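(* Let $\mathbf{D}=\{z\in\mathbb{C}:|z-\tfrac12|\leq\tfrac12\}$ and let $\mathsf{C}^{\omega}$ be the space of complex functions holomorphic on (a neighbourhood of) the closed disk $\mathbf{D}$, with the topology of uniform convergence on $\mathbf{D}$. Define $i:\mathbb{C}\to\mathsf{C}^{\omega}$ as the inclusion of constant functions, $\mathcal{L}:\mathsf{C}^{\omega}\to\mathsf{C}^{\omega}$ by $$[\mathcal{L}f](x)=f(x)-\sum_{n=1}^{\infty}2^{-n}f\Big(\frac{1}{x+n}\Big),$$ and $T:\mathsf{C}^{\omega}\to\mathbb{C}$ by $T(f)=\int_0^1 f(x)\,\mathrm{d}F(x)$. Then the sequence $$0\rightarrow\mathbb{C}\xrightarrow{\ i\ }\mathsf{C}^{\omega}\xrightarrow{\ \mathcal{L}\ }\mathsf{C}^{\omega}\xrightarrow{\ T\ }\mathbb{C}\rightarrow 0$$ is exact; that is, $i$ is injective, $\mathrm{Im}(i)=\mathrm{Ker}(\mathcal{L})$, $\mathrm{Im}(\mathcal{L})=\mathrm{Ker}(T)$, and $T$ is surjective.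
   Context: $F:[0,\infty)\to[0,1)$ is the Minkowski question mark function: if $x\geq 0$ has regular continued fraction expansion $x=[a_0;a_1,a_2,\dots]$, then $F(x)=1-2^{-a_0}+2^{-(a_0+a_1)}-2^{-(a_0+a_1+a_2)}+\cdots$, the series terminating for rational $x$. It is continuous and non-decreasing with $F(0)=0$, $F(1)=1/2$; $\mathrm{d}F$ denotes Lebesgue–Stieltjes integration. *)

(* Defs.v *)
From HB Require Import structures.
From mathcomp Require Import all_boot all_order all_algebra.
From mathcomp Require Import complex.
From mathcomp Require Import all_classical all_reals all_analysis.
From mathcomp Require Import measurable_realfun.
From mathcomp Require Import lra.
Set Implicit Arguments.
Unset Strict Implicit.
Unset Printing Implicit Defensive.
Import Order.TTheory GRing.Theory Num.Theory.
Import numFieldNormedType.Exports.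
Local Open Scope classical_set_scope.
Local Open Scope ring_scope.
Local Open Scope complex_scope.

Section minkowski.
Variable R : realType.
Implicit Types (x y : R) (k n : nat).

(* Regular continued fraction [a_0; a_1, ...] of x >= 0: the complete quotients
   are x_0 = x and x_(k+1) = 1 / (x_k - floor x_k), and a_k = floor x_k. *)
Definition cf_step x : R := (x - (Num.truncn x)%:R)^-1.
Definition cf_quot x k : R := iter k cf_step x.
Definition cf_digit x k : nat := Num.truncn (cf_quot x k).

(* The expansion stops before rank k, i.e. some complete quotient x_j with
   j < k is an integer (in particular, a_k does not exist). *)
Definition cf_over x k : bool :=
  [exists j : 'I_k, cf_quot x j == (cf_digit x j)%:R].

Definition qmark_term x k : R :=
  if cf_over x k then 0
  else (-1) ^+ k.+1 * 2 ^- (\sum_(j < k.+1) cf_digit x j).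

(* The question mark function on [0, +oo[. Its extension by 0 to the negative
   reals only serves to make it a cumulative function on R. *)
Definition qmark x : R :=
  if x < 0 then 0 else 1 + limn (series (qmark_term x)).

Let a x := Num.truncn x.
Let p n x := 1 + series (qmark_term x) n.

Let isint x := x == (a x)%:R.

Lemma cf_quotS x k : cf_quot x k.+1 = cf_quot (cf_step x) k.
Proof. by rewrite /cf_quot iterSr. Qed.

Lemma cf_overS x k : cf_over x k.+1 = isint x || cf_over (cf_step x) k.
Proof.
apply/existsP/orP.
  case=> -[[|j] jk]; first by left.
  rewrite /cf_digit [nat_of_ord _]/= cf_quotS => e; right; apply/existsP.
  by exists (Ordinal (jk : (j < k)%N)).
case=> [e|/existsP[j e]]; first by exists ord0.
by exists (lift ord0 j); rewrite /cf_digit cf_quotS.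
Qed.

Lemma qmark_term0 x : qmark_term x 0 = - 2 ^- (a x).
Proof.
rewrite /qmark_term ifF; first by rewrite big_ord1 expr1 mulN1r.
by apply/negbTE/existsP => -[[]].
Qed.

Lemma qmark_termS x k :
  qmark_term x k.+1 = if isint x then 0 else - 2 ^- (a x) * qmark_term (cf_step x) k.
Proof.
rewrite /qmark_term cf_overS; case: (isint x) => //=.
case: ifP => _; first by rewrite mulr0.
rewrite big_ord_recl exprD invfM exprS mulN1r !mulNr mulrCA.
congr (- (_ * _)). congr (_ * _).
by congr (2 ^- _); apply: eq_bigr => j _; rewrite /cf_digit cf_quotS.
Qed.

Let p0 x : p 0 x = 1.
Proof. by rewrite /p seriesEnat/= big_geq// addr0. Qed.

Let pS n x : p n.+1 x =
  if isint x then 1 - 2 ^- (a x) else 1 - 2 ^- (a x) * p n (cf_step x).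
Proof.
rewrite /p !seriesEnat/= big_nat_recl// qmark_term0; under eq_bigr do rewrite qmark_termS.
case: (isint x); first by rewrite big1 ?addr0.
by rewrite -big_distrr/=; lra.
Qed.

Let frac_itv x : 0 <= x -> 0 <= x - (a x)%:R < 1.
Proof.
move=> /truncn_itv; rewrite -/(a x) -(natr1 (a x)).
by move=> /andP[? ?]; apply/andP; split; lra.
Qed.

Let step_gt1 x : 0 <= x -> ~~ isint x -> 1 < cf_step x.
Proof.
move=> /frac_itv /andP[f0 f1] nx.
have f0' : 0 < x - (a x)%:R by rewrite lt_neqAle f0 andbT eq_sym subr_eq0.
by rewrite /cf_step invf_gt1.
Qed.

Let exp_gt0 n : 0 < 2 ^- n :> R.
Proof. by rewrite invr_gt0 exprn_gt0. Qed.
Let exp_le1 n : 2 ^- n <= 1 :> R.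
Proof. by rewrite invf_le1 ?exprn_gt0// exprn_ege1// ler1n. Qed.
Let exp_leh n : (0 < n)%N -> 2 ^- n <= 2^-1 :> R.
Proof.
case: n => // n _; rewrite exprS invfM.
by have := exp_le1 n; have := exp_gt0 n; lra.
Qed.
Let a_gt0 x : 1 <= x -> (0 < a x)%N.
Proof. by rewrite /a truncn_gt0. Qed.

Let p_itv n x : (0 <= x -> 0 <= p n x <= 1) /\ (1 <= x -> 2^-1 <= p n x).
Proof.
elim: n x => [|n IH] x; first by rewrite p0; split => *; lra.
have e1 := exp_le1 (a x); have e0 := exp_gt0 (a x).
rewrite pS; case: ifPn => ix.
  by split=> [x0|x1]; [|have := exp_leh (a_gt0 x1)]; lra.
have s (x0 : 0 <= x) : 0 <= p n (cf_step x) <= 1.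
  by apply: (IH _).1; have := step_gt1 x0 ix; lra.
split=> [/s /andP[s0 s1]|x1].
  have := mulr_ge0 (ltW e0) s0; have := ler_wpM2l (ltW e0) s1.
  by rewrite mulr1 => ? ?; apply/andP; split; lra.
have /s/andP[s0 s1] : 0 <= x by lra.
by have := ler_wpM2l (ltW e0) s1; have := exp_leh (a_gt0 x1); lra.
Qed.

Let p_mono n x y : 0 <= x -> x <= y -> p n x <= p n y.
Proof.
elim: n x y => [|n IH] x y x0 xy; first by rewrite !p0.
have y0 : 0 <= y by exact: le_trans xy.
have [axy|ayx|axy] := ltngtP (a x) (a y).
- have ey := exp_gt0 (a y).
  have e : 2 ^- (a y) <= 2 ^- (a x) * 2^-1 :> R.
    rewrite -invfM -exprSr lef_pV2 ?posrE ?exprn_gt0//.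
    by rewrite ler_eXn2l // ltr1n.
  have l : p n.+1 x <= 1 - 2 ^- (a x) * 2^-1.
    have e0 := exp_gt0 (a x).
    rewrite pS; case: ifPn => ix; first lra.
    have := ler_wpM2l (ltW e0) ((p_itv n _).2 (ltW (step_gt1 x0 ix))).
    lra.
  apply: (le_trans l); rewrite pS; case: ifPn => iy; first lra.
  have z0 : 0 <= cf_step y by have := step_gt1 y0 iy; lra.
  have /andP[_ u] := (p_itv n _).1 z0.
  by have := ler_wpM2l (ltW ey) u; lra.
- by move: ayx; rewrite ltnNge /a le_truncn.
- rewrite !pS /isint -axy; have e0 := exp_gt0 (a x).
  case: ifPn => ix; case: ifPn => iy //.
  + have z0 : 0 <= cf_step y.
      have iy' : ~~ isint y by rewrite /isint -axy.
      by have := step_gt1 y0 iy'; lra.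
    have /andP[_ u] := (p_itv n _).1 z0.
    by have := ler_wpM2l (ltW e0) u; lra.
  + have /andP[h _] := truncn_itv x0.
    by rewrite -(eqP iy) in ix h; rewrite eq_le xy h in ix.
  + rewrite lerD2l lerN2 ler_pM2l //.
    have iy' : ~~ isint y by rewrite /isint -axy.
    apply: IH; first by have := step_gt1 y0 iy'; lra.
    rewrite /cf_step -/(a x) -/(a y) -axy.
    have /andP[f0 _] := frac_itv x0; have f0x : 0 < x - (a x)%:R.
      by rewrite lt_neqAle f0 andbT eq_sym subr_eq0.
    by rewrite lef_pV2 ?posrE; lra.
Qed.

Lemma qmark_term_bound1 k x : 1 <= x -> `|qmark_term x k| <= 2 ^- k.+1.
Proof.
elim: k x => [|k IH] x x1; have e0 := exp_gt0 (a x); have := exp_leh (a_gt0 x1).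
  by rewrite qmark_term0 normrN (ger0_norm (ltW e0)) expr1.
rewrite qmark_termS; case: ifPn => ix eh; first by rewrite normr0 ltW ?exp_gt0.
rewrite mulNr normrN normrM (ger0_norm (ltW e0)) (exprS _ k.+1) invfM.
have x0 : 0 <= x by lra.
by rewrite ler_pM ?(ltW e0)// IH// ltW// step_gt1.
Qed.

Lemma qmark_term_bound k x : 0 <= x -> `|qmark_term x k| <= 2 ^- k.
Proof.
move=> x0; have e0 := exp_gt0 (a x); have e1 := exp_le1 (a x).
case: k => [|k].
  by rewrite qmark_term0 normrN (ger0_norm (ltW e0)) expr0 invr1.
rewrite qmark_termS; case: ifPn => ix; first by rewrite normr0 ltW ?exp_gt0.
rewrite mulNr normrN normrM (ger0_norm (ltW e0)) -[leRHS]mul1r.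
by rewrite ler_pM ?(ltW e0)// qmark_term_bound1// ltW// step_gt1.
Qed.

Lemma qmark_term_cvg x : 0 <= x -> cvgn (series (qmark_term x)).
Proof.
move=> x0; apply: normed_cvg.
apply: (@series_le_cvg _ _ (geometric 1 2^-1)) => [n|n|n|].
- by rewrite normr_ge0.
- by rewrite /= mul1r exprn_ge0// invr_ge0.
- by rewrite /= mul1r exprVn qmark_term_bound.
- by apply: is_cvg_geometric_series; rewrite ger0_norm; lra.
Qed.

Let p_cvg x : 0 <= x -> (p n x @[n --> \oo]) --> qmark x.
Proof.
move=> x0; rewrite /qmark ltNge x0 /=; apply: cvgD; first exact: cvg_cst.
exact: qmark_term_cvg.
Qed.

Lemma qmark_mono : {homo qmark : x y / x <= y}.
Proof.
move=> x y xy; have [x0|x0] := ltP x 0.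
  rewrite {1}/qmark x0; have [y0|y0] := ltP y 0; first by rewrite /qmark y0.
  rewrite -(cvg_lim (@Rhausdorff R) (p_cvg y0)); apply: limr_ge.
    by apply/cvg_ex; exists (qmark y); exact: p_cvg.
  by near=> n; have /andP[] := (p_itv n y).1 y0.
have y0 : 0 <= y by exact: le_trans xy.
rewrite -(cvg_lim (@Rhausdorff R) (p_cvg x0)) -(cvg_lim (@Rhausdorff R) (p_cvg y0)).
apply: ler_lim.
- by apply/cvg_ex; exists (qmark x); exact: p_cvg.
- by apply/cvg_ex; exists (qmark y); exact: p_cvg.
- by near=> n; exact: p_mono.
Unshelve. all: by end_near. Qed.

Lemma qmark_step x : 0 <= x -> qmark x =
  if isint x then 1 - 2 ^- (a x) else 1 - 2 ^- (a x) * qmark (cf_step x).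
Proof.
move=> x0; have h : p n.+1 x @[n --> \oo] --> qmark x.
  by have := p_cvg x0; rewrite -(@cvg_shiftS _ (p^~ x)).
rewrite -(cvg_lim (@Rhausdorff R) h); apply/cvg_lim; first exact: Rhausdorff.
under eq_fun do rewrite pS.
case: ifPn => ix; first exact: cvg_cst.
apply: cvgB; first exact: cvg_cst.
apply: cvgM; first exact: cvg_cst.
by apply: p_cvg; have := step_gt1 x0 ix; lra.
Qed.

Lemma qmark_itv x : 0 <= qmark x <= 1 /\ (1 <= x -> 2^-1 <= qmark x).
Proof.
have [x0|x0] := ltP x 0; first by rewrite /qmark x0; split => *; lra.
have h : cvgn (p^~ x) by apply/cvg_ex; exists (qmark x); exact: p_cvg.
rewrite -(cvg_lim (@Rhausdorff R) (p_cvg x0)); split; first apply/andP; first split.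
- by apply: limr_ge => //; near=> n; have /andP[] := (p_itv n x).1 x0.
- by apply: limr_le => //; near=> n; have /andP[] := (p_itv n x).1 x0.
- by move=> x1; apply: limr_ge => //; near=> n; exact: (p_itv n x).2.
Unshelve. all: by end_near. Qed.

Lemma qmark_lt1 x : qmark x < 1.
Proof.
have [x0|x0] := ltP x 0; first by rewrite /qmark x0.
rewrite qmark_step//; have e0 := exp_gt0 (a x).
case: ifPn => ix; first lra.
have := ler_wpM2l (ltW e0) ((qmark_itv _).2 (ltW (step_gt1 x0 ix))).
lra.
Qed.

Lemma qmark0 : qmark 0 = 0.
Proof. by rewrite qmark_step// /isint /a truncn0 eqxx expr0 invr1 subrr. Qed.

Lemma qmarkD1 x : 0 <= x -> qmark (x + 1) = (1 + qmark x) / 2.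
Proof.
move=> x0; have aS : a (x + 1) = (a x).+1.
  apply: truncn_def; have := truncn_itv x0.
  by rewrite -/(a x) -!natr1 => /andP[? ?]; apply/andP; split; lra.
have iS : isint (x + 1) = isint x by rewrite /isint aS -natr1 (inj_eq (addIr 1)).
have sS : cf_step (x + 1) = cf_step x.
  by rewrite /cf_step -/(a _) aS -natr1 -/(a x); congr (_^-1); lra.
rewrite (@qmark_step (x + 1)) ?addr_ge0// (@qmark_step x)// iS sS aS exprS invfM.
case: ifP => _; lra.
Qed.

Lemma qmark1 : qmark 1 = 2^-1.
Proof. by have := qmarkD1 (lexx 0); rewrite qmark0 add0r => ->; lra. Qed.

Lemma qmarkV x : 0 < x -> qmark x^-1 = 1 - qmark x.
Proof.
have h y : 0 < y < 1 -> qmark y^-1 = 1 - qmark y.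
  move=> /andP[y0 y1]; have ay : a y = 0.
    by apply: truncn_def; rewrite (ltW y0) y1.
  rewrite [qmark y]qmark_step ?ltW// /isint ay gt_eqF// expr0 invr1 mul1r.
  by rewrite /cf_step -/(a y) ay subr0; lra.
move=> x0; have [x1|x1|->] := ltgtP x 1.
- by apply: h; rewrite x0.
- have := h x^-1; rewrite invrK invr_gt0 x0 invf_lt1// x1 => /(_ isT); lra.
- by rewrite invr1 qmark1; lra.
Qed.

Lemma qmark_half x : 0 < x -> qmark (1 + x^-1)^-1 = qmark x / 2.
Proof.
move=> x0; have v0 : 0 < x^-1 by rewrite invr_gt0.
rewrite qmarkV ?addr_gt0// (addrC 1 x^-1) qmarkD1 ?ltW// qmarkV//; lra.
Qed.

Lemma qmark_dyadic n m : (m < 2 ^ n)%N -> exists2 x, 0 <= x & qmark x = m%:R / 2 ^+ n.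
Proof.
elim: n m => [|n IH] m.
  by case: m => // _; exists 0; rewrite // qmark0 mul0r.
have [mn _|nm mS] := ltnP m (2 ^ n).
  have [x x0 qx] := IH _ mn.
  have e : m%:R / 2 ^+ n.+1 = qmark x / 2 by rewrite qx exprS invfM; lra.
  rewrite e; move: x0; rewrite le_eqVlt => /predU1P[<-|x0].
    by exists 0; rewrite // qmark0 mul0r.
  exists (1 + x^-1)^-1; last exact: qmark_half.
  by rewrite invr_ge0 addr_ge0// invr_ge0 ltW.
have /IH[x x0 qx] : (m - 2 ^ n < 2 ^ n)%N.
  by rewrite ltn_subLR// addnn -mul2n -expnS.
exists (x + 1); first by rewrite addr_ge0.
rewrite qmarkD1// qx natrB// natrX exprS invfM mulrBl divff; first lra.
by rewrite expf_neq0.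
Qed.

Lemma qmark_rc x : qmark y @[y --> at_right x] --> qmark x.
Proof.
apply/cvgrPdist_le => e e0.
suff [y xy qy] : exists2 y, x < y & qmark y <= qmark x + e.
  near=> z; have xz : x <= z by near: z; exact: nbhs_right_ge.
  have zy : z <= y by near: z; exact: nbhs_right_le.
  have := qmark_mono xz; have := qmark_mono zy.
  by move=> h1 h2; rewrite ler_norml; apply/andP; split; lra.
have [q0 _] := qmark_itv x; have q1 := qmark_lt1 x.
pose d := Num.min e (1 - qmark x).
have d0 : 0 < d by rewrite lt_min e0; lra.
have [n nd] : exists n, 2 ^- n < d :> R.
  have [n h] : exists n, d^-1 < n%:R by exists (Num.bound d^-1); rewrite archi_boundP// invr_ge0 ltW.
  exists n; rewrite invf_plt ?posrE ?exprn_gt0//; apply: (lt_trans h).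
  by rewrite -natrX ltr_nat ltn_expl.
have t0 : 0 < 2 ^+ n :> R by rewrite exprn_gt0.
have q20 : 0 <= qmark x * 2 ^+ n by rewrite mulr_ge0 ?(ltW t0)//; case/andP: q0.
pose m := (Num.truncn (qmark x * 2 ^+ n)).+1.
have /andP[m1 m2] := truncn_itv q20.
have hm : m%:R / 2 ^+ n <= qmark x + 2 ^- n.
  by rewrite ler_pdivrMr// mulrDl mulVf ?gt_eqF// /m -natr1 lerD2r.
have hm' : qmark x < m%:R / 2 ^+ n by rewrite ltr_pdivlMr.
have dm : d <= e /\ d <= 1 - qmark x by rewrite /d !ge_min !lexx orbT.
have /qmark_dyadic[y y0 qy] : (m < 2 ^ n)%N.
  rewrite -(ltr_nat R) natrX -[ltRHS]mul1r -ltr_pdivrMr//; lra.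
exists y; last by rewrite qy; lra.
by rewrite ltNge; apply/negP => /qmark_mono; rewrite qy; lra.
Unshelve. all: by end_near. Qed.

HB.instance Definition _ := isCumulative.Build R _ R qmark qmark_mono qmark_rc.

End minkowski.

Section holomorphic_on_disk.
Variable R : realType.
Local Notation C := (R[i]^o).
Implicit Types (x : R) (z w : C).

Definition disk : set C := [set z | `|z - 2^-1| <= 2^-1].

(* Functions on the closed disk that extend to a function which is complex
   differentiable on an open set containing it: [derivable] is taken over the
   field R[i], so the difference quotients have complex increments. *)
Definition holomorphic_on_disk (f : disk -> C) : Prop :=
  exists (U : set C) (g : C -> C),
    [/\ open U, disk `<=` U, forall z, U z -> derivable g z 1 &
        forall z : disk, f z = g (val z)].

Definition Comega_pred : {pred disk -> C} :=
  [pred f | `[< holomorphic_on_disk f >]].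

Fact Comega_submod_closed : submod_closed Comega_pred.
Proof.
split.
  by apply/asboolP; exists setT, (cst 0); split=> //; exact: openT.
move=> a f g /asboolP[U [f' [oU DU df ff']]] /asboolP[V [g' [oV DV dg gg']]].
apply/asboolP; exists (U `&` V), (a *: f' + g'); split.
- exact: openI.
- by move=> z Dz; split; [exact: DU|exact: DV].
- move=> z [Uz Vz]; apply: derivableD; last exact: dg.
  by apply: derivableZ; exact: df.
- by move=> z; rewrite !fctE ff' gg'.
Qed.

HB.instance Definition _ :=
  GRing.isSubmodClosed.Build R[i] (disk -> C) Comega_pred Comega_submod_closed.

(* The space of holomorphic functions on the closed disk; its elements are
   functions on the disk itself, so that equality is equality on the disk. *)
Definition Comega := {f : disk -> C | Comega_pred f}.

HB.instance Definition _ := SubChoice.on Comega.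
HB.instance Definition _ := [SubChoice_isSubLmodule of Comega by <:].
HB.instance Definition _ := Topological.copy Comega
  (initial_topology (val : Comega -> {uniform disk -> C})).

Definition Comega_fun (f : Comega) : disk -> C := val f.
Coercion Comega_fun : Comega >-> Funclass.

Lemma cst_holomorphic (c : C) : Comega_pred (fun=> c).
Proof. by apply/asboolP; exists setT, (cst c); split=> //; exact: openT. Qed.

Definition cst_incl (c : C) : Comega :=
  exist _ (fun=> c) (cst_holomorphic c).

Fact cst_incl_linear : linear cst_incl.
Proof. by move=> a c d; apply/val_inj/funext. Qed.

HB.instance Definition _ :=
  GRing.isLinear.Build R[i] C Comega *:%R cst_incl cst_incl_linear.

Let half_complex : 2^-1 = 2^-1%:C :> R[i].
Proof. by rewrite fmorphV rmorph_nat. Qed.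

Lemma disk_Re_ge0 z : disk z -> 0 <= complex.Re z.
Proof.
move=> Dz; have := le_trans (normc_ge_Re _) Dz.
rewrite half_complex lecR; case: z {Dz} => u v /=.
by rewrite ler_norml => /andP[h _]; lra.
Qed.

Lemma disk_inv z n : disk z -> disk (z + n.+1%:R)^-1.
Proof.
move=> /disk_Re_ge0 z0; set w := z + _.
have w1 : 1 <= complex.Re w.
  have n1 : 1 <= n.+1%:R :> R by rewrite ler1n.
  by rewrite /w -(rmorph_nat (real_complex R)); case: (z) z0 => u v /=; lra.
have wn0 : w != 0.
  by apply/eqP => w0; move: w1; rewrite w0 /=; lra.
have le2 : `|2 - w| <= `|w|.
  rewrite -(@ler_pXn2r _ 2)// ?nnegrE ?normr_ge0// -!add_Re2_Im2 lecR.
  rewrite -(rmorph_nat (real_complex R)); case: (w) w1 => u v /= u1.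
  by nra.
rewrite /disk /=.
have -> : w^-1 - 2^-1 = (2 - w) / (2 * w).
  have n2 : (2 : R[i]) != 0 by rewrite pnatr_eq0.
  rewrite mulrBl invfM mulrA divff// mul1r mulrCA.
  by rewrite divff// mulr1.
rewrite normrM normfV normrM (ger0_norm (ler0n _ 2)) invfM mulrCA ler_piMr//.
by rewrite ler_pdivrMr ?normr_gt0// mul1r.
Qed.

(* The point 1 / (z + (n + 1)) of the disk: the index is shifted by one. *)
Definition gauss_pt (z : disk) (n : nat) : disk :=
  exist (fun w => w \in disk) _ (mem_set (disk_inv n (set_valP z))).

Definition calL (f : Comega) (z : disk) : C :=
  f z - limn (series (fun n => 2 ^- n.+1 * f (gauss_pt z n))).

(* Restriction to the real axis of a function on the disk, extended by 0. *)
Definition on_real (f : disk -> C) (x : R) : C := 'valL_ 0 f x%:C.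

Definition Stieltjes (u : R -> R) : R :=
  \int[lebesgue_stieltjes_measure (@qmark R)]_(x in `[0, 1]) u x.

Definition calT (f : Comega) : C :=
  Stieltjes (fun x => complex.Re (on_real f x)) +i*
  Stieltjes (fun x => complex.Im (on_real f x)).

Local Notation mu := (lebesgue_stieltjes_measure (@qmark R)).

Let mu_fin : (mu `[0%R, 1%R] < +oo)%E.
Proof.
apply: (@le_lt_trans _ _ (mu `]-1, 1%R])).
  apply: le_measure; rewrite ?inE; [exact: measurable_itv..|].
  by apply: subset_itvr => //=; rewrite bnd_simp; lra.
rewrite /lebesgue_stieltjes_measure /measure_extension measurable_mu_extE/=.
  by rewrite wlength_itv_bnd ?ltry//; lra.
by apply: is_ocitv.
Qed.

Let Re_cts : continuous ((fun w => complex.Re w) : C -> R).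
Proof.
move=> z; apply/(@cvgrPdist_le _ _ _ (nbhs z)) => e e0.
have e0' : 0 < e%:C :> R[i] by rewrite ltcR.
have FF : Filter (nbhs z) := @nbhs_filter C z.
have h := @cvgr_dist_le _ C _ (nbhs z) _ id z cvg_id _ e0'.
near=> w; have zw : `|z - w| <= e%:C by near: w; exact: h.
rewrite -lecR; apply: le_trans zw.
by rewrite -raddfB; exact: normc_ge_Re.
Unshelve. all: by end_near. Qed.

Let Im_cts : continuous ((fun w => complex.Im w) : C -> R).
Proof.
move=> z; apply/(@cvgrPdist_le _ _ _ (nbhs z)) => e e0.
have e0' : 0 < e%:C :> R[i] by rewrite ltcR.
have FF : Filter (nbhs z) := @nbhs_filter C z.
have h := @cvgr_dist_le _ C _ (nbhs z) _ id z cvg_id _ e0'.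
near=> w; have zw : `|z - w| <= e%:C by near: w; exact: h.
rewrite -lecR; apply: le_trans zw.
rewrite -raddfB -normrN -ReiNIm; apply: le_trans (normc_ge_Re _) _.
have i1 : `|'i%C| = 1 :> R[i].
  by rewrite normc_def/= expr0n expr1n add0r sqrtr1.
by rewrite normrM i1 mulr1.
Unshelve. all: by end_near. Qed.

Let real_cts : continuous ((fun x => x%:C) : R -> C).
Proof.
move=> x; apply/(@cvgrPdist_le _ C) => e e0.
have [r re] : exists r, e = r%:C.
  by exists (complex.Re e); rewrite RRe_real// gtr0_real.
move: e0; rewrite re ltcR => r0.
have h := @cvgr_dist_le _ R _ (nbhs x) _ id x cvg_id _ r0.
near=> y; have xy : `|x - y| <= r by near: y; exact: h.
by rewrite -rmorphB normc_def/= expr0n addr0 sqrtr_sqr lecR.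
Unshelve. all: by end_near. Qed.

Let real_disk x : `[0, 1]%classic x -> disk x%:C.
Proof.
rewrite /= in_itv/= => /andP[x0 x1].
rewrite /disk/= half_complex -rmorphB normc_def/= expr0n addr0 sqrtr_sqr lecR.
by rewrite ler_norml; apply/andP; split; lra.
Qed.

Lemma on_realE (f : disk -> C) (z : disk) x : val z = x%:C -> on_real f x = f z.
Proof. by move=> zx; rewrite /on_real -zx -[in RHS](valLK 0 f). Qed.

Let part_integrable (h : C -> R) (f : Comega) : continuous h ->
  mu.-integrable `[0, 1] (EFin \o (fun x => h (on_real f x))).
Proof.
move=> ch; have /asboolP[U [g [_ DU dg fg]]] := valP f.
have cg : {within `[0, 1], continuous (fun x => h (g x%:C))}.
  apply: continuous_in_subspaceT => x /set_mem /real_disk /DU /dg.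
  move=> /derivable1_diffP /differentiable_continuous cgx.
  apply: (@continuous_comp R C R (fun y => g y%:C)); last exact: ch.
  by apply: (@continuous_comp R C C (fun y => y%:C)); [exact: real_cts|].
have mI : measurable (`[0, 1]%classic : set (measurableTypeR R)).
  exact: measurable_itv.
apply: (@eq_integrable _ _ _ mu _ mI (EFin \o (fun x => h (g x%:C)))).
  move=> x /set_mem /real_disk Dx; congr (h _)%:E.
  by rewrite (@on_realE _ (exist (fun w => w \in disk) _ (mem_set Dx))).
apply: measurable_bounded_integrable => //.
- by apply: subspace_continuous_measurable_fun => //; exact: measurable_itv.
- have /compact_bounded[M [_ mrt]] :=
    continuous_compact cg (@segment_compact _ _ _).
  exists M; split; rewrite ?num_real // => N MN x Ix.
  by apply: (mrt _ MN); exists x.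
Qed.

Let on_real_linear (c : C) (f g : disk -> C) x :
  on_real (c *: f + g) x = c * on_real f x + on_real g x.
Proof.
by rewrite /on_real /valL_ /=; case: ('oinv_ _ _) => //=; rewrite mulr0 addr0.
Qed.

Fact calT_linear : linear calT.
Proof.
have mI : measurable (`[0, 1]%classic : set (measurableTypeR R)).
  exact: measurable_itv.
have iZ (r : R) (u : R -> R) : mu.-integrable `[0, 1] (EFin \o u) ->
    mu.-integrable `[0, 1] (EFin \o (fun x => r * u x)).
  by move=> iu; exact: (integrableZl mI r iu).
have iD (u v : R -> R) : mu.-integrable `[0, 1] (EFin \o u) ->
    mu.-integrable `[0, 1] (EFin \o v) ->
    mu.-integrable `[0, 1] (EFin \o (fun x => u x + v x)).
  by move=> iu iv; exact: (integrableD mI iu iv).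
have StD (r s : R) (u v w : R -> R) : mu.-integrable `[0, 1] (EFin \o u) ->
    mu.-integrable `[0, 1] (EFin \o v) -> mu.-integrable `[0, 1] (EFin \o w) ->
    Stieltjes (fun x => r * u x + s * v x + w x) =
    r * Stieltjes u + s * Stieltjes v + Stieltjes w.
  move=> iu iv iw; rewrite /Stieltjes RintegralD//; last by apply: iD; exact: iZ.
  by rewrite RintegralD//; [|exact: iZ..]; rewrite !RintegralZl.
move=> [a b] f g.
have [fR fI] := (part_integrable f Re_cts, part_integrable f Im_cts).
have [gR gI] := (part_integrable g Re_cts, part_integrable g Im_cts).
have -> : calT ((a +i* b) *: f + g) =
  (a * Stieltjes (fun x => complex.Re (on_real (val f) x))
    + - b * Stieltjes (fun x => complex.Im (on_real (val f) x))
    + Stieltjes (fun x => complex.Re (on_real (val g) x))) +i*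
  (a * Stieltjes (fun x => complex.Im (on_real (val f) x))
    + b * Stieltjes (fun x => complex.Re (on_real (val f) x))
    + Stieltjes (fun x => complex.Im (on_real (val g) x))).
  rewrite -!StD// /calT; congr (Stieltjes _ +i* Stieltjes _); apply/funext => x;
    rewrite [Comega_fun _](_ : _ = (a +i* b : C) *: val f + val g)// on_real_linear.
    by case: (on_real _ x) (on_real _ x) => [? ?] [? ?] /=; rewrite mulNr.
  by case: (on_real _ x) (on_real _ x) => [? ?] [? ?].
by rewrite /calT mulNr.
Qed.

HB.instance Definition _ :=
  GRing.isLinear.Build R[i] Comega C *:%R calT calT_linear.

End holomorphic_on_disk.

Arguments disk : clear implicits.
Arguments cst_incl : clear implicits.

(* Main.v *)
Require Import Defs.
From HB Require Import structures.
From mathcomp Require Import all_boot all_order all_algebra.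
From mathcomp Require Import complex.
From mathcomp Require Import all_classical all_reals all_analysis.
From mathcomp Require Import measurable_realfun ring lra.
Set Implicit Arguments.
Unset Strict Implicit.
Unset Printing Implicit Defensive.
Import Order.TTheory GRing.Theory Num.Theory.
Import numFieldNormedType.Exports.
Local Open Scope classical_set_scope.
Local Open Scope ring_scope.

(* Write [G f (z) = \sum_(n >= 1) 2^-n f (1 / (z + n))], so that [L f = f - G f].

   A function holomorphic near the disk is Lipschitz on a neighbourhood [V] of
   the disk that every map [1 / (z + n)] sends into itself. On such a [V] the
   operator [G] multiplies Lipschitz constants by at most 4/5, because
   [\sum_n 2^-n / n^2 < 1]. Hence a fixed point of [G] is constant, which gives
   the kernel. The functional equations of the question mark function give
   [T (G f) = T f], so [T] vanishes on the image; and if [T g = 0], then every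
   [G^k g] has mean zero, hence is bounded by a multiple of its Lipschitz
   constant, and [\sum_k G^k g] converges to a solution of [f - G f = g].

   Holomorphic means differentiable at each point, so the local Lipschitz bound
   needs Goursat's theorem: the integral of the difference quotient
   [(f z - f a) / (z - a)] around a square vanishes for each interior [a], and
   comparing two values of [a] bounds [f a - f b]. Sums of series are then
   holomorphic because functions differentiable in the complex sense are closed
   under limits in the Lipschitz seminorm. *)

(** * Complex differentiability *)

(** In the uniform norm [G] is no contraction, since it fixes the constants. The Lipschitz seminorm
    is blind to exactly these, and [Ker T] is a complement to them because [T 1 = 1/2]. The
    contraction is strict although the branch [1 / (z + 1)] has a derivative of modulus 1 at 0: this
    branch carries only half of the total weight. The slack lets the region reach a little to the
    left of 0, and such room is forced by the space, whose members must be differentiable on an open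
    set containing the disk. The kernel equation, in contrast, is known on the disk only; the disk
    is itself stable under every branch, so the same estimates are run there.

    Integrals are taken against an arbitrary cumulative function: the identity gives the contour
    integrals of Goursat's theorem, the question mark function gives [T]. The modulus [nc] takes
    values in [R] rather than [R[i]], so that all estimates are inequalities between reals. *)

Notation nc := ComplexField.Normc.normc.

Section complex_norm.
Local Open Scope complex_scope.
Variable R : realType.
Implicit Types (x y e : R) (z w d : R[i]).

Lemma nc_ge0 z : 0 <= nc z.
Proof. by case: z => a b; exact: sqrtr_ge0. Qed.

Lemma nc0 : nc (0 : R[i]) = 0. Proof. exact: ComplexField.Normc.normc0. Qed.

Lemma ncN z : nc (- z) = nc z.
Proof. exact: normcN. Qed.

Lemma ncM z w : nc (z * w) = nc z * nc w.
Proof. exact: ComplexField.Normc.normcM. Qed.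

Lemma ncV z : nc z^-1 = (nc z)^-1.
Proof. exact: ComplexField.Normc.normcV. Qed.

Lemma ncD z w : nc (z + w) <= nc z + nc w.
Proof. exact: le_normcD. Qed.

Lemma ncB z w : nc (z - w) = nc (w - z).
Proof. by rewrite -ncN opprB. Qed.

Lemma nc_tri (v z w : R[i]) : nc (z - w) <= nc (z - v) + nc (v - w).
Proof. by have := ncD (z - v) (v - w); rewrite addrA subrK. Qed.

Lemma nc_eq0 z : (nc z == 0) = (z == 0).
Proof.
by apply/eqP/eqP => [/ComplexField.Normc.eq0_normc//|->]; exact: nc0.
Qed.

Lemma nc_gt0 z : (0 < nc z) = (z != 0).
Proof. by rewrite lt_neqAle nc_ge0 andbT eq_sym nc_eq0. Qed.

Lemma nc_real x : nc x%:C = `|x|.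
Proof. by rewrite /= expr0n addr0 sqrtr_sqr. Qed.

Lemma nc_nat n : nc (n%:R : R[i]) = n%:R.
Proof. by rewrite -(rmorph_nat (real_complex R)) nc_real ger0_norm. Qed.

Lemma nc_i : nc ('i : R[i]) = 1.
Proof. by rewrite /= expr0n add0r expr1n sqrtr1. Qed.

Lemma nc_exp2 n : nc (2 ^- n : R[i]) = 2 ^- n.
Proof.
rewrite ncV; congr (_^-1); elim: n => [|n IH]; first by rewrite !expr0 (nc_nat 1).
by rewrite !exprS ncM IH nc_nat.
Qed.

Lemma ReB z w : complex.Re (z - w) = complex.Re z - complex.Re w.
Proof. by case: z w => [? ?] [? ?]. Qed.

Lemma ImB z w : complex.Im (z - w) = complex.Im z - complex.Im w.
Proof. by case: z w => [? ?] [? ?]. Qed.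

Lemma nc_Re z : `|complex.Re z| <= nc z.
Proof.
case: z => a b /=; rewrite -sqrtr_sqr ler_sqrt ?addr_ge0 ?sqr_ge0//.
by rewrite lerDl sqr_ge0.
Qed.

Lemma nc_Im z : `|complex.Im z| <= nc z.
Proof.
case: z => a b /=; rewrite -sqrtr_sqr ler_sqrt ?addr_ge0 ?sqr_ge0//.
by rewrite lerDr sqr_ge0.
Qed.

Lemma nc_le z : nc z <= `|complex.Re z| + `|complex.Im z|.
Proof.
rewrite {1}[z]complexE; apply: le_trans (ncD _ _) _.
by rewrite ncM nc_i mul1r !nc_real.
Qed.

Lemma lt0_real (e : R[i]) : 0 < e -> exists2 r : R, 0 < r & e = r%:C.
Proof.
move=> e0; exists (complex.Re e); last by rewrite RRe_real// gtr0_real.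
by move: e0; rewrite ltcE => /andP[].
Qed.

(** Since [R[i]] is normed over itself, its balls have radii in [R[i]]; a positive radius is real,
    which gives neighbourhoods a description by real radii. *)
Lemma nbhs_cP (z : R[i]^o) (A : set R[i]^o) :
  nbhs z A <-> exists2 r : R, 0 < r & forall w, nc (w - z) < r -> A w.
Proof.
split=> [/nbhs_ballP[e /= e0 eA]|[r r0 rA]].
  have [r r0 er] := lt0_real e0; exists r => // w wz.
  apply: eA; rewrite -ball_normE /= er.
  by change (is_true ((nc (z - w))%:C < r%:C)); rewrite ltcR ncB.
apply/nbhs_ballP; exists r%:C => /=; first by rewrite ltcR.
move=> w; rewrite -ball_normE /= => zw; apply: rA.
by change (is_true ((nc (z - w))%:C < r%:C)) in zw; rewrite ltcR in zw; rewrite ncB.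
Qed.

Lemma cvg_cP T (F : set_system T) (FF : Filter F) (f : T -> R[i]^o) (l : R[i]^o) :
  (f @ F --> l) <-> forall e, 0 < e -> \forall t \near F, nc (f t - l) < e.
Proof.
split=> [fl e e0|fl A /nbhs_cP[r r0 rA]].
  by apply: (fl (fun w => nc (w - l) < e)); apply/nbhs_cP; exists e.
by apply: filterS (fl r r0) => t; exact: rA.
Qed.

(** The difference quotient is multiplied out, so that [w = z] needs no exception. *)
Definition cdiff (g : R[i] -> R[i]) z d := forall e, 0 < e ->
  exists2 r, 0 < r &
    forall w, nc (w - z) < r -> nc (g w - g z - d * (w - z)) <= e * nc (w - z).

Lemma derivable_cdiff (g : R[i]^o -> R[i]^o) (z : R[i]^o) :
  derivable g z 1 <-> exists d, cdiff g z d.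
Proof.
split=> [/cvg_ex[d /= /cvg_cP dg]|[d dg]].
  exists d => e e0; have := dg e e0.
  move=> /nbhs_cP[r /= r0 H]; exists r => // w wz.
  have [->|wz0] := eqVneq w z; first by rewrite !subrr mulr0 subrr nc0 mulr0.
  have wz1 : w - z != 0 by rewrite subr_eq0.
  have := H (w - z); rewrite subr0 => /(_ wz wz1).
  rewrite /GRing.scale /= mulr1 subrK => /ltW le.
  have -> : g w - g z - d * (w - z) = ((w - z)^-1 * (g w - g z) - d) * (w - z).
    by field.
  by rewrite ncM ler_wpM2r ?nc_ge0.
apply/cvg_ex; exists d; apply/cvg_cP => e e0.
(* Half of [e], because [cdiff] gives [<=] and the limit asks for [<]. *)
have [r r0 H] := dg (e / 2) ltac:(lra).
apply/nbhs_cP; exists r => //= h; rewrite subr0 => hr h0.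
have := H (z + h); rewrite addrC addrA addNr add0r => /(_ hr) le.
rewrite /GRing.scale /= mulr1 (addrC h z).
have -> : h^-1 * (g (z + h) - g z) - d = h^-1 * (g (z + h) - g z - d * h).
  by field.
rewrite ncM ncV mulrC ltr_pdivrMr ?nc_gt0//.
by apply: le_lt_trans le _; rewrite ltr_pM2r ?nc_gt0//; lra.
Qed.

Definition ccont (g : R[i] -> R[i]) z := forall e, 0 < e ->
  exists2 r, 0 < r & forall w, nc (w - z) < r -> nc (g w - g z) <= e.

Lemma cdiff_lip g z d : cdiff g z d -> exists2 r, 0 < r &
  forall w, nc (w - z) < r -> nc (g w - g z) <= (nc d + 1) * nc (w - z).
Proof.
move=> /(_ _ ltr01)[r r0 H]; exists r => // w wz.
have := H _ wz; have := ncD (g w - g z - d * (w - z)) (d * (w - z)).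
by rewrite subrK ncM; nra.
Qed.

Lemma cdiff_cont g z d : cdiff g z d -> ccont g z.
Proof.
move=> /cdiff_lip[r r0 H] e e0.
have d0 : 0 < nc d + 1 by have := nc_ge0 d; lra.
exists (Num.min r (e / (nc d + 1))); first by rewrite lt_min r0 divr_gt0.
move=> w; rewrite lt_min => /andP[wr we]; apply: le_trans (H w wr) _.
by move: we; rewrite ltr_pdivlMr// mulrC => /ltW.
Qed.

Lemma cdiffD f g z d d' : cdiff f z d -> cdiff g z d' ->
  cdiff (fun w => f w + g w) z (d + d').
Proof.
move=> df dg e e0; have e2 : 0 < e / 2 by lra.
have [r r0 H] := df _ e2; have [s s0 K] := dg _ e2.
exists (Num.min r s); first by rewrite lt_min r0.
move=> w; rewrite lt_min => /andP[/H h1 /K h2].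
have -> : f w + g w - (f z + g z) - (d + d') * (w - z) =
  (f w - f z - d * (w - z)) + (g w - g z - d' * (w - z)) by ring.
by apply: le_trans (ncD _ _) _; lra.
Qed.

Lemma cdiff_cst c z : cdiff (fun=> c) z 0.
Proof. by move=> e e0; exists 1 => // w _; rewrite subrr mul0r subrr nc0 mulr_ge0 ?nc_ge0 ?ltW. Qed.

Lemma cdiff_id z : cdiff id z 1.
Proof. by move=> e e0; exists 1 => // w _; rewrite mul1r subrr nc0 mulr_ge0 ?nc_ge0 ?ltW. Qed.

Lemma cdiff_comp f g z d d' : cdiff g z d -> cdiff f (g z) d' ->
  cdiff (f \o g) z (d' * d).
Proof.
move=> dg df e e0; have [s s0 L] := cdiff_lip dg.
(* The added 1 keeps the divisors below positive when a derivative vanishes. *)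
have Kd : 0 < nc d + 1 by have := nc_ge0 d; lra.
have Kd' : 0 < nc d' + 1 by have := nc_ge0 d'; lra.
have [t t0 F] := df (e / 2 / (nc d + 1)) ltac:(rewrite !divr_gt0//).
have [r r0 G] := dg (e / 2 / (nc d' + 1)) ltac:(rewrite !divr_gt0//).
exists (Num.min r (Num.min s (t / (nc d + 1)))).
  by rewrite !lt_min r0 s0 divr_gt0.
move=> w; rewrite !lt_min => /and3P[/G wr /L ws wt].
have /F {}F : nc (g w - g z) < t.
  by apply: le_lt_trans ws _; rewrite mulrC -ltr_pdivlMr.
have -> : (f \o g) w - (f \o g) z - d' * d * (w - z) =
  (f (g w) - f (g z) - d' * (g w - g z)) + d' * (g w - g z - d * (w - z)).
  by rewrite /=; ring.
apply: le_trans (ncD _ _) _; rewrite ncM.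
have h1 : nc (f (g w) - f (g z) - d' * (g w - g z)) <= e / 2 * nc (w - z).
  apply: le_trans F _; rewrite -mulrA ler_pM2l; last by lra.
  by rewrite mulrC ler_pdivrMr// mulrC.
have h2 : nc d' * nc (g w - g z - d * (w - z)) <= e / 2 * nc (w - z).
  apply: le_trans (_ : (nc d' + 1) * (e / 2 / (nc d' + 1) * nc (w - z)) <= _).
    by apply: ler_pM; rewrite ?nc_ge0//; lra.
  by rewrite mulrA mulrCA divff ?gt_eqF// mulr1.
lra.
Qed.

Lemma cdiffM f g z d d' : cdiff f z d -> cdiff g z d' ->
  cdiff (fun w => f w * g w) z (d * g z + f z * d').
Proof.
move=> df dg.
(* The product of the two increments is of higher order: one factor is at most a multiple of
   [nc (w - z)], the other tends to 0. *)
have h e : 0 < e -> exists2 r, 0 < r & forall w, nc (w - z) < r ->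
    nc ((f w - f z) * (g w - g z)) <= e * nc (w - z).
  move=> e0; have [s s0 L] := cdiff_lip df.
  have Kd : 0 < nc d + 1 by have := nc_ge0 d; lra.
  have [r r0 G] := cdiff_cont dg (divr_gt0 e0 Kd).
  exists (Num.min r s); first by rewrite lt_min r0.
  move=> w; rewrite lt_min => /andP[/G wr /L ws]; rewrite ncM.
  apply: le_trans (ler_pM (nc_ge0 _) (nc_ge0 _) ws wr) _.
  by rewrite le_eqVlt; apply/orP; left; apply/eqP; field; rewrite gt_eqF.
move=> e e0; have e3 : 0 < e / 3 by lra.
have Kf : 0 < nc (f z) + 1 by have := nc_ge0 (f z); lra.
have Kg : 0 < nc (g z) + 1 by have := nc_ge0 (g z); lra.
have [r r0 H] := h _ e3.
have [s s0 F] := df _ (divr_gt0 e3 Kg); have [t t0 G] := dg _ (divr_gt0 e3 Kf).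
exists (Num.min r (Num.min s t)); first by rewrite !lt_min r0 s0.
move=> w; rewrite !lt_min => /and3P[/H {}H /F {}F /G {}G].
have -> : f w * g w - f z * g z - (d * g z + f z * d') * (w - z) =
  (f w - f z) * (g w - g z) + ((f w - f z - d * (w - z)) * g z +
   (g w - g z - d' * (w - z)) * f z) by ring.
have mul (u k : R[i]) (q : R) : nc u <= e / 3 / (nc k + 1) * q -> 0 <= q ->
    nc (u * k) <= e / 3 * q.
  move=> uk q0; rewrite ncM.
  have k1 : 0 < nc k + 1 by have := nc_ge0 k; lra.
  have /(ler_pM (nc_ge0 _) (nc_ge0 _) uk) : nc k <= nc k + 1 by lra.
  by move/le_trans; apply; rewrite le_eqVlt; apply/orP; left; apply/eqP; field; rewrite gt_eqF.
have mF := mul _ _ _ F (nc_ge0 _); have mG := mul _ _ _ G (nc_ge0 _).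
apply: le_trans (ncD _ _) _.
by have := ncD ((f w - f z - d * (w - z)) * g z) ((g w - g z - d' * (w - z)) * f z); lra.
Qed.

Lemma cdiffV z : z != 0 -> cdiff (fun w => w^-1) z (- z ^- 2).
Proof.
move=> z0 e e0; have zp : 0 < nc z by rewrite nc_gt0.
(* The first radius keeps [nc w] above [nc z / 2]; the second then bounds the remainder factor
   [nc (w - z) / (nc w * nc z ^+ 2)] by [e]. *)
exists (Num.min (nc z / 2) (e * nc z ^+ 3 / 2)).
  by rewrite lt_min !divr_gt0// mulr_gt0// exprn_gt0.
move=> w; rewrite lt_min => /andP[wz we].
have hw : nc z / 2 <= nc w by have := ncD w (z - w); rewrite addrC subrK ncB; lra.
have w0 : w != 0 by rewrite -nc_gt0; lra.
have -> : w^-1 - z^-1 - - z ^- 2 * (w - z) = (w - z) * ((w - z) * (w^-1 * z ^- 2)).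
  by field; rewrite z0 w0.
rewrite ncM mulrC ler_wpM2r ?nc_ge0// !ncM !ncV expr2 ncM.
have wp : 0 < nc w by rewrite nc_gt0.
rewrite -invfM ler_pdivrMr ?mulr_gt0//.
apply: le_trans (ltW we) _; rewrite -mulrA ler_pM2l// !exprS expr0 mulr1.
have : 0 < nc z * nc z by rewrite mulr_gt0.
nra.
Qed.

(* Complete the two components separately: [R[i]] carries no complete
   structure. *)
Lemma geometric_limit (u : nat -> R[i]) (e : nat -> R) : e @ \oo --> 0 ->
  (forall n m, (n <= m)%N -> nc (u m - u n) <= e n) ->
  exists l, forall n, nc (l - u n) <= e n.
Proof.
move=> e0 ue.
have cau (h : R[i] -> R) : (forall z w, `|h z - h w| <= nc (z - w)) ->
    exists l : R, (fun n => h (u n)) @ \oo --> l.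
  move=> hh; suff c : cvgn (fun n => h (u n)) by exists (limn (fun n => h (u n))).
  apply/cauchy_cvgP/cauchy_exP => r r0.
  have /cvgrPdist_lt/(_ r r0)[N _ /(_ N (leqnn N)) /= eN] := e0.
  exists (h (u N)), N => // n /= Nn.
  rewrite -ball_normE /=; apply: le_lt_trans (hh _ _) _; rewrite ncB.
  apply: le_lt_trans (ue _ _ Nn) _; move: eN; rewrite sub0r normrN.
  by apply: le_lt_trans; exact: ler_norm.
have [a ua] : exists a : R, (fun n => complex.Re (u n)) @ \oo --> a.
  by apply: cau => z w; rewrite -ReB; exact: nc_Re.
have [b ub] : exists b : R, (fun n => complex.Im (u n)) @ \oo --> b.
  by apply: cau => z w; rewrite -ImB; exact: nc_Im.
exists (a +i* b) => n; apply/ler_addgt0Pr => r r0.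
have r2 : 0 < r / 2 by lra.
have /cvgrPdist_lt/(_ _ r2)[N _ Na] := ua.
have /cvgrPdist_lt/(_ _ r2)[M _ Mb] := ub.
set m := maxn n (maxn N M).
have nm : (n <= m)%N by rewrite leq_maxl.
have /Na ha : (N <= m)%N by rewrite !leq_max leqnn orbT.
have /Mb hb : (M <= m)%N by rewrite !leq_max leqnn !orbT.
apply: le_trans (nc_tri (u m) _ _) _; rewrite addrC lerD ?ue//.
apply: le_trans (nc_le _) _; rewrite ReB ImB /=.
by move: ha hb => /=; lra.
Qed.

Definition lip_on (V : set R[i]) (c : R) (f : R[i] -> R[i]) :=
  forall z w, V z -> V w -> nc (f z - f w) <= c * nc (z - w).

(** A single small real increment [t] suffices, since the complex derivative is the same in every
    direction. *)
Lemma cdiff_lip_norm (V : set R[i]) c f z d :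
  (exists2 r, 0 < r & forall w, nc (w - z) < r -> V w) ->
  lip_on V c f -> cdiff f z d -> nc d <= c.
Proof.
move=> [r r0 rV] fl fd; apply/ler_addgt0Pr => e e0.
have [s s0 H] := fd e e0.
set t := Num.min r s / 2.
have t0 : 0 < t by rewrite divr_gt0// lt_min r0.
have [tr ts] : t < r /\ t < s.
  have : Num.min r s <= r /\ Num.min r s <= s by rewrite !ge_min !lexx orbT.
  by rewrite /t; move: (Num.min r s) t0 => m; rewrite /t => ? [? ?]; split; lra.
have zt : z + t%:C - z = t%:C by rewrite addrC addrA addNr add0r.
have nt : nc t%:C = t by rewrite nc_real gtr0_norm.
have Vz : V z by apply: rV; rewrite subrr nc0.
have Vt : V (z + t%:C) by apply: rV; rewrite zt nt.
have := H (z + t%:C); rewrite zt nt => /(_ ts) h.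
have := fl _ _ Vt Vz; rewrite zt nt => h2.
rewrite -(ler_pM2r t0).
rewrite -{1}nt -ncM.
have -> : d * t%:C = (f (z + t%:C) - f z) - (f (z + t%:C) - f z - d * t%:C) by ring.
by apply: le_trans (ncD _ _) _; rewrite ncN; lra.
Qed.

(* The derivatives converge because a Lipschitz constant bounds the
   derivative; no integral representation is involved. *)
Lemma cdiff_lip_limit (V : set R[i]) (f : nat -> R[i] -> R[i]) g (e : nat -> R) :
  (forall z, V z -> exists2 r, 0 < r & forall w, nc (w - z) < r -> V w) ->
  e @ \oo --> 0 ->
  (forall n z, V z -> exists d, cdiff (f n) z d) ->
  (forall n m, (n <= m)%N -> lip_on V (e n) (fun z => f m z - f n z)) ->
  (forall n, lip_on V (e n) (fun z => g z - f n z)) ->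
  forall z, V z -> exists d, cdiff g z d.
Proof.
move=> oV e0 fd fe ge z Vz.
have /choice[d dP] : forall n, exists d, cdiff (f n) z d by move=> n; exact: fd.
(* [d m - d n] is the derivative of [f m - f n], whose Lipschitz constant is [e n]. *)
have [l lP] : exists l, forall n, nc (l - d n) <= e n.
  apply: geometric_limit => // n m nm.
  apply: (cdiff_lip_norm (oV z Vz) (fe n m nm)).
  apply: cdiffD; first exact: dP.
  move=> r r0; have [s s0 H] := dP n r r0; exists s => // w /H.
  rewrite -ncN; congr (nc _ <= _); ring.
exists l => r r0.
have r3 : 0 < r / 3 by lra.
have /cvgrPdist_lt/(_ _ r3)[N _ /(_ N (leqnn N)) /= eN] := e0.
have {}eN : e N < r / 3.
  by move: eN; rewrite sub0r normrN; apply: le_lt_trans; exact: ler_norm.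
have [s s0 H] := dP N _ r3; have [t t0 K] := oV z Vz.
exists (Num.min s t); first by rewrite lt_min s0.
move=> w; rewrite lt_min => /andP[/H {}H /K Vw].
have h1 := ge N _ _ Vw Vz; have h2 := lP N; have w0 := nc_ge0 (w - z).
have -> : g w - g z - l * (w - z) = (g w - f N w - (g z - f N z)) +
   (f N w - f N z - d N * (w - z)) - (l - d N) * (w - z) by ring.
have := ncD (g w - f N w - (g z - f N z)) (f N w - f N z - d N * (w - z)).
set X := (X in nc X).
move=> h3; apply: le_trans (ncD _ _) _; rewrite ncN ncM.
have : nc (l - d N) * nc (w - z) <= r / 3 * nc (w - z) by apply: ler_wpM2r => //; lra.
have : e N * nc (w - z) <= r / 3 * nc (w - z) by apply: ler_wpM2r => //; lra.
lra.
Qed.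

End complex_norm.

Arguments ComplexField.Normc.normc : simpl never.

(** * Stieltjes integrals of complex functions *)

Section stieltjes_integral.
Local Open Scope complex_scope.
Variable R : realType.
Variable F : cumulative R R.
Implicit Types (a b m c x y e M : R) (u v : R -> R).
Local Notation mu := (lebesgue_stieltjes_measure F).

(** Continuity at the points of [[a, b]], but with [y] ranging over all of [R]; it restricts to
    subintervals without subspace topologies. *)
Definition cts_on a b u := forall x, a <= x <= b -> forall e, 0 < e ->
  exists2 r, 0 < r & forall y, `|y - x| < r -> `|u y - u x| <= e.

(** Half-open intervals have mass exactly [F b - F a], and adjacent ones are disjoint. *)
Definition sint a b u : R := \int[mu]_(x in `]a, b]) u x.

Lemma mu_ocitv a b : a <= b -> mu `]a, b]%classic = (F b - F a)%:E.
Proof.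
move=> ab; rewrite /lebesgue_stieltjes_measure /measure_extension.
rewrite measurable_mu_extE/=; last exact: is_ocitv.
by rewrite wlength_itv_bnd.
Qed.

Lemma mu_ccitv_lty a b : (mu `[a, b]%classic < +oo)%E.
Proof.
have [ab|ab] := leP a b; last first.
  rewrite set_itv_ge ?measure0 ?ltry//; first by rewrite bnd_simp -ltNge.
apply: (@le_lt_trans _ _ (mu `]a - 1, b]%classic)).
  apply: le_measure; rewrite ?inE; [exact: measurable_itv..|].
  by apply: subset_itvr => //=; rewrite bnd_simp; lra.
by rewrite mu_ocitv ?ltry//; lra.
Qed.

Lemma cts_on_within a b u : cts_on a b u -> {within `[a, b], continuous u}.
Proof.
move=> uc; apply: continuous_in_subspaceT => x; rewrite inE /= in_itv /= => xab.
apply/cvgrPdist_le => e e0; have [r r0 H] := uc x xab e e0.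
apply/nbhs_ballP; exists r => // y; rewrite /ball /= distrC => /H.
by rewrite distrC.
Qed.

Lemma cts_on_integrable_cc a b u : cts_on a b u ->
  mu.-integrable `[a, b] (EFin \o u).
Proof.
move=> /cts_on_within cu; apply: measurable_bounded_integrable.
- exact: measurable_itv.
- exact: mu_ccitv_lty.
- by apply: subspace_continuous_measurable_fun => //; exact: measurable_itv.
- have /compact_bounded[M [_ mrt]] :=
    continuous_compact cu (@segment_compact _ _ _).
  exists M; split; rewrite ?num_real // => N MN x Ix.
  by apply: (mrt _ MN); exists x.
Qed.

Lemma moc a b : measurable (`]a, b]%classic : set (measurableTypeR R)).
Proof. exact: measurable_itv. Qed.

Lemma cts_on_integrable a b u : cts_on a b u ->
  mu.-integrable `]a, b] (EFin \o u).
Proof.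
move=> /cts_on_integrable_cc; apply: integrableS; [exact: measurable_itv|exact: moc|].
by apply: subset_itvr; rewrite bnd_simp.
Qed.

Lemma cts_onS a b a' b' u : a <= a' -> b' <= b -> cts_on a b u -> cts_on a' b' u.
Proof. by move=> aa bb uc x /andP[ax xb]; apply: uc; apply/andP; split; lra. Qed.

Lemma cts_on_cst a b c : cts_on a b (fun=> c).
Proof. by move=> x _ e e0; exists 1 => // y _; rewrite subrr normr0 ltW. Qed.

Lemma cts_onD a b u v : cts_on a b u -> cts_on a b v ->
  cts_on a b (fun x => u x + v x).
Proof.
move=> uc vc x xab e e0; have e2 : 0 < e / 2 by lra.
have [r r0 H] := uc x xab _ e2; have [s s0 K] := vc x xab _ e2.
exists (Num.min r s); first by rewrite lt_min r0.
move=> y; rewrite lt_min => /andP[/H h /K k].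
have -> : u y + v y - (u x + v x) = (u y - u x) + (v y - v x) by ring.
by apply: le_trans (ler_normD _ _) _; lra.
Qed.

Lemma cts_onZ a b c u : cts_on a b u -> cts_on a b (fun x => c * u x).
Proof.
move=> uc x xab e e0; have c1 : 0 < `|c| + 1 by rewrite ltr_wpDl.
have [r r0 H] := uc x xab _ (divr_gt0 e0 c1); exists r => // y /H.
rewrite ler_pdivlMr// -mulrBr normrM mulrC; apply: le_trans.
by rewrite ler_wpM2r//; lra.
Qed.

Lemma sintD a b u v : cts_on a b u -> cts_on a b v ->
  sint a b (fun x => u x + v x) = sint a b u + sint a b v.
Proof. by move=> uc vc; apply: RintegralD; [exact: moc|exact: cts_on_integrable..]. Qed.

Lemma sintZ a b c u : cts_on a b u -> sint a b (fun x => c * u x) = c * sint a b u.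
Proof. by move=> uc; apply: RintegralZl; [exact: moc|exact: cts_on_integrable]. Qed.

Lemma sint_cst a b c : a <= b -> sint a b (fun=> c) = c * (F b - F a).
Proof.
move=> ab; transitivity (c * fine (mu `]a, b]%classic)); last by rewrite mu_ocitv.
by rewrite /sint (Rintegral_cst _ (moc a b)).
Qed.

Lemma sint_le a b u v : cts_on a b u -> cts_on a b v ->
  (forall x, a < x <= b -> u x <= v x) -> sint a b u <= sint a b v.
Proof.
move=> uc vc uv; apply: le_Rintegral; [exact: moc|exact: cts_on_integrable..|].
by move=> x /=; rewrite in_itv /=; exact: uv.
Qed.

Lemma eq_sint a b u v : (forall x, a < x <= b -> u x = v x) -> sint a b u = sint a b v.
Proof. by move=> uv; apply: eq_Rintegral => x; rewrite inE /= in_itv /=; exact: uv. Qed.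

Lemma sint_bound a b u M : a <= b -> cts_on a b u ->
  (forall x, a < x <= b -> `|u x| <= M) -> `|sint a b u| <= M * (F b - F a).
Proof.
move=> ab uc uM; rewrite ler_norml -mulNr -!sint_cst//.
by apply/andP; split; apply: sint_le => //; try exact: cts_on_cst;
  move=> x /uM; rewrite ler_norml => /andP[].
Qed.

Lemma sint_cat a m b u : a <= m -> m <= b -> cts_on a b u ->
  sint a b u = sint a m u + sint m b u.
Proof.
move=> am mb uc; rewrite /sint -(Rintegral_setU (moc a m) (moc m b)).
- by rewrite -itv_bndbnd_setU//= bnd_simp.
- by rewrite -itv_bndbnd_setU ?bnd_simp//; exact: cts_on_integrable.
- apply/disj_setPS => y [/=]; rewrite 2!in_itv/= => /andP[_ yx] /andP[].
  by rewrite ltNge yx.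
Qed.

End stieltjes_integral.

(** * Complex-valued integrands, by components *)

Section complex_stieltjes_integral.
Local Open Scope complex_scope.
Variable R : realType.
Variable F : cumulative R R.
Implicit Types (a b m x y e M : R) (c : R[i]) (u v : R -> R[i]).

Definition ccts_on a b u := forall x, a <= x <= b -> forall e, 0 < e ->
  exists2 r, 0 < r & forall y, `|y - x| < r -> nc (u y - u x) <= e.

Definition cint a b u : R[i] :=
  sint F a b (fun x => complex.Re (u x)) +i* sint F a b (fun x => complex.Im (u x)).

Lemma ccts_on_Re a b u : ccts_on a b u -> cts_on a b (fun x => complex.Re (u x)).
Proof.
move=> uc x xab e /(uc x xab)[r r0 H]; exists r => // y /H.
by apply: le_trans; rewrite -ReB nc_Re.
Qed.

Lemma ccts_on_Im a b u : ccts_on a b u -> cts_on a b (fun x => complex.Im (u x)).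
Proof.
move=> uc x xab e /(uc x xab)[r r0 H]; exists r => // y /H.
by apply: le_trans; rewrite -ImB nc_Im.
Qed.
Hint Resolve ccts_on_Re ccts_on_Im : core.

Lemma ccts_on_cst a b c : ccts_on a b (fun=> c).
Proof. by move=> x _ e e0; exists 1 => // y _; rewrite subrr nc0 ltW. Qed.

Lemma ccts_onD a b u v : ccts_on a b u -> ccts_on a b v ->
  ccts_on a b (fun x => u x + v x).
Proof.
move=> uc vc x xab e e0; have e2 : 0 < e / 2 by lra.
have [r r0 H] := uc x xab _ e2; have [s s0 K] := vc x xab _ e2.
exists (Num.min r s); first by rewrite lt_min r0.
move=> y; rewrite lt_min => /andP[/H h /K k].
have -> : u y + v y - (u x + v x) = (u y - u x) + (v y - v x) by ring.
by apply: le_trans (ncD _ _) _; lra.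
Qed.

Lemma ccts_onZ a b c u : ccts_on a b u -> ccts_on a b (fun x => c * u x).
Proof.
move=> uc x xab e e0; have c1 : 0 < nc c + 1 by rewrite ltr_wpDl ?nc_ge0.
have [r r0 H] := uc x xab _ (divr_gt0 e0 c1); exists r => // y /H.
rewrite ler_pdivlMr// -mulrBr ncM mulrC; apply: le_trans.
by rewrite ler_wpM2r ?nc_ge0//; lra.
Qed.

Lemma ccts_onB a b u v : ccts_on a b u -> ccts_on a b v ->
  ccts_on a b (fun x => u x - v x).
Proof.
move=> uc vc; have -> : (fun x => u x - v x) = (fun x => u x + (-1) * v x).
  by apply/funext => x; rewrite mulN1r.
by apply: ccts_onD => //; exact: ccts_onZ.
Qed.

Lemma cintD a b u v : ccts_on a b u -> ccts_on a b v ->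
  cint a b (fun x => u x + v x) = cint a b u + cint a b v.
Proof.
move=> uc vc; rewrite /cint; apply/eqP; rewrite eq_complex /= -!sintD; auto.
by apply/andP; split; apply/eqP/eq_sint => x _; case: (u x) (v x) => [? ?] [? ?].
Qed.

Lemma cintZ a b c u : ccts_on a b u -> cint a b (fun x => c * u x) = c * cint a b u.
Proof.
case: c => c d uc; apply/eqP; rewrite eq_complex /= -!mulNr -!sintZ; auto.
rewrite -!sintD; try by apply: cts_onZ; auto.
by apply/andP; split; apply/eqP/eq_sint => x _; case: (u x) => [? ?] /=; rewrite ?mulNr.
Qed.

Lemma cintB a b u v : ccts_on a b u -> ccts_on a b v ->
  cint a b (fun x => u x - v x) = cint a b u - cint a b v.
Proof.
move=> uc vc; have -> : (fun x => u x - v x) = (fun x => u x + (-1) * v x).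
  by apply/funext => x; rewrite mulN1r.
by rewrite cintD ?cintZ ?mulN1r//; exact: ccts_onZ.
Qed.

Lemma cint_cst a b c : a <= b -> cint a b (fun=> c) = c * (F b - F a)%:C.
Proof.
move=> ab; rewrite /cint !sint_cst//; case: c => c d /=.
by apply/eqP; rewrite eq_complex /=; apply/andP; split; apply/eqP; ring.
Qed.

Lemma eq_cint a b u v : (forall x, a < x <= b -> u x = v x) -> cint a b u = cint a b v.
Proof. by move=> uv; congr (_ +i* _); apply: eq_sint => x /uv ->. Qed.

(** The factor 2 comes from bounding the real and imaginary parts separately. *)
Lemma cint_bound a b u M : a <= b -> ccts_on a b u ->
  (forall x, a < x <= b -> nc (u x) <= M) -> nc (cint a b u) <= 2 * M * (F b - F a).
Proof.
move=> ab uc uM; apply: le_trans (nc_le _) _ => /=.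
have h1 : `|sint F a b (fun x => complex.Re (u x))| <= M * (F b - F a).
  by apply: sint_bound; auto => x /uM; apply: le_trans; exact: nc_Re.
have h2 : `|sint F a b (fun x => complex.Im (u x))| <= M * (F b - F a).
  by apply: sint_bound; auto => x /uM; apply: le_trans; exact: nc_Im.
lra.
Qed.

Lemma cint_cat a m b u : a <= m -> m <= b -> ccts_on a b u ->
  cint a b u = cint a m u + cint m b u.
Proof.
by move=> am mb uc; rewrite /cint (@sint_cat _ _ a m b) 1?(@sint_cat _ _ a m b); auto.
Qed.

End complex_stieltjes_integral.

Arguments cint : simpl never.

(** * Goursat's theorem on rectangles *)

Section rectangle_integral.
Local Open Scope complex_scope.
Variable R : realType.
Implicit Types (f g : R[i] -> R[i]) (x y : R) (z w c d : R[i]).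
Local Notation I := (@cint R (@idfun R)).

Definition hcts f x0 x1 y := ccts_on x0 x1 (fun x => f (x +i* y)).
Definition vcts f x y0 y1 := ccts_on y0 y1 (fun y => f (x +i* y)).

(** The counterclockwise contour integral around the rectangle, with opposite sides paired: bottom
    minus top, then right minus left. *)
Definition rint f x0 x1 y0 y1 : R[i] :=
  I x0 x1 (fun x => f (x +i* y0) - f (x +i* y1)) +
  'i * I y0 y1 (fun y => f (x1 +i* y) - f (x0 +i* y)).

Lemma ccont_hcts f x0 x1 y :
  (forall x, x0 <= x <= x1 -> ccont f (x +i* y)) -> hcts f x0 x1 y.
Proof.
move=> fc x /fc + e e0 => /(_ e e0)[r r0 H]; exists r => // x' xx'.
apply: H; apply: le_lt_trans xx'; apply: le_trans (nc_le _) _.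
by rewrite /= subrr normr0 addr0.
Qed.

Lemma ccont_vcts f x y0 y1 :
  (forall y, y0 <= y <= y1 -> ccont f (x +i* y)) -> vcts f x y0 y1.
Proof.
move=> fc y /fc + e e0 => /(_ e e0)[r r0 H]; exists r => // y' yy'.
apply: H; apply: le_lt_trans yy'; apply: le_trans (nc_le _) _.
by rewrite /= subrr normr0 add0r.
Qed.

Lemma rint_catx f x0 m x1 y0 y1 : x0 <= m -> m <= x1 ->
  hcts f x0 x1 y0 -> hcts f x0 x1 y1 ->
  vcts f x0 y0 y1 -> vcts f m y0 y1 -> vcts f x1 y0 y1 ->
  rint f x0 x1 y0 y1 = rint f x0 m y0 y1 + rint f m x1 y0 y1.
Proof.
move=> xm mx h0 h1 v0 vm v1.
rewrite /rint (cint_cat _ xm mx (ccts_onB h0 h1)).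
by rewrite (cintB _ v1 v0) (cintB _ vm v0) (cintB _ v1 vm); ring.
Qed.

Lemma rint_caty f x0 x1 y0 m y1 : y0 <= m -> m <= y1 ->
  hcts f x0 x1 y0 -> hcts f x0 x1 m -> hcts f x0 x1 y1 ->
  vcts f x0 y0 y1 -> vcts f x1 y0 y1 ->
  rint f x0 x1 y0 y1 = rint f x0 x1 y0 m + rint f x0 x1 m y1.
Proof.
move=> ym my h0 hm h1 v0 v1.
rewrite /rint (cint_cat _ ym my (ccts_onB v1 v0)).
by rewrite (cintB _ h0 h1) (cintB _ h0 hm) (cintB _ hm h1); ring.
Qed.

Lemma rint_bound f x0 x1 y0 y1 M : x0 <= x1 -> y0 <= y1 ->
  hcts f x0 x1 y0 -> hcts f x0 x1 y1 -> vcts f x0 y0 y1 -> vcts f x1 y0 y1 ->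
  (forall x y, x0 <= x <= x1 -> y = y0 \/ y = y1 -> nc (f (x +i* y)) <= M) ->
  (forall x y, y0 <= y <= y1 -> x = x0 \/ x = x1 -> nc (f (x +i* y)) <= M) ->
  nc (rint f x0 x1 y0 y1) <= 4 * M * ((x1 - x0) + (y1 - y0)).
Proof.
move=> x01 y01 h0 h1 v0 v1 hM vM; apply: le_trans (ncD _ _) _.
rewrite ncM nc_i mul1r.
have h : nc (I x0 x1 (fun x => f (x +i* y0) - f (x +i* y1))) <= 2 * (2 * M) * (x1 - x0).
  apply: cint_bound => //; first exact: ccts_onB.
  move=> x /andP[/ltW a b]; apply: le_trans (ncD _ _) _; rewrite ncN.
  have xx : x0 <= x <= x1 by rewrite a.
  by have := hM x y0 xx (or_introl erefl); have := hM x y1 xx (or_intror erefl); lra.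
have v : nc (I y0 y1 (fun y => f (x1 +i* y) - f (x0 +i* y))) <= 2 * (2 * M) * (y1 - y0).
  apply: cint_bound => //; first exact: ccts_onB.
  move=> y /andP[/ltW a b]; apply: le_trans (ncD _ _) _; rewrite ncN.
  have xx : y0 <= y <= y1 by rewrite a.
  by have := vM x0 y xx (or_introl erefl); have := vM x1 y xx (or_intror erefl); lra.
move: (nc _) (nc _) h v => p q; move: (x1 - x0) (y1 - y0) => s t; clear; lra.
Qed.

(** The constant cancels between opposite sides; the linear part contributes
    [d * 'i * (y0 - y1) * (x1 - x0)] along the horizontal sides and its opposite along the vertical
    ones. *)
Lemma rint_affine g c d x0 x1 y0 y1 : x0 <= x1 -> y0 <= y1 ->
  hcts g x0 x1 y0 -> hcts g x0 x1 y1 -> vcts g x0 y0 y1 -> vcts g x1 y0 y1 ->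
  rint (fun z => c + d * z + g z) x0 x1 y0 y1 = rint g x0 x1 y0 y1.
Proof.
move=> x01 y01 h0 h1 v0 v1; rewrite /rint.
have -> : I x0 x1 (fun x => c + d * (x +i* y0) + g (x +i* y0) -
      (c + d * (x +i* y1) + g (x +i* y1))) =
    I x0 x1 (fun x => d * ('i * (y0 - y1)%:C) + (g (x +i* y0) - g (x +i* y1))).
  apply: eq_cint => x _.
  have -> : 'i * (y0 - y1)%:C = (x +i* y0) - (x +i* y1).
    by apply/eqP; rewrite eq_complex /=; apply/andP; split; apply/eqP; ring.
  ring.
have -> : I y0 y1 (fun y => c + d * (x1 +i* y) + g (x1 +i* y) -
      (c + d * (x0 +i* y) + g (x0 +i* y))) =
    I y0 y1 (fun y => d * (x1 - x0)%:C + (g (x1 +i* y) - g (x0 +i* y))).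
  apply: eq_cint => y _.
  have -> : (x1 - x0)%:C = (x1 +i* y) - (x0 +i* y).
    by apply/eqP; rewrite eq_complex /=; apply/andP; split; apply/eqP; ring.
  ring.
rewrite (cintD _ (@ccts_on_cst R x0 x1 _) (ccts_onB h0 h1)).
rewrite (cintD _ (@ccts_on_cst R y0 y1 _) (ccts_onB v1 v0)).
rewrite !cint_cst//= -(opprB y0 y1) rmorphN /=; ring.
Qed.

Lemma eq_rint f g x0 x1 y0 y1 :
  (forall x y, x0 <= x <= x1 -> y = y0 \/ y = y1 -> f (x +i* y) = g (x +i* y)) ->
  (forall x y, y0 <= y <= y1 -> x = x0 \/ x = x1 -> f (x +i* y) = g (x +i* y)) ->
  rint f x0 x1 y0 y1 = rint g x0 x1 y0 y1.
Proof.
move=> h v; congr (_ + 'i * _); apply: eq_cint => t /andP[/ltW a b].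
  by rewrite !h ?a//; tauto.
by rewrite !v ?a//; tauto.
Qed.

Lemma rintD f g x0 x1 y0 y1 :
  hcts f x0 x1 y0 -> hcts f x0 x1 y1 -> vcts f x0 y0 y1 -> vcts f x1 y0 y1 ->
  hcts g x0 x1 y0 -> hcts g x0 x1 y1 -> vcts g x0 y0 y1 -> vcts g x1 y0 y1 ->
  rint (fun z => f z + g z) x0 x1 y0 y1 = rint f x0 x1 y0 y1 + rint g x0 x1 y0 y1.
Proof.
move=> fh0 fh1 fv0 fv1 gh0 gh1 gv0 gv1; rewrite /rint.
have -> : I x0 x1 (fun x => f (x +i* y0) + g (x +i* y0) - (f (x +i* y1) + g (x +i* y1))) =
    I x0 x1 (fun x => f (x +i* y0) - f (x +i* y1) + (g (x +i* y0) - g (x +i* y1))).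
  by apply: eq_cint => x _; ring.
have -> : I y0 y1 (fun y => f (x1 +i* y) + g (x1 +i* y) - (f (x0 +i* y) + g (x0 +i* y))) =
    I y0 y1 (fun y => f (x1 +i* y) - f (x0 +i* y) + (g (x1 +i* y) - g (x0 +i* y))).
  by apply: eq_cint => x _; ring.
rewrite (cintD _ (ccts_onB fh0 fh1) (ccts_onB gh0 gh1)).
by rewrite (cintD _ (ccts_onB fv1 fv0) (ccts_onB gv1 gv0)); ring.
Qed.

Lemma rintZ c f x0 x1 y0 y1 :
  hcts f x0 x1 y0 -> hcts f x0 x1 y1 -> vcts f x0 y0 y1 -> vcts f x1 y0 y1 ->
  rint (fun z => c * f z) x0 x1 y0 y1 = c * rint f x0 x1 y0 y1.
Proof.
move=> fh0 fh1 fv0 fv1; rewrite /rint.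
have -> : I x0 x1 (fun x => c * f (x +i* y0) - c * f (x +i* y1)) =
    I x0 x1 (fun x => c * (f (x +i* y0) - f (x +i* y1))).
  by apply: eq_cint => x _; ring.
have -> : I y0 y1 (fun y => c * f (x1 +i* y) - c * f (x0 +i* y)) =
    I y0 y1 (fun y => c * (f (x1 +i* y) - f (x0 +i* y))).
  by apply: eq_cint => x _; ring.
by rewrite (cintZ _ _ (ccts_onB fh0 fh1)) (cintZ _ _ (ccts_onB fv1 fv0)); ring.
Qed.

End rectangle_integral.

Arguments rint : simpl never.

(** * Goursat's theorem by repeated quartering *)

Section goursat.
Local Open Scope complex_scope.
Variable R : realType.
Implicit Types (f g : R[i] -> R[i]) (x y : R) (z w c d : R[i]).

Lemma cdiff_affine c d z : cdiff (fun z => c + d * z) z d.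
Proof.
move=> e e0; exists 1 => // w _.
have -> : c + d * w - (c + d * z) - d * (w - z) = 0 by ring.
by rewrite nc0 mulr_ge0 ?nc_ge0 ?ltW.
Qed.

Lemma rint_quarter f x0 m x1 y0 n y1 : x0 <= m -> m <= x1 -> y0 <= n -> n <= y1 ->
  (forall x y, x0 <= x <= x1 -> y0 <= y <= y1 -> ccont f (x +i* y)) ->
  rint f x0 x1 y0 y1 = rint f x0 m y0 n + rint f m x1 y0 n +
    (rint f x0 m n y1 + rint f m x1 n y1).
Proof.
move=> xm mx yn ny fc.
have hc a b y : x0 <= a -> b <= x1 -> y0 <= y <= y1 -> hcts f a b y.
  by move=> *; apply: ccont_hcts => x /andP[? ?]; apply: fc => //; apply/andP; split; lra.
have vc a b x : y0 <= a -> b <= y1 -> x0 <= x <= x1 -> vcts f x a b.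
  by move=> *; apply: ccont_vcts => y /andP[? ?]; apply: fc => //; apply/andP; split; lra.
rewrite (rint_caty yn ny); last 5 first; try by [apply: hc; lra|apply: vc; lra].
congr (_ + _); apply: rint_catx => //; by [apply: hc; lra|apply: vc; lra].
Qed.

Lemma large_summand (r1 r2 r3 r4 : R[i]) (t : R) : 4 * t <= nc (r1 + r2 + (r3 + r4)) ->
  [\/ t <= nc r1, t <= nc r2, t <= nc r3 | t <= nc r4].
Proof.
move=> h; have h1 := ncD (r1 + r2) (r3 + r4); have h2 := ncD r1 r2; have h3 := ncD r3 r4.
case: (leP t (nc r1)) => [|l1]; first by constructor 1.
case: (leP t (nc r2)) => [|l2]; first by constructor 2.
case: (leP t (nc r3)) => [|l3]; first by constructor 3.
by constructor 4; lra.
Qed.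

Lemma rint_quarter_large f (a b W H t : R) : 0 <= W -> 0 <= H ->
  (forall x y, a <= x <= a + W + W -> b <= y <= b + H + H -> ccont f (x +i* y)) ->
  4 * t <= nc (rint f a (a + W + W) b (b + H + H)) ->
  exists a' b', [/\ a' = a \/ a' = a + W, b' = b \/ b' = b + H &
    t <= nc (rint f a' (a' + W) b' (b' + H))].
Proof.
move=> W0 H0 fc.
have -> : rint f a (a + W + W) b (b + H + H) =
    rint f a (a + W) b (b + H) + rint f (a + W) (a + W + W) b (b + H) +
    (rint f a (a + W) (b + H) (b + H + H) + rint f (a + W) (a + W + W) (b + H) (b + H + H)).
  by apply: rint_quarter => //; rewrite lerDl.
move=> /large_summand[] h.
- by exists a, b; split => //; left.
- by exists (a + W), b; split => //; [right|left].
- by exists a, (b + H); split => //; [left|right].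
- by exists (a + W), (b + H); split => //; right.
Qed.

(** The affine part at [l] integrates to 0. The remainder is at most [eps * (2 * (W + H))] on the
    rectangle, and integrating it along the sides makes the estimate quadratic in the size. *)
Lemma rint_near_diff f (a b W H eps r : R) d l : 0 <= W -> 0 <= H -> 0 <= eps ->
  (forall x y, a <= x <= a + W -> b <= y <= b + H -> exists d', cdiff f (x +i* y) d') ->
  nc (l - (a +i* b)) <= W + H -> 2 * (W + H) < r ->
  (forall w, nc (w - l) < r -> nc (f w - f l - d * (w - l)) <= eps * nc (w - l)) ->
  nc (rint f a (a + W) b (b + H)) <= 8 * eps * (W + H) ^+ 2.
Proof.
move=> W0 H0 eps0 fd lab Wr fl.
pose g z := f z - f l - d * (z - l).
have aW : a <= a + W by rewrite lerDl.
have bH : b <= b + H by rewrite lerDl.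
have aa : a <= a <= a + W by rewrite lexx.
have aa' : a <= a + W <= a + W by rewrite lexx aW.
have bb : b <= b <= b + H by rewrite lexx.
have bb' : b <= b + H <= b + H by rewrite lexx bH.
have gc x y : a <= x <= a + W -> b <= y <= b + H -> ccont g (x +i* y).
  move=> xx yy; have [d' fd'] := fd x y xx yy.
  have := cdiff_cont (cdiffD fd' (cdiff_affine (- f l + d * l) (- d) (x +i* y))).
  congr (ccont _ _); apply/funext => z; rewrite /g; ring.
have gh y : b <= y <= b + H -> hcts g a (a + W) y.
  by move=> yy; apply: ccont_hcts => x xx; exact: gc.
have gv x : a <= x <= a + W -> vcts g x b (b + H).
  by move=> xx; apply: ccont_vcts => y yy; exact: gc.
have gM x y : a <= x <= a + W -> b <= y <= b + H -> nc (g (x +i* y)) <= eps * (2 * (W + H)).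
  move=> /andP[x1 x2] /andP[y1 y2].
  have zl : nc ((x +i* y) - l) <= 2 * (W + H).
    apply: le_trans (nc_tri (a +i* b) _ _) _; rewrite mulr_natl mulr2n.
    apply: lerD; last by rewrite ncB.
    apply: le_trans (nc_le _) _; rewrite ReB ImB /= !ger0_norm ?subr_ge0//.
    by apply: lerD; rewrite lerBlDl.
  by apply: le_trans (fl _ (le_lt_trans zl Wr)) _; rewrite ler_wpM2l.
have -> : f = (fun z => (f l - d * l) + d * z + g z).
  by apply/funext => z; rewrite /g; ring.
rewrite (rint_affine _ _ aW bH (gh _ bb) (gh _ bb') (gv _ aa) (gv _ aa')).
apply: le_trans (rint_bound aW bH (gh _ bb) (gh _ bb') (gv _ aa) (gv _ aa') _ _) _.
- by move=> x y xx [->|->]; exact: gM.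
- by move=> x y yy [->|->]; exact: gM.
- clear; rewrite le_eqVlt; apply/orP; left; apply/eqP; ring.
Qed.

(** A nonzero integral would leave, at stage [k], a rectangle carrying at least [eta / 4 ^+ k];
    differentiability at the common limit point makes it a smaller multiple of [4 ^- k]. *)
Lemma goursat f x0 x1 y0 y1 : x0 <= x1 -> y0 <= y1 ->
  (forall x y, x0 <= x <= x1 -> y0 <= y <= y1 -> exists d, cdiff f (x +i* y) d) ->
  rint f x0 x1 y0 y1 = 0.
Proof.
move=> x01 y01 fd; apply/eqP; rewrite -nc_eq0; apply/negPn/negP => nz.
set eta := nc (rint f x0 x1 y0 y1) in nz.
have eta0 : 0 < eta by rewrite lt_neqAle eq_sym nz nc_ge0.
have fc x y : x0 <= x <= x1 -> y0 <= y <= y1 -> ccont f (x +i* y).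
  by move=> xx yy; have [d /cdiff_cont] := fd x y xx yy.
pose w k : R := (x1 - x0) / 2 ^+ k; pose h k : R := (y1 - y0) / 2 ^+ k.
have wS k : w k = w k.+1 + w k.+1.
  by rewrite /w exprS invfM; field; rewrite expf_neq0.
have hS k : h k = h k.+1 + h k.+1.
  by rewrite /h exprS invfM; field; rewrite expf_neq0.
have w0 k : 0 <= w k by rewrite divr_ge0 ?exprn_ge0//; lra.
have h0 k : 0 <= h k by rewrite divr_ge0 ?exprn_ge0//; lra.
pose Bad k (p : R * R) := [/\ x0 <= p.1, p.1 + w k <= x1, y0 <= p.2, p.2 + h k <= y1 &
  eta / 4 ^+ k <= nc (rint f p.1 (p.1 + w k) p.2 (p.2 + h k))].
(* As [w k = w k.+1 + w k.+1], this says that the new rectangle lies inside the old one. *)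
pose Near k (p q : R * R) := (p.1 <= q.1 <= p.1 + w k.+1) /\ (p.2 <= q.2 <= p.2 + h k.+1).
have w00 : w 0 = x1 - x0 by rewrite /w expr0 divr1.
have h00 : h 0 = y1 - y0 by rewrite /h expr0 divr1.
pose e k := w k + h k.
have eE k : e k = (x1 - x0 + (y1 - y0)) * 2^-1 ^+ k by rewrite /e /w /h -mulrDl exprVn.
(* The implication stands under the existential so that choice yields a total function. *)
have step (kp : nat * (R * R)) : exists q, Bad kp.1 kp.2 -> Bad kp.1.+1 q /\ Near kp.1 kp.2 q.
  case: kp => k [a b]; case: (pselect (Bad k (a, b))) => [|nB]; last by exists (a, b).
  rewrite /Bad /Near /=; have wk := wS k; have hk := hS k.
  have wk0 := w0 k.+1; have hk0 := h0 k.+1.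
  move: wk hk wk0 hk0; clear wS hS w0 h0 w00 h00 eE.
  move: (w k) (w k.+1) (h k) (h k.+1) => W W' H H' -> -> W0 H0.
  rewrite (addrA a W' W') (addrA b H' H') => -[ax aw bx bh ler].
  have fc' x y : a <= x <= a + W' + W' -> b <= y <= b + H' + H' -> ccont f (x +i* y).
    by move=> /andP[xa xa'] /andP[yb yb']; apply: fc;
      rewrite ?(le_trans ax xa) ?(le_trans bx yb) ?(le_trans xa' aw) ?(le_trans yb' bh).
  have : 4 * (eta / 4 ^+ k.+1) <= nc (rint f a (a + W' + W') b (b + H' + H')).
    have -> : 4 * (eta / 4 ^+ k.+1) = eta / 4 ^+ k by rewrite exprS; field; rewrite expf_neq0.
    exact: ler.
  move=> /(rint_quarter_large W0 H0 fc')[a' [b' [aa bb le]]]; exists (a', b') => _ /=.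
  clear ler fc' fc fd Bad Near e; clearbody w h eta.
  by case: aa bb le => -> [] -> le; split; split;
    try exact: le; clear le; try (apply/andP; split); lra.
have /choice[next nextP] := step.
pose u := fix u k := if k is k'.+1 then next (k', u k') else (x0, y0).
have uB k : Bad k (u k).
  elim: k => [|k IH]; last exact: (nextP (k, u k) IH).1.
  rewrite /Bad w00 h00 /= expr0 divr1.
  have -> : x0 + (x1 - x0) = x1 by ring.
  have -> : y0 + (y1 - y0) = y1 by ring.
  by split; rewrite ?lexx.
have uN k : Near k (u k) (u k.+1) by exact: (nextP (k, u k) (uB k)).2.
have eWH k : e k = w k + h k by [].
clear step nextP; clearbody u w h e eta.
have uW k m : (k <= m)%N -> ((u k).1 <= (u m).1 /\ (u m).1 + w m <= (u k).1 + w k) /\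
    ((u k).2 <= (u m).2 /\ (u m).2 + h m <= (u k).2 + h k).
  elim: m => [|m IH]; first by rewrite leqn0 => /eqP ->; rewrite !lexx.
  rewrite leq_eqVlt => /predU1P[<-|/IH]; first by rewrite !lexx.
  case: (uN m) => /andP[? ?] /andP[? ?]; have := wS m; have := hS m.
  by move=> ? ? [[? ?] [? ?]]; split; split; lra.
have ecvg : e @ \oo --> 0.
  rewrite (_ : e = geometric (x1 - x0 + (y1 - y0)) 2^-1); last by apply/funext => k; exact: eE.
  by apply: cvg_geometric; rewrite ger0_norm; lra.
have [l lP] : exists l, forall k, nc (l - ((u k).1 +i* (u k).2)) <= e k.
  apply: geometric_limit => // k m /uW[[? ?] [? ?]].
  apply: le_trans (nc_le _) _; rewrite ReB ImB /=.
  have := w0 m; have := h0 m => ? ?.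
  by rewrite eWH !ger0_norm; lra.
case: l lP => X Y lP.
have elt r : 0 < r -> exists k, e k < r.
  move=> r0; have /cvgrPdist_lt/(_ _ r0)[N _ /(_ N (leqnn N)) /= eN] := ecvg.
  by exists N; move: eN; rewrite sub0r normrN; apply: le_lt_trans; exact: ler_norm.
have lk k : `|X - (u k).1| <= e k /\ `|Y - (u k).2| <= e k.
  split; apply: le_trans (lP k).
    by apply: le_trans (nc_Re _); rewrite ReB.
  by apply: le_trans (nc_Im _); rewrite ImB.
have lR : (x0 <= X <= x1) /\ (y0 <= Y <= y1).
  split; apply/andP; split; apply/ler_addgt0Pr => r /elt[k ek];
  have [] := lk k; rewrite !ler_norml => /andP[? ?] /andP[? ?];
  have [? ? ? ? _] := uB k; have := w0 k; have := h0 k; lra.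
have [d dl] := fd X Y lR.1 lR.2.
set S := x1 - x0 + (y1 - y0) in eE.
have S0 : 0 <= S by rewrite addr_ge0 ?subr_ge0.
have S1 : 0 < S ^+ 2 + 1 by rewrite ltr_wpDl ?sqr_ge0.
clearbody S.
(* Then [8 * eps * S ^+ 2 < eta]; the added 1 covers the degenerate case [S = 0]. *)
set eps := eta / (16 * (S ^+ 2 + 1)).
have eps0 : 0 < eps by rewrite divr_gt0// mulr_gt0.
have [r r0 H] := dl eps eps0.
have [k ek] := elt (r / 2) (divr_gt0 r0 (ltr0Sn _ _)).
have er : 2 * (w k + h k) < r by rewrite -eWH mulrC -ltr_pdivlMr.
have [ux uxw uy uyh ub] := uB k.
have fd' x y : (u k).1 <= x <= (u k).1 + w k -> (u k).2 <= y <= (u k).2 + h k ->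
    exists d', cdiff f (x +i* y) d'.
  move=> /andP[xa xb] /andP[ya yb]; apply: fd.
    by rewrite (le_trans ux xa) (le_trans xb uxw).
  by rewrite (le_trans uy ya) (le_trans yb uyh).
have lk' : nc ((X +i* Y) - ((u k).1 +i* (u k).2)) <= w k + h k by rewrite -eWH.
have := rint_near_diff (w0 k) (h0 k) (ltW eps0) fd' lk' er H.
move=> /(le_trans ub); apply/negP; rewrite -ltNge -eWH eE.
rewrite /eps; move: (eta) eta0 S1; clear => t t0 S1.
rewrite exprMn -exprM mulnC exprM (_ : 2^-1 ^+ 2 = 4^-1 :> R); last by field.
rewrite mulrA exprVn ltr_pM2r ?invr_gt0 ?exprn_gt0//.
have -> : 8 * (t / (16 * (S ^+ 2 + 1))) * S ^+ 2 = t * (S ^+ 2 / (2 * (S ^+ 2 + 1))).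
  by field; rewrite gt_eqF.
rewrite -[ltRHS]mulr1 ltr_pM2l// ltr_pdivrMr ?mulr_gt0//; lra.
Qed.

End goursat.

(** * Local Lipschitz bounds *)

Section local_lipschitz.
Local Open Scope complex_scope.
Variable R : realType.
Implicit Types (f g : R[i] -> R[i]) (x y s r : R) (a b z w c d : R[i]).

Definition quot f a z := (f z - f a) * (z - a)^-1.

Lemma cdiff_inv_sub a z : z != a -> exists d, cdiff (fun z => (z - a)^-1) z d.
Proof.
move=> za; have za0 : z - a != 0 by rewrite subr_eq0.
have ds : cdiff (fun z => z - a) z (1 + 0).
  by apply: (@cdiffD _ id (fun=> - a)); [exact: cdiff_id|exact: cdiff_cst].
by have := cdiff_comp ds (cdiffV za0); eexists; eassumption.
Qed.

Lemma cdiff_quot f a z d : z != a -> cdiff f z d -> exists d', cdiff (quot f a) z d'.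
Proof.
move=> za fd; have [d2 d2P] := cdiff_inv_sub za.
have := cdiffM (cdiffD fd (cdiff_cst (- f a) z)) d2P.
by eexists; eassumption.
Qed.

(** The frame between the two rectangles is cut into four rectangles, and Goursat's theorem applies
    to each. *)
Lemma rint_shrink h x0 u v x1 y0 u' v' y1 : x0 <= u -> u <= v -> v <= x1 ->
  y0 <= u' -> u' <= v' -> v' <= y1 ->
  (forall x y, x0 <= x <= x1 -> y0 <= y <= y1 ->
     [\/ x <= u, v <= x, y <= u' | v' <= y] -> exists d, cdiff h (x +i* y) d) ->
  rint h x0 x1 y0 y1 = rint h u v u' v'.
Proof.
move=> xu uv vx yu uv' vy hd.
have ux := le_trans uv vx; have xv := le_trans xu uv.
have uy := le_trans uv' vy; have yv := le_trans yu uv'.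
have hc y s t : y0 <= y <= y1 -> y <= u' \/ v' <= y -> x0 <= s -> t <= x1 -> hcts h s t y.
  move=> yy side xs tx; apply: ccont_hcts => x /andP[sx xt].
  have xx : x0 <= x <= x1 by rewrite (le_trans xs sx) (le_trans xt tx).
  have [|d /cdiff_cont//] := hd x y xx yy.
  by case: side => ?; [constructor 3|constructor 4].
have vc x s t : x0 <= x <= x1 -> x <= u \/ v <= x -> y0 <= s -> t <= y1 -> vcts h x s t.
  move=> xx side ys ty; apply: ccont_vcts => y /andP[sy yt].
  have yy : y0 <= y <= y1 by rewrite (le_trans ys sy) (le_trans yt ty).
  have [|d /cdiff_cont//] := hd x y xx yy.
  by case: side => ?; [constructor 1|constructor 2].
have gz s t s' t' : x0 <= s -> s <= t -> t <= x1 -> y0 <= s' -> s' <= t' -> t' <= y1 ->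
    [\/ t <= u, v <= s, t' <= u' | v' <= s'] -> rint h s t s' t' = 0.
  move=> xs st tx ys st' ty side; apply: goursat => // x y /andP[sx xt] /andP[sy yt].
  apply: hd; first by rewrite (le_trans xs sx) (le_trans xt tx).
    by rewrite (le_trans ys sy) (le_trans yt ty).
  by case: side => h1; [constructor 1; exact: le_trans xt h1|constructor 2; exact: le_trans h1 sx|
    constructor 3; exact: le_trans yt h1|constructor 4; exact: le_trans h1 sy].
have X0 : x0 <= x0 <= x1 by rewrite lexx (le_trans xu ux).
have X1 : x0 <= x1 <= x1 by rewrite lexx (le_trans xu ux).
have Xu : x0 <= u <= x1 by rewrite xu ux.
have Xv : x0 <= v <= x1 by rewrite xv vx.
have Y0 : y0 <= y0 <= y1 by rewrite lexx (le_trans yu uy).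
have Y1 : y0 <= y1 <= y1 by rewrite lexx (le_trans yu uy).
have Yu : y0 <= u' <= y1 by rewrite yu uy.
have Yv : y0 <= v' <= y1 by rewrite yv vy.
have -> : rint h x0 x1 y0 y1 = rint h x0 u y0 y1 + rint h u x1 y0 y1.
  by apply: rint_catx => //; [apply: hc|apply: hc|apply: vc|apply: vc|apply: vc] => //;
    rewrite ?lexx; auto.
have -> : rint h u x1 y0 y1 = rint h u v y0 y1 + rint h v x1 y0 y1.
  by apply: rint_catx => //; [apply: hc|apply: hc|apply: vc|apply: vc|apply: vc] => //;
    rewrite ?lexx; auto.
have -> : rint h u v y0 y1 = rint h u v y0 u' + rint h u v u' y1.
  by apply: rint_caty => //; [apply: hc|apply: hc|apply: hc|apply: vc|apply: vc] => //;
    rewrite ?lexx; auto.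
have -> : rint h u v u' y1 = rint h u v u' v' + rint h u v v' y1.
  by apply: rint_caty => //; [apply: hc|apply: hc|apply: hc|apply: vc|apply: vc] => //;
    rewrite ?lexx; auto.
have -> : rint h x0 u y0 y1 = 0.
  by apply: gz; rewrite ?lexx// ?(le_trans yu uy)//; constructor 1.
have -> : rint h v x1 y0 y1 = 0.
  by apply: gz; rewrite ?lexx// ?(le_trans yu uy)//; constructor 2.
have -> : rint h u v y0 u' = 0 by apply: gz; rewrite ?lexx//; constructor 3.
have -> : rint h u v v' y1 = 0 by apply: gz; rewrite ?lexx//; constructor 4.
by rewrite !add0r !addr0.
Qed.

Lemma rint_quot_center f (a1 a2 e r M : R) : 0 < e -> 2 * e < r -> 0 <= M ->
  (forall x y, a1 - e <= x <= a1 + e -> a2 - e <= y <= a2 + e ->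
     exists d, cdiff f (x +i* y) d) ->
  (forall w, nc (w - (a1 +i* a2)) < r ->
     nc (f w - f (a1 +i* a2)) <= M * nc (w - (a1 +i* a2))) ->
  nc (rint (quot f (a1 +i* a2)) (a1 - e) (a1 + e) (a2 - e) (a2 + e)) <= 16 * M * e.
Proof.
move=> e0 er M0 fd dr.
have hM x y : a1 - e <= x <= a1 + e -> a2 - e <= y <= a2 + e ->
    nc (quot f (a1 +i* a2) (x +i* y)) <= M.
  move=> xx yy.
  have near : nc ((x +i* y) - (a1 +i* a2)) < r.
    apply: le_lt_trans er; apply: le_trans (nc_le _) _; rewrite ReB ImB /= mulr_natl mulr2n.
    by apply: lerD; rewrite ler_distl.
  have := dr _ near; rewrite /quot ncM ncV.
  have [->|ne] := eqVneq (x +i* y) (a1 +i* a2); first by rewrite !subrr nc0 mul0r.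
  by rewrite ler_pdivrMr// nc_gt0 subr_eq0.
have le1 (p : R) : p - e <= p + e by rewrite lerD2l; apply: le_trans (ltW e0); rewrite oppr_le0 ltW.
have L (p : R) : p - e <= p - e <= p + e by rewrite lexx le1.
have U (p : R) : p - e <= p + e <= p + e by rewrite lexx le1.
have neL (p : R) : p - e != p by rewrite -subr_eq0 addrAC subrr add0r oppr_eq0 gt_eqF.
have neU (p : R) : p + e != p by rewrite -subr_eq0 addrAC subrr add0r gt_eqF.
have hc y : a2 - e <= y <= a2 + e -> y != a2 -> hcts (quot f (a1 +i* a2)) (a1 - e) (a1 + e) y.
  move=> yy ne; apply: ccont_hcts => x xx; have [d df] := fd x y xx yy.
  have ne' : x +i* y != a1 +i* a2 by rewrite eq_complex /= negb_and ne orbT.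
  by have [d' /cdiff_cont] := cdiff_quot ne' df.
have vc x : a1 - e <= x <= a1 + e -> x != a1 -> vcts (quot f (a1 +i* a2)) x (a2 - e) (a2 + e).
  move=> xx ne; apply: ccont_vcts => y yy; have [d df] := fd x y xx yy.
  have ne' : x +i* y != a1 +i* a2 by rewrite eq_complex /= negb_and ne.
  by have [d' /cdiff_cont] := cdiff_quot ne' df.
apply: le_trans (rint_bound (le1 _) (le1 _) (hc _ (L _) (neL _)) (hc _ (U _) (neU _))
  (vc _ (L _) (neL _)) (vc _ (U _) (neU _)) _ _) _.
- by move=> x y xx [->|->]; apply: hM.
- by move=> x y xx [->|->]; apply: hM.
- by clear; rewrite le_eqVlt; apply/orP; left; apply/eqP; ring.
Qed.

Lemma rint_quot f (a1 a2 : R) x0 x1 y0 y1 : x0 < a1 < x1 -> y0 < a2 < y1 ->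
  (forall x y, x0 <= x <= x1 -> y0 <= y <= y1 -> exists d, cdiff f (x +i* y) d) ->
  rint (quot f (a1 +i* a2)) x0 x1 y0 y1 = 0.
Proof.
move=> /andP[xa ax] /andP[ya ay] fd.
have Xa : x0 <= a1 <= x1 by rewrite !ltW.
have Ya : y0 <= a2 <= y1 by rewrite !ltW.
have [d /cdiff_lip[r r0 dr]] := fd a1 a2 Xa Ya.
have M0 : 0 < nc d + 1 by rewrite ltr_wpDl ?nc_ge0.
move: (nc d + 1) M0 dr => M M0 dr.
apply/eqP; rewrite -nc_eq0 eq_le nc_ge0 andbT; apply/ler_addgt0Pr => eta eta0.
rewrite add0r.
(* The four distances keep the square inside, [r / 3] gives [2 * e < r], and the last term makes
   [16 * M * e] at most [eta]. *)
pose e := Num.min (Num.min (Num.min (a1 - x0) (x1 - a1)) (Num.min (a2 - y0) (y1 - a2)))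
  (Num.min (r / 3) (eta / (16 * M))).
have [e0 [e1 [e2 [e3 [e4 [e5 e6]]]]]] : 0 < e /\ (e <= a1 - x0 /\ (e <= x1 - a1 /\
    (e <= a2 - y0 /\ (e <= y1 - a2 /\ (e <= r / 3 /\ e <= eta / (16 * M)))))).
  split; last by rewrite /e !ge_min !lexx !orbT.
  by rewrite !lt_min !subr_gt0 xa ax ya ay !divr_gt0 ?mulr_gt0.
clearbody e.
have xl : x0 <= a1 - e by rewrite lerBrDl -lerBrDr.
have xr : a1 + e <= x1 by rewrite -lerBrDl.
have yl : y0 <= a2 - e by rewrite lerBrDl -lerBrDr.
have yr : a2 + e <= y1 by rewrite -lerBrDl.
have le1 (p : R) : p - e <= p + e by rewrite lerD2l; apply: le_trans (ltW e0); rewrite oppr_le0 ltW.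
rewrite (rint_shrink xl (le1 a1) xr yl (le1 a2) yr); last first.
  move=> x y xx yy side; have [d' df] := fd x y xx yy; apply: cdiff_quot df.
  rewrite eq_complex /= negb_and.
  have ltp (p : R) : p - e < p by rewrite gtrBl.
  have gtp (p : R) : p < p + e by rewrite ltrDl.
  by case: side => h; apply/orP; [left|left|right|right]; 
    rewrite ?(lt_eqF (le_lt_trans h (ltp _)))// gt_eqF// (lt_le_trans (gtp _) h).
have er : 2 * e < r by clear -e5 r0; lra.
apply: le_trans (rint_quot_center e0 er (ltW M0) _ dr) _.
  move=> x y /andP[h1 h2] /andP[h3 h4]; apply: fd.
    by rewrite (le_trans xl h1) (le_trans h2 xr).
  by rewrite (le_trans yl h3) (le_trans h4 yr).
by move: e6; rewrite ler_pdivlMr ?mulr_gt0// mulrC.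
Qed.

End local_lipschitz.

(** * From Goursat's theorem to a local Lipschitz bound *)

Section local_lipschitz_estimate.
Local Open Scope complex_scope.
Variable R : realType.
Implicit Types (f g : R[i] -> R[i]) (x y s r : R) (a b z w c d : R[i]).

Lemma Im_inv (u v : R) : complex.Im (u +i* v)^-1 = - v / (u ^+ 2 + v ^+ 2).
Proof. by rewrite mulNr. Qed.

Lemma Re_inv (u v : R) : complex.Re (u +i* v)^-1 = u / (u ^+ 2 + v ^+ 2).
Proof. by []. Qed.

Lemma ccont_inv_sub a z : z != a -> ccont (fun z => (z - a)^-1) z.
Proof. by move=> /cdiff_inv_sub[d /cdiff_cont]. Qed.

(** The denominator is at most [8 * s ^+ 2]. This bounds the imaginary part of [1 / (z - a)] on the
    horizontal sides. *)
Lemma div_sqr_bound (t u v s : R) : 0 < s -> s / 2 <= t -> `|u| <= 2 * s -> `|v| <= 2 * s ->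
  0 < u ^+ 2 + v ^+ 2 -> (16 * s)^-1 <= t / (u ^+ 2 + v ^+ 2).
Proof.
move=> s0 ts us vs p0; rewrite ler_pdivlMr// mulrC ler_pdivrMr ?mulr_gt0//.
move: us vs; rewrite !ler_norml => /andP[? ?] /andP[? ?].
have : u ^+ 2 <= 4 * s ^+ 2 by nra.
have : v ^+ 2 <= 4 * s ^+ 2 by nra.
nra.
Qed.

(* The argument of [z - a] increases along each side of the rectangle, so the
   imaginary part of the integral of [1 / (z - a)] is bounded below; its exact
   value is not needed. *)
Lemma rint_inv_sub (p q s a1 a2 : R) : 0 < s -> `|a1 - p| <= s / 2 -> `|a2 - q| <= s / 2 ->
  4^-1 <= nc (rint (fun z => (z - (a1 +i* a2))^-1) (p - s) (p + s) (q - s) (q + s)).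
Proof.
move=> s0; rewrite !ler_norml => /andP[pa1 pa2] /andP[qa1 qa2].
apply: le_trans (nc_Im _); apply: le_trans (ler_norm _).
set k := fun z => (z - (a1 +i* a2))^-1.
have kh y : y != a2 -> hcts k (p - s) (p + s) y.
  move=> ya; apply: ccont_hcts => x _; apply: ccont_inv_sub.
  by rewrite eq_complex /= negb_and ya orbT.
have kv x : x != a1 -> vcts k x (q - s) (q + s).
  move=> xa; apply: ccont_vcts => y _; apply: ccont_inv_sub.
  by rewrite eq_complex /= negb_and xa.
have ny0 : q - s != a2 by apply/eqP; lra.
have ny1 : q + s != a2 by apply/eqP; lra.
have nx0 : p - s != a1 by apply/eqP; lra.
have nx1 : p + s != a1 by apply/eqP; lra.
have ImD z w : complex.Im (z + w) = complex.Im z + complex.Im w by case: z w => [? ?] [? ?].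
have Imi z : complex.Im ('i * z) = complex.Re z by case: z => ? ? /=; ring.
rewrite /rint ImD Imi /cint.
have sq0 (u v : R) : v != 0 -> 0 < u ^+ 2 + v ^+ 2.
  by move=> v0; rewrite ltr_wpDl ?sqr_ge0// exprn_even_gt0.
have sq0' (u v : R) : u != 0 -> 0 < u ^+ 2 + v ^+ 2.
  by move=> v0; rewrite ltr_wpDr ?sqr_ge0// exprn_even_gt0.
(* Each horizontal side contributes at least [(16 * s)^-1] to the integrand; over the length [2 * s]
   this makes 1/4. *)
have h1 : (8 * s)^-1 * ((p + s) - (p - s)) <= sint idfun (p - s) (p + s)
    (fun x => complex.Im (k (x +i* (q - s)) - k (x +i* (q + s)))).
  have e8 := @sint_cst R idfun (p - s) (p + s) (8 * s)^-1 ltac:(lra); rewrite -e8.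
  apply: sint_le; [exact: cts_on_cst|exact: (ccts_on_Im (ccts_onB (kh _ ny0) (kh _ ny1)))|].
  move=> x /andP[x1 x2]; rewrite ImB /k.
  have -> : (x +i* (q - s)) - (a1 +i* a2) = (x - a1) +i* (q - s - a2) by [].
  have -> : (x +i* (q + s)) - (a1 +i* a2) = (x - a1) +i* (q + s - a2) by [].
  rewrite !Im_inv.
  have xs : `|x - a1| <= 2 * s by rewrite ler_norml; apply/andP; split; lra.
  have e1 : (16 * s)^-1 <= - (q - s - a2) / ((x - a1) ^+ 2 + (q - s - a2) ^+ 2).
    apply: div_sqr_bound => //; [lra|rewrite ler_norml; apply/andP; split; lra|].
    by apply: sq0; apply/eqP; lra.
  have e2 : (16 * s)^-1 <= (q + s - a2) / ((x - a1) ^+ 2 + (q + s - a2) ^+ 2).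
    apply: div_sqr_bound => //; [lra|rewrite ler_norml; apply/andP; split; lra|].
    by apply: sq0; apply/eqP; lra.
  have -> : (8 * s)^-1 = (16 * s)^-1 + (16 * s)^-1 by field; rewrite gt_eqF.
  by rewrite mulNr; lra.
(* For the vertical sides the sign is enough. *)
have h2 : 0 <= sint idfun (q - s) (q + s)
    (fun y => complex.Re (k ((p + s) +i* y) - k ((p - s) +i* y))).
  have := @sint_cst R idfun (q - s) (q + s) 0 ltac:(lra); rewrite mul0r => <-.
  apply: sint_le; [exact: cts_on_cst|exact: (ccts_on_Re (ccts_onB (kv _ nx1) (kv _ nx0)))|].
  move=> y /andP[y1 y2]; rewrite ReB /k.
  have -> : ((p + s) +i* y) - (a1 +i* a2) = (p + s - a1) +i* (y - a2) by [].
  have -> : ((p - s) +i* y) - (a1 +i* a2) = (p - s - a1) +i* (y - a2) by [].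
  rewrite !Re_inv subr_ge0.
  apply: (@le_trans _ _ 0).
    rewrite mulr_le0_ge0 ?invr_ge0 ?addr_ge0 ?sqr_ge0//; lra.
  by apply: divr_ge0; [lra|rewrite addr_ge0 ?sqr_ge0].
refine (le_trans _ (lerD h1 h2)).
have -> : (8 * s)^-1 * (p + s - (p - s)) = 4^-1 by field; rewrite gt_eqF.
by rewrite addr0.
Qed.

(** Around a fixed square, the vanishing of the integrals of [quot f a] and [quot f b] equates
    [(f a - f b)] times the integral of [1 / (z - a)] with an integral carrying the factor [b - a].
    The former integral is at least 1/4 in modulus, so one may divide. *)
Lemma local_lipschitz f c r : 0 < r ->
  (forall z, nc (z - c) < r -> exists d, cdiff f z d) ->
  exists2 s, 0 < s & exists2 K, 0 < K & forall a b, nc (a - c) < s -> nc (b - c) < s ->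
    nc (f a - f b) <= K * nc (a - b).
Proof.
move=> r0 fd.
have [dc /cdiff_cont/(_ _ ltr01)[t t0 ft]] := fd c ltac:(rewrite subrr nc0//).
(* Points of the square of half-side [s] are within [2 * s] of the centre, hence within both [r] and
   [t]. *)
pose s := Num.min (r / 3) (t / 3).
have s0 : 0 < s by rewrite lt_min !divr_gt0.
have [sr st] : s <= r / 3 /\ s <= t / 3 by rewrite !ge_min !lexx orbT.
case: c fd ft => p q fd ft.
have sq x y : p - s <= x <= p + s -> q - s <= y <= q + s -> nc ((x +i* y) - (p +i* q)) <= 2 * s.
  move=> /andP[? ?] /andP[? ?]; apply: le_trans (nc_le _) _; rewrite ReB ImB /=.
  have : `|x - p| <= s by rewrite ler_norml; apply/andP; split; lra.
  have : `|y - q| <= s by rewrite ler_norml; apply/andP; split; lra.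
  lra.
have fdQ x y : p - s <= x <= p + s -> q - s <= y <= q + s -> exists d, cdiff f (x +i* y) d.
  by move=> hx hy; apply: fd; have := sq x y hx hy; lra.
have f1 x y : p - s <= x <= p + s -> q - s <= y <= q + s -> nc (f (x +i* y) - f (p +i* q)) <= 1.
  by move=> hx hy; apply: ft; have := sq x y hx hy; lra.
exists (s / 2); first lra.
(* 4 undoes the lower bound 1/4. The rest is [rint_bound] for [m], of size at most
   [2 * nc (a - b) * 4 / s ^+ 2], on a square with side [2 * s]. *)
exists (4 * (16 * 8 / s)); first by rewrite !mulr_gt0 ?invr_gt0.
move=> [a1 a2] [b1 b2] ac bc.
have ca1 : `|a1 - p| < s / 2 by apply: le_lt_trans ac; apply: le_trans (nc_Re _); rewrite ReB.
have ca2 : `|a2 - q| < s / 2 by apply: le_lt_trans ac; apply: le_trans (nc_Im _); rewrite ImB.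
have cb1 : `|b1 - p| < s / 2 by apply: le_lt_trans bc; apply: le_trans (nc_Re _); rewrite ReB.
have cb2 : `|b2 - q| < s / 2 by apply: le_lt_trans bc; apply: le_trans (nc_Im _); rewrite ImB.
have /(rint_inv_sub s0) := ltW ca1; move/(_ _ _ (ltW ca2)).
move: ca1 ca2 cb1 cb2; rewrite !ltr_norml => /andP[? ?] /andP[? ?] /andP[? ?] /andP[? ?].
set a := a1 +i* a2; set b := b1 +i* b2; set k := fun z => (z - a)^-1 => K4.
set x0 := p - s in K4 *; set x1 := p + s in K4 *.
set y0 := q - s in K4 *; set y1 := q + s in K4 *.
have qa : rint (quot f a) x0 x1 y0 y1 = 0.
  by apply: rint_quot => //; apply/andP; split; rewrite /x0 /x1 /y0 /y1; lra.
have qb : rint (quot f b) x0 x1 y0 y1 = 0.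
  by apply: rint_quot => //; apply/andP; split; rewrite /x0 /x1 /y0 /y1; lra.
(* Away from [a] and [b], [quot f b] is [quot f a + (f a - f b) * k + m]. *)
pose m z := (f z - f b) * ((b - a) * ((z - b)^-1 * (z - a)^-1)).
pose bd x y := (x0 <= x <= x1 /\ (y = y0 \/ y = y1)) \/ (y0 <= y <= y1 /\ (x = x0 \/ x = x1)).
have bdQ x y : bd x y -> [/\ x0 <= x <= x1, y0 <= y <= y1, s / 2 <= nc ((x +i* y) - a) &
    s / 2 <= nc ((x +i* y) - b)].
  have far (c1 c2 : R) : p - s / 2 < c1 < p + s / 2 -> q - s / 2 < c2 < q + s / 2 -> bd x y ->
      s / 2 <= nc ((x +i* y) - (c1 +i* c2)).
    move=> /andP[? ?] /andP[? ?] [[_ yy]|[_ xx]].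
      apply: le_trans (nc_Im _); rewrite ImB /=; case: yy => ->; rewrite /y0 /y1.
        by rewrite ler0_norm; lra.
      by rewrite ger0_norm; lra.
    apply: le_trans (nc_Re _); rewrite ReB /=; case: xx => ->; rewrite /x0 /x1.
      by rewrite ler0_norm; lra.
    by rewrite ger0_norm; lra.
  move=> xy; split; try by [apply: far => //; apply/andP; split; lra].
    by case: xy => -[? [e|e]] //; rewrite e /x0 /x1; apply/andP; split; lra.
  by case: xy => -[? [e|e]] //; rewrite e /y0 /y1; apply/andP; split; lra.
have ne x y (c : R[i]) : s / 2 <= nc ((x +i* y) - c) -> (x +i* y) != c.
  by move=> h; rewrite -subr_eq0 -nc_gt0; lra.
have hv g : (forall x y, bd x y -> ccont g (x +i* y)) ->
    [/\ hcts g x0 x1 y0, hcts g x0 x1 y1, vcts g x0 y0 y1 & vcts g x1 y0 y1].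
  by move=> gc; split; [apply: ccont_hcts|apply: ccont_hcts|apply: ccont_vcts|apply: ccont_vcts];
    move=> t' ht; apply: gc; rewrite /bd; tauto.
have [kh0 kh1 kv0 kv1] : [/\ hcts k x0 x1 y0, hcts k x0 x1 y1, vcts k x0 y0 y1 & vcts k x1 y0 y1].
  by apply: hv => x y /bdQ[_ _ /ne ? _]; exact: ccont_inv_sub.
have [ah0 ah1 av0 av1] : [/\ hcts (quot f a) x0 x1 y0, hcts (quot f a) x0 x1 y1,
    vcts (quot f a) x0 y0 y1 & vcts (quot f a) x1 y0 y1].
  apply: hv => x y /bdQ[hx hy /ne xa _]; have [d df] := fdQ x y hx hy.
  by have [d' /cdiff_cont] := cdiff_quot xa df.
have [mh0 mh1 mv0 mv1] : [/\ hcts m x0 x1 y0, hcts m x0 x1 y1, vcts m x0 y0 y1 & vcts m x1 y0 y1].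
  apply: hv => x y /bdQ[hx hy /ne xa /ne xb]; have [d df] := fdQ x y hx hy.
  have [d1 dq] := cdiff_quot xb df; have [d2 di] := cdiff_inv_sub xa.
  have := cdiff_cont (cdiffM (cdiffM dq di) (cdiff_cst (b - a) _)).
  by congr (ccont _ _); apply/funext => z; rewrite /m /quot; ring.
have [kah0 kah1 kav0 kav1] : [/\ hcts (fun z => (f a - f b) * k z) x0 x1 y0,
   hcts (fun z => (f a - f b) * k z) x0 x1 y1, vcts (fun z => (f a - f b) * k z) x0 y0 y1 &
   vcts (fun z => (f a - f b) * k z) x1 y0 y1].
  by split; exact: ccts_onZ.
have key : (f a - f b) * rint k x0 x1 y0 y1 = - rint m x0 x1 y0 y1.
  have := qb; rewrite (@eq_rint _ _ (fun z => quot f a z + ((f a - f b) * k z + m z))); last 2 first.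
  - move=> x y xx yy; have /bdQ[_ _ /ne xa /ne xb] : bd x y by left.
    by rewrite /quot /k /m; field; rewrite !subr_eq0 xa xb.
  - move=> x y xx yy; have /bdQ[_ _ /ne xa /ne xb] : bd x y by right.
    by rewrite /quot /k /m; field; rewrite !subr_eq0 xa xb.
  rewrite rintD ?qa ?add0r//; try exact: ccts_onD.
  by rewrite rintD// rintZ// => /eqP; rewrite addr_eq0 => /eqP.
have mM x y : bd x y -> nc (m (x +i* y)) <= 2 * (nc (a - b) * (4 / s ^+ 2)).
  move=> xy; have [hx hy ha hb] := bdQ x y xy.
  rewrite /m !ncM !ncV (ncB b a); apply: ler_pM; rewrite ?mulr_ge0 ?invr_ge0 ?nc_ge0//.
    apply: le_trans (nc_tri (f (p +i* q)) _ _) _.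
    have := f1 x y hx hy; have : nc (f b - f (p +i* q)) <= 1.
      by apply: f1; apply/andP; split; lra.
    by rewrite (ncB (f b)) => h1 h2; lra.
  apply: ler_wpM2l; first exact: nc_ge0.
  have -> : 4 / s ^+ 2 = (s / 2)^-1 * (s / 2)^-1 by field; rewrite gt_eqF.
  have p2 : 0 < s / 2 by lra.
  by apply: ler_pM; rewrite ?invr_ge0 ?nc_ge0// lef_pV2 ?posrE//; lra.
have mB : nc (rint m x0 x1 y0 y1) <= 16 * 8 * nc (a - b) / s.
  apply: le_trans (_ : 4 * (2 * (nc (a - b) * (4 / s ^+ 2))) * ((x1 - x0) + (y1 - y0)) <= _).
    apply: rint_bound => //; try by rewrite /x0 /x1 /y0 /y1; lra.
      by move=> x y hx hy; apply: mM; left.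
    by move=> x y hx hy; apply: mM; right.
  by rewrite le_eqVlt /x0 /x1 /y0 /y1; apply/orP; left; apply/eqP; field; rewrite gt_eqF.
have : nc (f a - f b) * 4^-1 <= 16 * 8 * nc (a - b) / s.
  apply: le_trans mB; rewrite -[leRHS]ncN -key ncM.
  by apply: ler_wpM2l => //; exact: nc_ge0.
have -> : 4 * (16 * 8 / s) * nc (a - b) = 4 * (16 * 8 * nc (a - b) / s) by ring.
lra.
Qed.

End local_lipschitz_estimate.

(** * Stable neighbourhoods of the disk and a uniform Lipschitz constant *)

Section disk_neighbourhoods.
Local Open Scope complex_scope.
Variable R : realType.
Implicit Types (f g : R[i] -> R[i]) (x y s r : R) (z w c d : R[i]).

Lemma nc_sqr z : nc z ^+ 2 = complex.Re z ^+ 2 + complex.Im z ^+ 2.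
Proof. by case: z => u v; rewrite sqr_sqrtr// addr_ge0 ?sqr_ge0. Qed.

Lemma diskE z : disk R z <-> nc (z - 2^-1%:C) <= 2^-1.
Proof.
have half : (2^-1 : R[i]) = (2^-1 : R)%:C by rewrite fmorphV rmorph_nat.
rewrite /disk /= half.
by change (((nc (z - 2^-1%:C))%:C <= 2^-1%:C) <-> (nc (z - 2^-1%:C) <= 2^-1)); rewrite lecR.
Qed.

(* The disk with diameter ]- a, 1 / (1 - a) + a[. It lies in [- a < Re z] and
   contains the disk with diameter ]0, 1 / (1 - a)[, which is the image of
   [1 - a < Re z] under inversion; so every [1 / (z + n)] preserves it. *)
Definition vreg (a : R) : set R[i] :=
  [set z | nc (z - (2 * (1 - a))^-1%:C) < (2 * (1 - a))^-1 + a].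

Let half_lt (a : R) : 0 < a -> a <= 10^-1 -> 2^-1 < (2 * (1 - a))^-1.
Proof. move=> a0 a1; have s0 : 0 < 1 - a by lra.
by rewrite ltf_pV2 ?posrE ?mulr_gt0//; lra.
Qed.

Lemma vreg_open (a : R) z : vreg a z -> exists2 r, 0 < r & forall w, nc (w - z) < r -> vreg a w.
Proof.
rewrite /vreg /=; move: (_^-1%:C) (_^-1 + a) => c r zr.
exists (r - nc (z - c)); first by rewrite subr_gt0.
by move=> w wz; have := nc_tri z w c; lra.
Qed.

Lemma disk_vreg (a : R) z : 0 < a -> a <= 10^-1 -> disk R z -> vreg a z.
Proof.
move=> a0 a1; have c0 := half_lt a0 a1; move=> /diskE zd; rewrite /vreg /=.
apply: le_lt_trans (nc_tri (2^-1%:C) _ _) _.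
rewrite -rmorphB nc_real ltr0_norm; last by rewrite subr_lt0.
lra.
Qed.

Lemma vreg_Re (a : R) z : vreg a z -> - a < complex.Re z.
Proof.
move=> /(le_lt_trans (nc_Re _)); rewrite ReB /= ltr_norml => /andP[h _]; lra.
Qed.

Lemma vreg_inv (a : R) z (n : nat) : 0 < a -> a <= 10^-1 ->
  vreg a z -> vreg a (z + n.+1%:R)^-1.
Proof.
move=> a0 a1; have s0 : 0 < 1 - a by lra.
move=> /vreg_Re za; set w := z + _.
have ws : 1 - a < complex.Re w.
  have n1 : 1 <= n.+1%:R :> R by rewrite ler1n.
  by rewrite /w -(rmorph_nat (real_complex R)); case: (z) za => u v /=; lra.
have w0 : w != 0 by apply/eqP => w0; move: ws; rewrite w0 /=; lra.
have ss : (2 * (1 - a))%:C != 0 :> R[i].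
  by rewrite -nc_eq0 nc_real normr_eq0 gt_eqF//; lra.
rewrite /vreg /=; set k := (2 * (1 - a))^-1.
suff : nc (w^-1 - k%:C) < k by lra.
(* The claim becomes that [w] is closer to 0 than to [2 * (1 - a)], that is [1 - a < Re w]. *)
have -> : w^-1 - k%:C = ((2 * (1 - a))%:C - w) * ((2 * (1 - a))%:C * w)^-1.
  have -> : k%:C = ((2 * (1 - a))%:C)^-1 by rewrite fmorphV.
  by move: ss; move: (_%:C) => S ss; field; rewrite ss w0.
rewrite ncM ncV ncM nc_real gtr0_norm; last lra.
rewrite invfM mulrCA -[ltRHS]mulr1 ltr_pM2l ?invr_gt0; last lra.
rewrite ltr_pdivrMr ?nc_gt0// mul1r.
rewrite -(@ltr_pXn2r _ 2)// ?nnegrE ?nc_ge0// !nc_sqr ReB ImB /=.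
by move: ws; move: (complex.Re w) (complex.Im w) => u v; nra.
Qed.

Lemma vreg_near (a : R) z : 0 < a -> a <= 10^-1 ->
  vreg a z -> exists2 w, disk R w & nc (z - w) <= 3 * a.
Proof.
move=> a0 a1; have s0 : 0 < 1 - a by lra.
have c0 := half_lt a0 a1.
rewrite /vreg /=; set c := (2 * (1 - a))^-1 in c0 *; move=> zr.
have r0 : 0 < c + a by lra.
have ca : 2 * c - 1 <= 2 * a.
  have : 2 * c = (1 - a)^-1 by rewrite /c; field; rewrite gt_eqF.
  move=> ->; rewrite lerBlDr -(@ler_pM2r _ (1 - a))// mulVf ?gt_eqF//; nra.
(* The ratio of the two radii: [w] is the image of [z] under the homothety from [vreg a] to the
   disk. It moves points by at most [(c - 1/2) + (c + a - 1/2)], and [2 * c - 1 <= 2 * a]. *)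
pose t := (2 * (c + a))^-1.
have t1 : t < 1 by rewrite invf_lt1; lra.
have t0 : 0 < t by rewrite invr_gt0; lra.
have tr : t * (c + a) = 2^-1 by rewrite /t; field; rewrite gt_eqF.
exists (2^-1%:C + (z - c%:C) * t%:C).
  apply/diskE; rewrite addrC addKr ncM nc_real gtr0_norm//.
  by rewrite mulrC -tr ler_pM2l// ltW.
have -> : z - (2^-1%:C + (z - c%:C) * t%:C) = (c - 2^-1)%:C + (z - c%:C) * (1 - t)%:C.
  by rewrite !rmorphB rmorph1; ring.
apply: le_trans (ncD _ _) _; rewrite ncM !nc_real !gtr0_norm; try lra.
have : nc (z - c%:C) * (1 - t) <= (c + a) * (1 - t) by rewrite ler_pM2r; lra.
lra.
Qed.

(** Compactness makes the local bounds uniform. Two close points lie in a common ball with a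
    Lipschitz bound; for two distant points a bound on the values of [g] does. *)
Lemma lipschitz_near_disk (U : set R[i]^o) (g : R[i]^o -> R[i]^o) :
  open U -> disk R `<=` U -> (forall z, U z -> derivable g z 1) ->
  exists a K : R, [/\ 0 < a <= 10^-1, 0 < K, vreg a `<=` U & lip_on (vreg a) K g].
Proof.
move=> oU DU gd.
(* One parameter [c] is inverse radius, Lipschitz constant and bound on [g], so that a single large
   value serves the whole disk. *)
pose P (c : R) (p : R * R) := disk R (p.1 +i* p.2) -> forall y y' : R[i],
  nc (y - (p.1 +i* p.2)) < c^-1 -> nc (y' - (p.1 +i* p.2)) < c^-1 ->
  [/\ U y, nc (g y - g y') <= c * nc (y - y') & nc (g y) <= c].
(* A product of real segments containing the disk, hence compact; [P] is vacuous off the disk. *)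
pose sq : set (R * R) := `[0, 1]%classic `*` `[-1, 1]%classic.
have ncp (p q : R * R) r : ball p r q -> nc ((q.1 +i* q.2) - (p.1 +i* p.2)) < 2 * r.
  move=> [/= b1 b2]; apply: le_lt_trans (nc_le _) _; rewrite ReB ImB /=.
  move: b1 b2; rewrite /ball /= distrC => b1; rewrite distrC => b2; lra.
have : compact sq by apply: compact_setX; exact: segment_compact.
move=> /compact_near_coveringP/(_ R (pinfty_nbhs R) P _)[].
  move=> p _; have [pD|npD] := pselect (disk R (p.1 +i* p.2)); last first.
    pose r := nc ((p.1 +i* p.2) - 2^-1%:C) - 2^-1.
    have r0 : 0 < r by rewrite subr_gt0 ltNge; apply/negP => /diskE.
    exists (ball p (r / 2), setT); first by split; [apply: nbhsx_ballx; lra|exact: filterT].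
    move=> [q c] [/ncp pq _]; rewrite /P /= => /diskE qD; exfalso.
    have := nc_tri (q.1 +i* q.2) (p.1 +i* p.2) (2^-1%:C).
    by rewrite (ncB _ (q.1 +i* q.2)); move: pq; rewrite /r /=; lra.
  set z := p.1 +i* p.2 in pD.
  have [r r0 rU] : exists2 r : R, 0 < r & forall w, nc (w - z) < r -> U w.
    by apply/nbhs_cP; apply: open_nbhs_nbhs; split => //; exact: DU.
  have [s s0 [K K0 gL]] : exists2 s, 0 < s & exists2 K, 0 < K &
      forall y y' : R[i], nc (y - z) < s -> nc (y' - z) < s -> nc (g y - g y') <= K * nc (y - y').
    apply: (local_lipschitz r0) => w /rU /gd; exact: (derivable_cdiff g w).1.
  pose t := Num.min r s.
  have t0 : 0 < t by rewrite lt_min r0.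
  have [tr ts] : t <= r /\ t <= s by rewrite !ge_min !lexx orbT.
  (* [q] is within [t / 2] of [z] and [c^-1 < t / 2], so the ball of radius [c^-1] about [q] stays
     within [t] of [z]. *)
  exists (ball p (t / 4), [set c | Num.max (2 / t) (K + nc (g z) + K * s) < c]).
    by split; [apply: nbhsx_ballx; lra|apply: nbhs_pinfty_gt; rewrite num_real].
  move=> [q c] [/ncp pq]; rewrite /P /= gt_max => /andP[c1 c2] _ y y' yq yq'.
  rewrite -/z in pq.
  have c0 : 0 < c by apply: lt_trans c1; rewrite divr_gt0.
  have ct : c^-1 < t / 2 by rewrite invf_plt ?posrE ?divr_gt0// invf_div.
  have yz : nc (y - z) < t by have := nc_tri (q.1 +i* q.2) y z; lra.
  have yz' : nc (y' - z) < t by have := nc_tri (q.1 +i* q.2) y' z; lra.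
  have Ks : 0 <= K * s by rewrite mulr_ge0 ?ltW.
  have gz0 := nc_ge0 (g z).
  split; first by apply: rU; lra.
    apply: le_trans (gL _ _ _ _) _; try lra.
    by apply: ler_wpM2r; [exact: nc_ge0|lra].
  have := gL y z ltac:(lra) ltac:(rewrite subrr nc0; lra).
  have : K * nc (y - z) <= K * s by rewrite ler_pM2l//; lra.
  by have := ncD (g y - g z) (g z); rewrite subrK; lra.
move=> M [_ /(_ (Num.max M 1 + 1))]; set c := _ + 1 => PM.
have {PM}Pc : sq `<=` P c by apply: PM; rewrite /c ltr_pwDr// le_max lexx.
have M1 : 1 <= Num.max M 1 by rewrite le_max lexx orbT.
have c1 : 1 <= c by rewrite /c; lra.
have V0 : 0 < (12 * c)^-1 by rewrite invr_gt0; lra.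
(* By [vreg_near], points of [vreg a] are then within [3 * a <= c^-1 / 4] of the disk. *)
pose a := Num.min 10^-1 (12 * c)^-1.
have a0 : 0 < a by rewrite lt_min V0; lra.
have [a1 a2] : a <= 10^-1 /\ a <= (12 * c)^-1 by rewrite !ge_min !lexx orbT.
have e12 : 3 * (12 * c)^-1 = c^-1 / 4 by field; rewrite gt_eqF//; lra.
have cV0 : 0 < c^-1 by rewrite invr_gt0; lra.
have near (y : R[i]) : vreg a y ->
    exists2 p, disk R (p.1 +i* p.2) & P c p /\ nc (y - (p.1 +i* p.2)) <= c^-1 / 4.
  move=> /(vreg_near a0 a1)[[u v] uD yw]; exists (u, v) => //; split; last by move: yw => /=; lra.
  apply: Pc; have /diskE uvD := uD.
  have := nc_Re ((u +i* v) - 2^-1%:C); have := nc_Im ((u +i* v) - 2^-1%:C).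
  rewrite ReB ImB /= subr0 => h1 h2.
  have := le_trans h1 uvD; have := le_trans h2 uvD; rewrite !ler_norml => /andP[? ?] /andP[? ?].
  by split; rewrite /= in_itv /=; apply/andP; split; lra.
exists a, (c + 4 * c ^+ 2); split; [by rewrite a0| | |].
- by rewrite ltr_pwDl ?mulr_ge0 ?sqr_ge0//; lra.
- move=> y /near[p pD [Pp yp]].
  have yc : nc (y - (p.1 +i* p.2)) < c^-1 by lra.
  by have [] := Pp pD y y yc yc.
move=> y y' /near[p pD [Pp yp]] /near[p' pD' [Pp' yp']].
have yy0 := nc_ge0 (y - y').
have yc : nc (y - (p.1 +i* p.2)) < c^-1 by lra.
have yc' : nc (y' - (p'.1 +i* p'.2)) < c^-1 by lra.
have [yy|yy] := ltP (nc (y - y')) (c^-1 / 2).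
  have y'c : nc (y' - (p.1 +i* p.2)) < c^-1.
    by have := nc_tri y y' (p.1 +i* p.2); rewrite (ncB y' y); lra.
  have [_ h _] := Pp pD y y' yc y'c.
  by apply: le_trans h _; rewrite ler_wpM2r// lerDl mulr_ge0 ?sqr_ge0.
(* Distant points: the values differ by at most [2 * c], which is [4 * c ^+ 2] times the minimal
   distance [c^-1 / 2]. *)
have [_ _ h] := Pp pD y y yc yc.
have [_ _ h'] := Pp' pD' y' y' yc' yc'.
apply: le_trans (ncD _ _) _; rewrite ncN.
have h1 : 4 * c ^+ 2 * (c^-1 / 2) <= 4 * c ^+ 2 * nc (y - y').
  by apply: ler_wpM2l => //; rewrite mulr_ge0 ?sqr_ge0.
have e1 : 4 * c ^+ 2 * (c^-1 / 2) = 2 * c by field; rewrite gt_eqF//; lra.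
have h2 : 0 <= c * nc (y - y') by rewrite mulr_ge0//; lra.
rewrite e1 in h1; rewrite mulrDl.
apply: le_trans (lerD h h') _; lra.
Qed.

End disk_neighbourhoods.

(** * The averaging operator *)

Section gauss_operator.
Local Open Scope complex_scope.
Variable R : realType.
Implicit Types (f g h : R[i] -> R[i]) (z w : R[i]) (x y K M C q : R) (n k N : nat).

Lemma le_geometric q C x y : 0 <= q < 1 -> (forall N, x <= y + C * q ^+ N) -> x <= y.
Proof.
move=> /andP[q0 q1] h; apply/ler_addgt0Pr => e e0.
have : geometric C q @ \oo --> 0 by apply: cvg_geometric; rewrite ger0_norm.
move=> /cvgrPdist_lt/(_ _ e0)[N _ /(_ N (leqnn N))] /=; rewrite sub0r normrN => eN.
by have := h N; have := ler_norm (C * q ^+ N); lra.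
Qed.

Lemma exp2V n : 2 ^- n = 2^-1 ^+ n :> R. Proof. by rewrite exprVn. Qed.

Lemma le_pow2 C x y : (forall N, x <= y + C * 2 ^- N) -> x <= y.
Proof.
move=> h; apply: (@le_geometric 2^-1 C); first by apply/andP; split; lra.
by move=> N; rewrite -exp2V.
Qed.

Lemma exp2S n : 2 ^- n = 2 * 2 ^- n.+1 :> R.
Proof. by rewrite exprS; field; rewrite expf_neq0. Qed.

Lemma exp2_gt0 n : 0 < 2 ^- n :> R.
Proof. by rewrite invr_gt0 exprn_gt0. Qed.

Lemma dyadic_series (t : nat -> R[i]^o) M : (forall n, nc (t n) <= M * 2 ^- n.+1) ->
  (series t @ \oo --> limn (series t)) /\
  forall N, nc (limn (series t) - series t N) <= M * 2 ^- N.
Proof.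
move=> tM; have M0 : 0 <= M.
  by have := le_trans (nc_ge0 _) (tM 0); rewrite pmulr_lge0 ?exp2_gt0.
have [l lP] : exists l : R[i], forall N, nc (l - series t N) <= M * 2 ^- N.
  apply: geometric_limit.
    rewrite (_ : (fun N => M * 2 ^- N) = geometric M 2^-1).
      by apply: cvg_geometric; rewrite ger0_norm; lra.
    by apply/funext => n; rewrite exp2V.
  (* Induction on [m] goes through for this telescoping bound. *)
  move=> n m nm; apply: (@le_trans _ _ (M * 2 ^- n - M * 2 ^- m)); last first.
    by rewrite gerBl mulr_ge0// ltW// exp2_gt0.
  elim: m nm => [|m IH]; first by rewrite leqn0 => /eqP ->; rewrite !subrr nc0.
  rewrite leq_eqVlt => /predU1P[<-|/IH {}IH]; first by rewrite !subrr nc0.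
  rewrite seriesSr -addrAC; apply: le_trans (ncD _ _) _.
  by have := tM m; have := exp2S m; nra.
have tl : series t @ \oo --> (l : R[i]^o).
  apply/cvg_cP => e e0.
  have : geometric M 2^-1 @ \oo --> 0 by apply: cvg_geometric; rewrite ger0_norm; lra.
  move=> /cvgrPdist_lt/(_ _ e0); apply: filterS => n /=; rewrite sub0r normrN => en.
  by rewrite ncB; apply: le_lt_trans (lP n) _; apply: le_lt_trans en; rewrite exp2V ler_norm.
have -> : limn (series t) = l by apply: cvg_lim => //; exact: norm_hausdorff.
by [].
Qed.

Lemma series_at0 (t : nat -> R[i]^o) : series t 0 = 0.
Proof. by rewrite seriesEnat /= big_geq. Qed.

Definition gterm f z n : R[i]^o := 2 ^- n.+1 * f (z + n.+1%:R)^-1.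
Definition gop f z : R[i] := limn (series (gterm f z)).

Lemma gop_lim f z (l : R[i]^o) : series (gterm f z) @ \oo --> l -> gop f z = l.
Proof. by move=> h; apply: cvg_lim h; exact: norm_hausdorff. Qed.

(** Common to the disk and the regions [vreg a]; the bound on the real part keeps every [z + n.+1]
    at modulus at least 9/10. *)
Definition gauss_stable (W : set R[i]) :=
  forall z, W z -> - 10^-1 <= complex.Re z /\ forall n, W (z + n.+1%:R)^-1.
Definition bounded_on (W : set R[i]) M f := forall z, W z -> nc (f z) <= M.

Lemma nc_gterm f z n : nc (gterm f z n) = 2 ^- n.+1 * nc (f (z + n.+1%:R)^-1).
Proof. by rewrite ncM nc_exp2. Qed.

Section stable_region.
Variable W : set R[i].
Hypothesis Wst : gauss_stable W.

Lemma gop_cvg f M : bounded_on W M f -> forall z, W z ->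
  (series (gterm f z) @ \oo --> (gop f z : R[i]^o)) /\
  forall N, nc (gop f z - series (gterm f z) N) <= M * 2 ^- N.
Proof.
move=> fM z Wz; apply: dyadic_series => n.
by rewrite nc_gterm mulrC ler_wpM2r ?(ltW (exp2_gt0 _))//; apply: fM; exact: (Wst Wz).2.
Qed.

Lemma gop_bounded f M : bounded_on W M f -> bounded_on W M (gop f).
Proof.
move=> fM z Wz; have := (gop_cvg fM Wz).2 0.
by rewrite series_at0 subr0 expr0 invr1 mulr1.
Qed.

Lemma gopD f g M M' : bounded_on W M f -> bounded_on W M' g -> forall z, W z ->
  gop (fun z => f z + g z) z = gop f z + gop g z.
Proof.
move=> fM gM z Wz; apply: gop_lim.
have -> : series (gterm (fun z => f z + g z) z) = series (gterm f z) + series (gterm g z).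
  by apply/funext => N; rewrite !seriesEnat !fctE -big_split; apply: eq_bigr => n _; exact: mulrDr.
by apply: cvgD; [exact: (gop_cvg fM Wz).1|exact: (gop_cvg gM Wz).1].
Qed.

Lemma gopZ f c M : bounded_on W M f -> forall z, W z ->
  gop (fun z => c * f z) z = c * gop f z.
Proof.
move=> fM z Wz; apply: gop_lim.
have -> : series (gterm (fun z => c * f z) z) = (fun N => c *: (series (gterm f z) N : R[i]^o)).
  apply/funext => N; rewrite !seriesEnat scaler_sumr; apply: eq_bigr => n _.
  by rewrite /gterm mulrCA.
by apply: cvgZr; exact: (gop_cvg fM Wz).1.
Qed.

Lemma bounded_onN f M : bounded_on W M f -> bounded_on W M (fun z => -1 * f z).
Proof. by move=> fM z /fM; rewrite mulN1r ncN. Qed.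

Lemma gopB f g M M' : bounded_on W M f -> bounded_on W M' g -> forall z, W z ->
  gop (fun z => f z - g z) z = gop f z - gop g z.
Proof.
move=> fM gM z Wz; rewrite -[- gop g z]mulN1r -(gopZ _ gM Wz) -(gopD fM (bounded_onN gM) Wz).
by congr gop; apply/funext => v; rewrite mulN1r.
Qed.

Lemma Re_shift z n : W z -> n%:R + 9 / 10 <= complex.Re (z + n.+1%:R).
Proof.
move=> /Wst[z0 _]; rewrite -(rmorph_nat (real_complex R)) -natr1.
by case: z z0 => u v /=; lra.
Qed.

(* [1 / 0.9 ^ 2 < 5 / 4] and [1 / 1.9 ^ 2 < 1 / 3]; the contraction factor is
   then [5 / 4 * 1 / 2 + 1 / 3 * (1 / 4 + 1 / 8 + ...) = 19 / 24 < 4 / 5]. *)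
Lemma inv_shift_lip z w n : W z -> W w ->
  nc ((z + n.+1%:R)^-1 - (w + n.+1%:R)^-1) <= (if n == 0 then 5 / 4 else 3^-1) * nc (z - w).
Proof.
move=> Wz Ww; have zn := Re_shift n Wz; have wn := Re_shift n Ww.
have {}zn : n%:R + 9 / 10 <= nc (z + n.+1%:R).
  by apply: le_trans zn _; apply: le_trans (nc_Re _); exact: ler_norm.
have {}wn : n%:R + 9 / 10 <= nc (w + n.+1%:R).
  by apply: le_trans wn _; apply: le_trans (nc_Re _); exact: ler_norm.
have n0 : 0 <= n%:R :> R by [].
have z0 : 0 < nc (z + n.+1%:R) by lra.
have w0 : 0 < nc (w + n.+1%:R) by lra.
have -> : (z + n.+1%:R)^-1 - (w + n.+1%:R)^-1 =
   (w - z) * ((z + n.+1%:R) * (w + n.+1%:R))^-1.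
  have -> : w - z = (w + n.+1%:R) - (z + n.+1%:R) by ring.
  by move: (z + _) (w + _) z0 w0 => p q p0 q0; field; rewrite -!nc_eq0 !gt_eqF.
rewrite ncM ncV ncM (ncB w z) mulrC ler_wpM2r ?nc_ge0//.
have [E|nz] := eqVneq n 0%N.
  have n00 : n%:R = 0 :> R by rewrite E.
  have -> : 5 / 4 = (4 / 5)^-1 :> R by field.
  rewrite lef_pV2 ?posrE ?mulr_gt0//; nra.
have n1 : 1 <= n%:R :> R by rewrite ler1n lt0n.
rewrite lef_pV2 ?posrE ?mulr_gt0//.
have zs : 19 / 10 <= nc (z + n.+1%:R) by lra.
have ws : 19 / 10 <= nc (w + n.+1%:R) by lra.
nra.
Qed.

Lemma gterm_lip f K n z w : 0 <= K -> lip_on W K f -> W z -> W w ->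
  nc (gterm f z n - gterm f w n) <=
    2 ^- n.+1 * (K * ((if n == 0 then 5 / 4 else 3^-1) * nc (z - w))).
Proof.
move=> K0 fK Wz Ww; rewrite -mulrBr ncM nc_exp2 ler_pM2l ?exp2_gt0//.
apply: le_trans (fK _ _ ((Wst Wz).2 n) ((Wst Ww).2 n)) _.
by rewrite ler_wpM2l// inv_shift_lip.
Qed.

(** Every branch gets the crude constant 5/4 here, as only the geometric decay of the tail
    matters. *)
Lemma series_gterm_lip f K n m : 0 <= K -> lip_on W K f -> (n <= m)%N ->
  lip_on W (5 / 4 * K * 2 ^- n) (fun z => series (gterm f z) m - series (gterm f z) n).
Proof.
move=> K0 fK nm z w Wz Ww; have zw := nc_ge0 (z - w).
apply: (@le_trans _ _ (5 / 4 * K * (2 ^- n - 2 ^- m) * nc (z - w))); last first.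
  by rewrite ler_wpM2r// ler_wpM2l ?gerBl ?(ltW (exp2_gt0 _))//; lra.
elim: m nm => [|m IH]; first by rewrite leqn0 => /eqP ->; rewrite !subrr nc0 mulr0 mul0r.
rewrite leq_eqVlt => /predU1P[<-|/IH {}IH]; first by rewrite !subrr nc0 mulr0 mul0r.
rewrite !seriesSr.
have -> : series (gterm f z) m + gterm f z m - series (gterm f z) n -
   (series (gterm f w) m + gterm f w m - series (gterm f w) n) =
   (series (gterm f z) m - series (gterm f z) n - (series (gterm f w) m - series (gterm f w) n)) +
   (gterm f z m - gterm f w m) by ring.
apply: le_trans (ncD _ _) _.
have : nc (gterm f z m - gterm f w m) <= 5 / 4 * K * 2 ^- m.+1 * nc (z - w).
  apply: le_trans (gterm_lip m K0 fK Wz Ww) _.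
  have -> : 5 / 4 * K * 2 ^- m.+1 * nc (z - w) = 2 ^- m.+1 * (K * (5 / 4 * nc (z - w))) by ring.
  rewrite ler_pM2l ?exp2_gt0// ler_wpM2l//; case: ifP => _; lra.
rewrite (exp2S m) in IH; lra.
Qed.

Lemma series_gterm_contract f K N z w : 0 <= K -> lip_on W K f -> W z -> W w ->
  nc (series (gterm f z) N - series (gterm f w) N) <= 4 / 5 * K * nc (z - w).
Proof.
move=> K0 fK Wz Ww; have zw := nc_ge0 (z - w); have Kz : 0 <= K * nc (z - w) by rewrite mulr_ge0.
case: N => [|N].
  by rewrite !series_at0 subrr nc0 -mulrA mulr_ge0//; lra.
(* 5/8 is the term of index 0; [2^-1 - 2 ^- N.+1] is the sum of the weights of the other terms. *)
suff : nc (series (gterm f z) N.+1 - series (gterm f w) N.+1) <=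
    (5 / 8 + 3^-1 * (2^-1 - 2 ^- N.+1)) * (K * nc (z - w)).
  by have := exp2_gt0 N.+1; nra.
elim: N => [|N IH].
  rewrite !seriesSr !series_at0 !add0r.
  by have := gterm_lip 0 K0 fK Wz Ww; rewrite eqxx expr1; lra.
rewrite [series (gterm f z) _]seriesSr [series (gterm f w) _]seriesSr opprD addrACA.
apply: le_trans (ncD _ _) _; have /= := gterm_lip N.+1 K0 fK Wz Ww.
by rewrite (exp2S N.+1) in IH; have := exp2_gt0 N.+2; lra.
Qed.

Lemma gop_lip f M K : bounded_on W M f -> 0 <= K -> lip_on W K f ->
  lip_on W (4 / 5 * K) (gop f).
Proof.
move=> fM K0 fK z w Wz Ww; apply: (@le_pow2 (2 * M)) => N.
have hz := (gop_cvg fM Wz).2 N; have hw := (gop_cvg fM Ww).2 N.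
have := series_gterm_contract N K0 fK Wz Ww.
rewrite (ncB _ (series _ _)) in hw.
have := nc_tri (series (gterm f z) N) (gop f z) (gop f w).
have := nc_tri (series (gterm f w) N) (series (gterm f z) N) (gop f w).
rewrite (ncB (series (gterm f w) N)) in hw *; lra.
Qed.

Lemma gop_tail_lip f M K N : bounded_on W M f -> 0 <= K -> lip_on W K f ->
  lip_on W (5 / 4 * K * 2 ^- N) (fun z => gop f z - series (gterm f z) N).
Proof.
move=> fM K0 fK z w Wz Ww; apply: (@le_pow2 (2 * M)) => m.
set S := fun z m => series (gterm f z) m.
have nm : (N <= N + m)%N by rewrite leq_addr.
have := series_gterm_lip K0 fK nm Wz Ww.
have M0 : 0 <= M by exact: le_trans (nc_ge0 _) (fM _ Wz).
have mm : M * 2 ^- (N + m) <= M * 2 ^- m.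
  apply: ler_wpM2l => //; rewrite lef_pV2 ?posrE ?exprn_gt0//.
  by rewrite ler_eXn2l ?ltr1n// leq_addl.
have hz := (gop_cvg fM Wz).2 (N + m); have hw := (gop_cvg fM Ww).2 (N + m).
rewrite -/(S z) -/(S w) in hz hw *.
have -> : gop f z - S z N - (gop f w - S w N) =
  ((gop f z - S z (N + m)) - (gop f w - S w (N + m))) +
  (S z (N + m) - S z N - (S w (N + m) - S w N)) by ring.
move=> hS; apply: le_trans (ncD _ _) _.
have := ncD (gop f z - S z (N + m)) (- (gop f w - S w (N + m))).
rewrite (ncN (gop f w - _)) /S; rewrite /S in hz hw hS *; lra.
Qed.

End stable_region.

Lemma gop_cdiff (V : set R[i]) f M K : gauss_stable V ->
  (forall z, V z -> exists2 r, 0 < r & forall w, nc (w - z) < r -> V w) ->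
  bounded_on V M f -> 0 <= K -> lip_on V K f ->
  (forall z, V z -> exists d, cdiff f z d) ->
  forall z, V z -> exists d, cdiff (gop f) z d.
Proof.
move=> Vst oV fM K0 fK fd.
apply: (@cdiff_lip_limit _ V (fun N z => series (gterm f z) N) _ (fun N => 5 / 4 * K * 2 ^- N)) => //.
- rewrite (_ : (fun N => _) = geometric (5 / 4 * K) 2^-1).
    by apply: cvg_geometric; rewrite ger0_norm; lra.
  by apply/funext => n; rewrite exp2V.
- move=> N z Vz; elim: N => [|N [d IH]].
    exists 0; have := cdiff_cst 0 z; congr cdiff; apply/funext => w.
    by rewrite series_at0.
  have [Rez Vn] := Vst z Vz; have [d' fd'] := fd _ (Vn N).
  have zn0 : z + N.+1%:R != 0.
    by rewrite -nc_gt0; apply: lt_le_trans (nc_Re _); apply: lt_le_trans (ler_norm _);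
      apply: lt_le_trans (Re_shift Vst N Vz); rewrite ltr_wpDl.
  have ds : cdiff (fun w => w + N.+1%:R) z (1 + 0).
    by apply: (@cdiffD _ id (fun=> N.+1%:R)); [exact: cdiff_id|exact: cdiff_cst].
  have dv := cdiff_comp ds (cdiffV zn0).
  have := cdiffM (cdiff_cst (2 ^- N.+1) z) (cdiff_comp dv fd').
  move=> /(cdiffD IH) H; eexists; move: H; congr cdiff; apply/funext => w.
  by rewrite seriesSr.
- by move=> n m nm; exact: series_gterm_lip.
- by move=> n; apply: gop_tail_lip => //; exact: fM.
Qed.

End gauss_operator.

(** * Neumann series and fixed points of the averaging operator *)

Section neumann_series.
Local Open Scope complex_scope.
Variable R : realType.
Implicit Types (f g h : R[i] -> R[i]) (z w : R[i]) (x y K M C q : R) (n k N : nat).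
Variable V : set R[i].
Hypothesis Vst : gauss_stable V.
Hypothesis oV : forall z, V z -> exists2 r, 0 < r & forall w, nc (w - z) < r -> V w.

Let q : R := 4 / 5.
Let q01 : 0 <= q < 1. Proof. by apply/andP; split; rewrite /q; lra. Qed.
Let q0 : 0 < q. Proof. by rewrite /q; lra. Qed.

(** The factor 5 is [1 / (1 - q)]. *)
Lemma geometric_increments (t : nat -> R[i]) (b : R) : 0 <= b ->
  (forall n, nc (t n.+1 - t n) <= b * q ^+ n) ->
  forall n m, (n <= m)%N -> nc (t m - t n) <= 5 * b * q ^+ n.
Proof.
move=> b0 tb n m nm.
apply: (@le_trans _ _ (5 * b * (q ^+ n - q ^+ m))); last first.
  by rewrite ler_wpM2l ?gerBl ?exprn_ge0 ?(ltW q0)//; lra.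
elim: m nm => [|m IH]; first by rewrite leqn0 => /eqP ->; rewrite !subrr nc0 mulr0.
rewrite leq_eqVlt => /predU1P[<-|/IH {}IH]; first by rewrite !subrr nc0 mulr0.
apply: le_trans (nc_tri (t m) _ _) _; have := tb m; rewrite exprS.
have -> : q * q ^+ m = 4 / 5 * q ^+ m by [].
lra.
Qed.

Definition gauss_sum g N z := \sum_(k < N) iter k (@gop R) g z.

(** Decay of the bounds gives the sum pointwise; decay of the Lipschitz constants makes it
    differentiable. *)
Lemma neumann g C K : 0 <= C -> 0 <= K ->
  (forall k, lip_on V (K * q ^+ k) (iter k (@gop R) g)) ->
  (forall k z, V z -> exists d, cdiff (iter k (@gop R) g) z d) ->
  (forall k, bounded_on V (C * q ^+ k) (iter k (@gop R) g)) ->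
  exists f, [/\ forall z, V z -> exists d, cdiff f z d,
    (exists M, bounded_on V M f) &
    forall z, V z -> f z - gop f z = g z].
Proof.
move=> C0 K0 gkK gkd gC.
pose S := gauss_sum g.
have SS N z : S N.+1 z = S N z + iter N (@gop R) g z by rewrite /S /gauss_sum big_ord_recr.
have Sdist z : V z -> forall n m, (n <= m)%N -> nc (S m z - S n z) <= 5 * C * q ^+ n.
  by move=> Vz; apply: geometric_increments => // n; rewrite SS addrC addKr; exact: gC.
have Slip n m : (n <= m)%N -> lip_on V (5 * K * q ^+ n) (fun z => S m z - S n z).
  move=> nm z w Vz Vw; have zw := nc_ge0 (z - w).
  have -> : S m z - S n z - (S m w - S n w) = (S m z - S m w) - (S n z - S n w) by ring.
  have -> : 5 * K * q ^+ n * nc (z - w) = 5 * (K * nc (z - w)) * q ^+ n by ring.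
  apply: (@geometric_increments (fun n => S n z - S n w)) => //; first exact: mulr_ge0.
  move=> k; rewrite !SS.
  have -> : S k z + iter k (@gop R) g z - (S k w + iter k (@gop R) g w) - (S k z - S k w) =
    iter k (@gop R) g z - iter k (@gop R) g w by ring.
  by rewrite mulrAC; exact: gkK.
(* The condition [V z] stands under the existential so that choice defines [f] everywhere. *)
have lim z : exists l, V z -> forall N, nc (l - S N z) <= 5 * C * q ^+ N.
  have [Vz|nVz] := pselect (V z); last by exists 0.
  have [l lP] : exists l, forall N, nc (l - S N z) <= 5 * C * q ^+ N.
    apply: geometric_limit; last exact: Sdist.
    by apply: cvg_geometric; rewrite ger0_norm /q; lra.
  by exists l.
have /choice[f fP] := lim.
have Slip' n : lip_on V (5 * K * q ^+ n) (fun z => f z - S n z).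
  move=> z w Vz Vw; apply: (@le_geometric _ q (10 * C)) => // N.
  have nm : (n <= n + N)%N by rewrite leq_addr.
  have h := Slip _ _ nm z w Vz Vw.
  have hz := fP z Vz (n + N)%N; have hw := fP w Vw (n + N)%N.
  have qN : q ^+ (n + N) <= q ^+ N.
    rewrite exprD ler_piMl ?exprn_ge0 ?(ltW q0)// exprn_ile1 ?(ltW q0)//.
    by rewrite /q; lra.
  have : C * q ^+ (n + N) <= C * q ^+ N by rewrite ler_wpM2l.
  have -> : f z - S n z - (f w - S n w) = (f z - S (n + N)%N z) - (f w - S (n + N)%N w) +
     (S (n + N)%N z - S n z - (S (n + N)%N w - S n w)) by ring.
  move: h; set A := S (n + N)%N z - S n z - _ => h ?.
  apply: le_trans (ncD _ _) _.
  have := ncD (f z - S (n + N)%N z) (- (f w - S (n + N)%N w)).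
  rewrite (ncN (f w - _)); lra.
have SM N : bounded_on V (5 * C) (S N).
  move=> z Vz; have := Sdist z Vz 0%N N (leq0n _).
  by rewrite /S /gauss_sum big_ord0 subr0 expr0 mulr1.
have fM : bounded_on V (5 * C) f.
  move=> z Vz; have := fP z Vz 0%N.
  by rewrite /S /gauss_sum big_ord0 subr0 expr0 mulr1.
exists f; split; last 1 first.
(* Hence [f - gop f - g] is [(f - S N.+1) - gop (f - S N)], and both parts decay like [q ^+ N]. *)
- have gS N z : V z -> gop (S N) z = S N.+1 z - g z.
    elim: N z => [|N IH] z Vz.
      rewrite SS [S 0 z]/S /gauss_sum big_ord0 add0r subrr; apply: gop_lim.
      rewrite (_ : series _ = fun=> 0); first exact: cvg_cst.
      apply/funext => N; rewrite seriesEnat /= big1// => n _.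
      by rewrite /gterm /S /gauss_sum big_ord0 mulr0.
    have -> : S N.+1 = (fun z => S N z + iter N (@gop R) g z) by apply/funext => w; exact: SS.
    by rewrite (gopD Vst (SM N) (gC N) Vz) IH// (SS N.+1) iterS; ring.
  move=> z Vz; apply/eqP; rewrite -subr_eq0 -nc_eq0 eq_le nc_ge0 andbT.
  apply: (@le_geometric _ q (10 * C)) => // N; rewrite add0r.
  have -> : f z - gop f z - g z = (f z - S N.+1 z) - (gop f z - gop (S N) z).
    by rewrite gS//; ring.
  rewrite -(gopB Vst fM (SM N) Vz).
  have : bounded_on V (5 * C * q ^+ N) (gop (fun z => f z - S N z)).
    by apply: gop_bounded => // w Vw; exact: fP.
  move=> /(_ z Vz) h; have := fP z Vz N.+1.
  have : C * q ^+ N.+1 <= C * q ^+ N.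
    rewrite ler_wpM2l// exprS ler_piMl ?exprn_ge0 ?(ltW q0)//; by rewrite /q; lra.
  by move=> ? ?; apply: le_trans (ncD _ _) _; rewrite ncN; lra.
- apply: (@cdiff_lip_limit _ V S _ (fun n => 5 * K * q ^+ n)) => //.
    by apply: cvg_geometric; rewrite ger0_norm /q; lra.
  move=> N z Vz; elim: N => [|N [d IH]].
    exists 0; have := cdiff_cst 0 z; congr cdiff; apply/funext => w.
    by rewrite /S /gauss_sum big_ord0.
  have [d' /(cdiffD IH) H] := gkd N z Vz; exists (d + d').
  by move: H; congr cdiff; apply/funext => w; rewrite SS.
- by exists (5 * C).
Qed.

(* The kernel needs no maximum principle: a fixed function is Lipschitz with
   arbitrarily small constant. *)
Lemma gop_fixed_cst (W : set R[i]) f M K : gauss_stable W -> bounded_on W M f -> 0 <= K ->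
  lip_on W K f -> (forall z, W z -> f z = gop f z) ->
  forall z w, W z -> W w -> f z = f w.
Proof.
move=> Wst fM K0 fK fix_ z w Wz Ww.
have h k : lip_on W (K * q ^+ k) f.
  elim: k => [|k IH]; first by rewrite expr0 mulr1.
  have Kq : 0 <= K * q ^+ k by rewrite mulr_ge0 ?exprn_ge0 ?(ltW q0).
  have := gop_lip Wst fM Kq IH; rewrite exprS mulrCA => hk u v Wu Wv.
  by rewrite (fix_ u)// (fix_ v)//; exact: hk.
apply/eqP; rewrite -subr_eq0 -nc_eq0 eq_le nc_ge0 andbT.
apply: (@le_geometric _ q (K * nc (z - w))) => // k.
by rewrite add0r mulrAC; exact: h.
Qed.

End neumann_series.

(** * Invariance of the Stieltjes integral *)

Section qmark_invariance.
Local Open Scope complex_scope.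
Variable R : realType.
Implicit Types (a b c x y K M e : R) (u v : R -> R) (n k N : nat).
Local Notation F := (@qmark R).
Local Notation mu := (lebesgue_stieltjes_measure (@qmark R)).

(** The inverse branches of the Gauss map: [phi n] reverses [[0, 1]] onto
    [[1 / (n + 2), 1 / (n + 1)]]. *)
Definition phi n x : R := (x + n.+1%:R)^-1.

Lemma phi_den n x : 0 <= x -> 1 <= x + n.+1%:R.
Proof. by move=> x0; have h : 1 <= n.+1%:R :> R; [rewrite ler1n|lra]. Qed.

Lemma phi_itv n x : 0 <= x -> 0 < phi n x <= 1.
Proof.
move=> /(phi_den n) h; apply/andP; split; first by rewrite invr_gt0; lra.
by rewrite invf_le1; lra.
Qed.

Lemma phi_lip n x y : 0 <= x -> 0 <= y -> `|phi n x - phi n y| <= `|x - y|.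
Proof.
move=> /(phi_den n) x0 /(phi_den n) y0.
have -> : phi n x - phi n y = (y - x) / ((x + n.+1%:R) * (y + n.+1%:R)).
  rewrite /phi; have -> : y - x = (y + n.+1%:R) - (x + n.+1%:R) by ring.
  by move: (x + _) (y + _) x0 y0 => p q p0 q0; field; apply/andP; split; rewrite gt_eqF//; lra.
have pq : 1 <= (x + n.+1%:R) * (y + n.+1%:R) by nra.
by rewrite normrM normfV distrC ler_piMr// ger0_norm ?invf_le1; lra.
Qed.

Lemma phi_le n x y : 0 <= x -> x <= y -> phi n y <= phi n x.
Proof.
move=> x0 xy; have := phi_den n x0 => h; rewrite lef_pV2 ?posrE; lra.
Qed.

Lemma phi1 n : phi n 1 = phi n.+1 0.
Proof. by rewrite /phi add0r addrC natr1. Qed.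

Lemma qmarkD x n : 0 <= x -> 1 - F (x + n%:R) = 2 ^- n * (1 - F x).
Proof.
move=> x0; elim: n => [|n IH]; first by rewrite addr0 expr0 invr1 mul1r.
rewrite -natr1 addrA qmarkD1 ?addr_ge0// exprS invfM -mulrA -IH; lra.
Qed.

(** The source of the invariance: each branch scales [dF] by the very weight it has in [gop], up to
    orientation. *)
Lemma qmark_phi n x : 0 <= x -> F (phi n x) = 2 ^- n.+1 * (1 - F x).
Proof.
move=> x0; have h : 0 < x + n.+1%:R by have := phi_den n x0; lra.
by rewrite /phi qmarkV// qmarkD.
Qed.

Lemma cts_on_phi n u : cts_on 0 1 u -> cts_on 0 1 (fun x => u (phi n x)).
Proof.
move=> uc x /andP[x0 x1] e e0.
have /andP[p0 p1] := phi_itv n x0.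
have [r r0 H] := uc (phi n x) ltac:(rewrite (ltW p0) p1//) e e0.
have d1 := phi_den n x0.
(* [y] may be negative; the first radius keeps [y + n.+1] above 1/2, so that [phi n] at most doubles
   distances here. *)
exists (Num.min (2^-1) (r / 2)); first by rewrite lt_min; apply/andP; split; lra.
move=> y; rewrite lt_min => /andP[y1 yr]; apply: H.
have yd : 2^-1 <= y + n.+1%:R by move: y1; rewrite ltr_norml => /andP[? ?]; lra.
have -> : phi n y - phi n x = (x - y) / ((x + n.+1%:R) * (y + n.+1%:R)).
  rewrite /phi; have -> : x - y = (x + n.+1%:R) - (y + n.+1%:R) by ring.
  by move: (x + _) (y + _) d1 yd => p q p0' q0'; field; apply/andP; split; rewrite gt_eqF//; lra.
rewrite normrM normfV distrC (ger0_norm (_ : 0 <= (x + _) * _)); last by nra.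
rewrite ltr_pdivrMr; last by nra.
have : r / 2 <= r * ((x + n.+1%:R) * (y + n.+1%:R)).
  by rewrite ler_pM2l//; nra.
lra.
Qed.

Lemma sint_near a b u c e : a <= b -> cts_on a b u ->
  (forall x, a < x <= b -> `|u x - c| <= e) ->
  `|sint F a b u - c * (F b - F a)| <= e * (F b - F a).
Proof.
move=> ab uc ue; have -> : sint F a b u - c * (F b - F a) = sint F a b (fun x => u x + - c).
  by rewrite sintD ?sint_cst ?mulNr//; exact: cts_on_cst.
apply: sint_bound => //; apply: cts_onD => //; exact: cts_on_cst.
Qed.

Section change_of_variable.
Variables (u : R -> R) (K : R) (n : nat).

(** The defect of the substitution on [[a, b]]; the endpoints are swapped because [phi n]
    decreases. *)
Let D a b := sint F (phi n b) (phi n a) u - 2 ^- n.+1 * sint F a b (fun x => u (phi n x)).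

(** Freezing [u] at [phi n a] makes the two sides equal by [qmark_phi]; the Lipschitz bound controls
    each error by length times mass. *)
Let D_small a b : cts_on 0 1 u -> 0 <= K ->
  (forall x y, 0 <= x <= 1 -> 0 <= y <= 1 -> `|u x - u y| <= K * `|x - y|) ->
  0 <= a -> a <= b -> b <= 1 -> `|D a b| <= 2 * K * (b - a) * (F b - F a).
Proof.
move=> uc K0 uK a0 ab b1; have b0 : 0 <= b by lra.
have pab := phi_le n a0 ab.
have /andP[pa0 pa1] := phi_itv n a0; have /andP[pb0 pb1] := phi_itv n b0.
have Fab : 0 <= F b - F a by rewrite subr_ge0 qmark_mono.
have pdist := phi_lip n a0 b0; rewrite distrC (ler0_norm (_ : a - b <= 0)) in pdist; last lra.
rewrite (ler0_norm (_ : phi n b - phi n a <= 0)) in pdist; last lra.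
have h1 : `|sint F (phi n b) (phi n a) u - u (phi n a) * (2 ^- n.+1 * (F b - F a))| <=
    K * (b - a) * (2 ^- n.+1 * (F b - F a)).
  have -> : 2 ^- n.+1 * (F b - F a) = F (phi n a) - F (phi n b).
    by rewrite !qmark_phi//; ring.
  apply: sint_near => //.
    by apply: cts_onS uc; lra.
  move=> x /andP[x1 x2]; apply: le_trans (uK _ _ _ _) _; try by apply/andP; split; lra.
  by rewrite ler_wpM2l// ler0_norm; lra.
have h2 : `|sint F a b (fun x => u (phi n x)) - u (phi n a) * (F b - F a)| <=
    K * (b - a) * (F b - F a).
  apply: sint_near => //.
    by apply: (@cts_onS _ 0 1); [lra|lra|exact: cts_on_phi].
  move=> x /andP[x1 x2]; have x0 : 0 <= x by lra.
  have /andP[px0 px1] := phi_itv n x0.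
  apply: le_trans (uK _ _ _ _) _; try by apply/andP; split; lra.
  rewrite ler_wpM2l//; apply: le_trans (phi_lip n x0 a0) _.
  by rewrite ger0_norm; lra.
have e1 := exp2_gt0 R n.+1.
have e2 : 2 ^- n.+1 <= 1 :> R by rewrite invf_le1 ?exprn_gt0// exprn_ege1// ler1n.
have KF : 0 <= K * (b - a) * (F b - F a) by rewrite !mulr_ge0//; lra.
have -> : D a b = (sint F (phi n b) (phi n a) u - u (phi n a) * (2 ^- n.+1 * (F b - F a))) -
  2 ^- n.+1 * (sint F a b (fun x => u (phi n x)) - u (phi n a) * (F b - F a)).
  by rewrite /D; ring.
apply: le_trans (ler_normB _ _) _; rewrite normrM (gtr0_norm e1).
move: h1 h2; set A := `|sint _ _ _ u - _|; set B := `|sint _ _ _ _ - _|.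
have -> : K * (b - a) * (2 ^- n.+1 * (F b - F a)) = 2 ^- n.+1 * (K * (b - a) * (F b - F a)) by ring.
move: KF; set T := K * (b - a) * (F b - F a) => T0 h1 h2.
have -> : 2 * K * (b - a) * (F b - F a) = 2 * T by rewrite /T; ring.
have : 2 ^- n.+1 * B <= 2 ^- n.+1 * T by rewrite ler_wpM2l// ltW.
have : 2 ^- n.+1 * T <= 1 * T by rewrite ler_wpM2r.
lra.
Qed.

Let D_cat a m b : cts_on 0 1 u -> 0 <= a -> a <= m -> m <= b -> b <= 1 ->
  D a b = D a m + D m b.
Proof.
move=> uc a0 am mb b1; have m0 : 0 <= m by lra.
have pam := phi_le n a0 am; have pmb := phi_le n m0 mb.
have b0 : 0 <= b by lra.
have /andP[pa0 pa1] := phi_itv n a0; have /andP[pb0 pb1] := phi_itv n b0.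
rewrite /D (@sint_cat _ _ (phi n b) (phi n m)) //; last by apply: cts_onS uc; lra.
rewrite (@sint_cat _ _ a m) //; last by apply: (@cts_onS _ 0 1); [lra|lra|exact: cts_on_phi].
ring.
Qed.

(* Both sides are additive in the interval and agree to second order, hence
   they agree: no change of variables for measures is needed. *)
Lemma sint_phi : cts_on 0 1 u -> 0 <= K ->
  (forall x y, 0 <= x <= 1 -> 0 <= y <= 1 -> `|u x - u y| <= K * `|x - y|) ->
  sint F (phi n 1) (phi n 0) u = 2 ^- n.+1 * sint F 0 1 (fun x => u (phi n x)).
Proof.
move=> uc K0 uK; apply/eqP; rewrite -subr_eq0 -/(D 0 1) -normr_le0.
apply/ler_addgt0Pr => e e0; rewrite add0r.
pose N := (Num.bound (2 * K / e)).+1.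
have N0 : 0 < N%:R :> R by rewrite ltr0n.
have NK : 2 * K / N%:R <= e.
  have /archi_boundP h : 0 <= 2 * K / e by rewrite divr_ge0 ?(ltW e0)// mulr_ge0.
  rewrite ler_pdivrMr// (mulrC e) -ler_pdivrMr//; apply: le_trans (ltW h) _.
  by rewrite ler_nat leqnSn.
(* Each of [N] equal pieces costs [2 * K / N] times its mass, and the masses telescope. *)
have step k : (k <= N)%N -> `|D 0 (k%:R / N%:R)| <= 2 * K / N%:R * (F (k%:R / N%:R) - F 0).
  elim: k => [_|k IH kN].
    by rewrite mul0r; have := D_small uc K0 uK (lexx 0) (lexx 0) ler01; rewrite !subrr !mulr0.
  have {}IH := IH (ltnW kN).
  have k0 : 0 <= k%:R / N%:R :> R by rewrite divr_ge0.
  have kS : k%:R / N%:R <= k.+1%:R / N%:R :> R by rewrite ler_pM2r ?invr_gt0// ler_nat.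
  have k1 : k.+1%:R / N%:R <= 1 :> R by rewrite ler_pdivrMr// mul1r ler_nat.
  rewrite (D_cat uc (lexx 0) k0 kS k1); apply: le_trans (ler_normD _ _) _.
  have := D_small uc K0 uK k0 kS k1.
  have -> : k.+1%:R / N%:R - k%:R / N%:R = N%:R^-1 :> R.
    by rewrite -mulrBl -natr1 addrAC subrr add0r mul1r.
  lra.
have := step N (leqnn _); rewrite divff ?gt_eqF// qmark1 qmark0 subr0 => h.
have T0 : 0 <= 2 * K / N%:R by rewrite divr_ge0 ?mulr_ge0// ltW.
by apply: le_trans h _; lra.
Qed.

End change_of_variable.

(** The images of the first [N] branches tile []phi N 0, 1]], and the remaining []0, phi N 0]] has
    mass [2 ^- N.+1]. Here [v] is the transform of [u], given through its partial sums. *)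
Lemma sint_gauss u v K M : cts_on 0 1 u -> cts_on 0 1 v -> 0 <= K ->
  (forall x y, 0 <= x <= 1 -> 0 <= y <= 1 -> `|u x - u y| <= K * `|x - y|) ->
  (forall x, 0 <= x <= 1 -> `|u x| <= M) ->
  (forall N x, 0 <= x <= 1 ->
     `|v x - \sum_(0 <= n < N) 2 ^- n.+1 * u (phi n x)| <= M * 2 ^- N) ->
  sint F 0 1 v = sint F 0 1 u.
Proof.
move=> uc vc K0 uK uM vM.
have tail N : sint F 0 1 u = \sum_(0 <= n < N) 2 ^- n.+1 * sint F 0 1 (fun x => u (phi n x)) +
    sint F 0 (phi N 0) u.
  elim: N => [|N IH]; first by rewrite big_geq// add0r /phi add0r invr1.
  rewrite big_nat_recr//= IH -addrA -(sint_phi N uc K0 uK) phi1; congr (_ + _).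
  have /andP[p0 p1] := phi_itv N.+1 (lexx 0); have /andP[p0' p1'] := phi_itv N (lexx 0).
  rewrite addrC; apply: sint_cat; [exact: ltW| |by apply: cts_onS uc; lra].
  by rewrite -phi1; apply: phi_le.
have main N : cts_on 0 1 (fun x => \sum_(0 <= n < N) 2 ^- n.+1 * u (phi n x)) /\
   sint F 0 1 (fun x => \sum_(0 <= n < N) 2 ^- n.+1 * u (phi n x)) =
   \sum_(0 <= n < N) 2 ^- n.+1 * sint F 0 1 (fun x => u (phi n x)).
  elim: N => [|N [IHc IH]].
    have -> : (fun x => \sum_(0 <= n < 0) 2 ^- n.+1 * u (phi n x)) = fun=> 0.
      by apply/funext => x; rewrite big_geq.
    by rewrite big_geq// sint_cst ?mul0r//; split => //; exact: cts_on_cst.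
  have -> : (fun x => \sum_(0 <= n < N.+1) 2 ^- n.+1 * u (phi n x)) =
     (fun x => \sum_(0 <= n < N) 2 ^- n.+1 * u (phi n x) + 2 ^- N.+1 * u (phi N x)).
    by apply/funext => x; rewrite big_nat_recr.
  have c1 : cts_on 0 1 (fun x => 2 ^- N.+1 * u (phi N x)) by apply: cts_onZ; exact: cts_on_phi.
  split; first exact: cts_onD.
  by rewrite big_nat_recr//= sintD// IH sintZ//; exact: cts_on_phi.
have M0 : 0 <= M by apply: le_trans (uM 0 _); rewrite ?lexx ?ler01.
apply/eqP; rewrite -subr_eq0 -normr_le0; apply: (@le_pow2 R (2 * M)) => N.
rewrite add0r; have [Sc SE] := main N.
have -> : sint F 0 1 v - sint F 0 1 u =
   sint F 0 1 (fun x => v x + -1 * \sum_(0 <= n < N) 2 ^- n.+1 * u (phi n x)) - sint F 0 (phi N 0) u.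
  by rewrite sintD ?sintZ// ?SE ?(tail N); [ring|exact: cts_onZ].
have /andP[p0 p1] := phi_itv N (lexx 0).
have h1 : `|sint F 0 1 (fun x => v x + -1 * \sum_(0 <= n < N) 2 ^- n.+1 * u (phi n x))| <=
    M * 2 ^- N * (F 1 - F 0).
  apply: sint_bound => //; first by apply: cts_onD => //; exact: cts_onZ.
  by move=> x /andP[x0 x1]; rewrite mulN1r; apply: vM; rewrite ltW.
have h2 : `|sint F 0 (phi N 0) u| <= M * (F (phi N 0) - F 0).
  apply: sint_bound; [exact: ltW|by apply: cts_onS uc; lra|].
  by move=> x /andP[x0 x1]; apply: uM; apply/andP; split; lra.
rewrite qmark1 qmark0 subr0 in h1; rewrite qmark_phi// qmark0 !subr0 mulr1 in h2.
apply: le_trans (ler_normB _ _) _.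
have := exp2S R N; have := exp2_gt0 R N.+1 => ? e.
have T0 : 0 <= M * 2 ^- N.+1 by rewrite mulr_ge0// ltW.
rewrite e in h1 *; move: h1 h2 T0.
move: (`|sint F 0 1 _|) (`|sint F 0 (phi N 0) u|) (2 ^- N.+1) => A B w; clear => *; lra.
Qed.

(** The point 0 has no mass, since [qmark] vanishes on the negative reals and at 0. *)
Lemma Stieltjes_sint u : cts_on 0 1 u -> Stieltjes u = sint F 0 1 u.
Proof.
move=> uc; have mu0 : mu [set 0 : R] = 0%E.
  apply/eqP; rewrite eq_le measure_ge0 andbT.
  apply: (@le_trans _ _ (mu `]-1, 0]%classic)).
    apply: le_measure; rewrite ?inE; [exact: measurable_set1|exact: measurable_itv|].
    by move=> x ->; rewrite /= in_itv /= lexx andbT; lra.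
  rewrite mu_ocitv; last lra.
  by rewrite /= qmark0 /qmark ltrN10 subr0.
have I01 : (`[0, 1] : set R)%classic = [set 0] `|` `]0, 1]%classic.
  by rewrite setU1itv// bnd_simp.
have S0 : Rintegral mu [set 0] u = 0.
  transitivity (u 0 * fine (mu [set 0])); last by rewrite mu0 mulr0.
  rewrite (@eq_Rintegral _ _ _ _ _ (cst (u 0))); last by move=> x; rewrite inE /= => ->.
  exact: (@Rintegral_cst _ _ _ mu _ (measurable_set1 (0 : R)) (u 0)).
rewrite /Stieltjes I01 Rintegral_setU.
- by rewrite S0 add0r.
- exact: measurable_set1.
- exact: moc.
- by rewrite -I01; exact: cts_on_integrable_cc.
- by apply/disj_setPS => x [/= ->]; rewrite in_itv /= ltxx.
Qed.

End qmark_invariance.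

(** * Exactness *)

Section exactness.
Local Open Scope complex_scope.
Variable R : realType.
Implicit Types (g h : R[i] -> R[i]) (z w : R[i]) (x y a K M : R) (n k N : nat).
Local Notation F := (@qmark R).

Definition extends g (f : disk R -> R[i]) := forall z : disk R, f z = g (val z).

Lemma vreg_stable a : 0 < a -> a <= 10^-1 -> gauss_stable (vreg a).
Proof.
move=> a0 a1 z Vz; split; last by move=> n; exact: vreg_inv.
by have := vreg_Re Vz; lra.
Qed.

Lemma disk_stable : gauss_stable (disk R).
Proof.
move=> z Dz; split; last by move=> n; exact: disk_inv.
by have := disk_Re_ge0 Dz; lra.
Qed.

Lemma real_disk x : 0 <= x <= 1 -> disk R x%:C.
Proof.
move=> /andP[x0 x1]; apply/diskE; rewrite -rmorphB nc_real ler_norml.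
by apply/andP; split; lra.
Qed.

Lemma vreg_bounded a z : 0 < a -> a <= 10^-1 -> vreg a z -> nc z <= 3.
Proof.
move=> a0 a1; rewrite /vreg /=; set c := (2 * (1 - a))^-1 => h.
have c1 : 0 <= c <= 1.
  apply/andP; split; first by rewrite invr_ge0; lra.
  by rewrite invf_le1; lra.
have := ncD (z - c%:C) c%:C; rewrite subrK nc_real ger0_norm; lra.
Qed.

(** [gop] shrinks [K] but merely preserves [M]; decay of the values comes from [mean_zero_bound]. *)
Definition lip_holo a K M g :=
  [/\ forall z, vreg a z -> exists d, cdiff g z d, lip_on (vreg a) K g &
      bounded_on (vreg a) M g].

Lemma Comega_extends (f : Comega R) : exists a K M g,
  [/\ 0 < a /\ a <= 10^-1, 0 < K, lip_holo a K M g & extends g f].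
Proof.
have /asboolP[U [g [oU DU dg fg]]] := valP f.
have [a [K [/andP[a0 a1] K0 VU gK]]] := lipschitz_near_disk oU DU dg.
exists a, K, (nc (g 0) + K * 3), g; split => //; split => //.
  by move=> z /VU /dg /derivable_cdiff.
have V0 : vreg a 0 by apply: disk_vreg => //; apply: (@real_disk 0); rewrite lexx ler01.
move=> z Vz; have := gK z 0 Vz V0; rewrite subr0.
have : K * nc z <= K * 3 by rewrite ler_pM2l//; exact: vreg_bounded Vz.
by have := ncD (g z - g 0) (g 0); rewrite subrK; lra.
Qed.

Lemma extends_Comega (f : disk R -> R[i]) a g : 0 < a -> a <= 10^-1 ->
  (forall z, vreg a z -> exists d, cdiff g z d) -> extends g f -> Comega_pred f.
Proof.
move=> a0 a1 gd fg; apply/asboolP; exists (vreg a), g; split => //.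
- by rewrite openE => z /vreg_open h; apply/nbhs_cP.
- by move=> z; exact: disk_vreg.
- by move=> z /gd /derivable_cdiff.
Qed.

Lemma calLE (f : Comega R) g : extends g f -> forall z : disk R,
  calL f z = g (val z) - gop g (val z).
Proof.
move=> fg z; rewrite /calL fg; congr (_ - limn (series _)).
by apply/funext => n; rewrite fg.
Qed.

Lemma lip_holo_gop a K M g : 0 < a -> a <= 10^-1 -> 0 <= K ->
  lip_holo a K M g -> lip_holo a (4 / 5 * K) M (gop g).
Proof.
move=> a0 a1 K0 [gd gK gM]; have Vst := vreg_stable a0 a1; split.
- by apply: (gop_cdiff Vst _ gM K0 gK gd) => z; exact: vreg_open.
- exact: (gop_lip Vst gM K0 gK).
- exact: (gop_bounded Vst gM).
Qed.

Lemma cdiffB g h z d d' : cdiff g z d -> cdiff h z d' ->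
  cdiff (fun w => g w - h w) z (d - d').
Proof.
move=> gd hd; have := cdiffD gd (cdiffM (cdiff_cst (-1) z) hd).
rewrite mul0r add0r mulN1r; congr cdiff.
by apply/funext => w; rewrite mulN1r.
Qed.

Lemma calL_Comega (f : Comega R) : Comega_pred (calL f).
Proof.
have [a [K [M [g [[a0 a1] K0 gh fg]]]]] := Comega_extends f.
apply: (@extends_Comega _ a (fun z => g z - gop g z)) => //; last exact: calLE.
have [gd _ _] := gh; have [Gd _ _] := lip_holo_gop a0 a1 (ltW K0) gh.
move=> z Vz; have [d dP] := gd z Vz; have [d' dP'] := Gd z Vz.
by exists (d - d'); exact: cdiffB.
Qed.

Definition calL_op (f : Comega R) : Comega R := exist _ (calL f) (calL_Comega f).

Lemma bounded_on_disk a M g : 0 < a -> a <= 10^-1 ->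
  bounded_on (vreg a) M g -> bounded_on (disk R) M g.
Proof. by move=> a0 a1 gM z /(disk_vreg a0 a1) /gM. Qed.

Fact calL_linear : linear calL_op.
Proof.
move=> c f1 f2; apply/val_inj/funext => z.
have [a [K [M [g [[a0 a1] K0 [_ _ gM] fg]]]]] := Comega_extends f1.
have [a' [K' [M' [g' [[a0' a1'] K0' [_ _ gM'] fg']]]]] := Comega_extends f2.
(* The two extensions live on different regions, so the comparison takes place on the disk. *)
have {}gM := bounded_on_disk a0 a1 gM; have {}gM' := bounded_on_disk a0' a1' gM'.
have cgM : bounded_on (disk R) (nc c * M) (fun z => c * g z).
  by move=> w /gM h; rewrite ncM ler_wpM2l ?nc_ge0.
have Dz : disk R (val z) := set_valP z.
have fgE : extends (fun z => c * g z + g' z) (c *: f1 + f2 : Comega R).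
  by move=> w; rewrite -fg -fg'.
change (calL (c *: f1 + f2) z = c * calL f1 z + calL f2 z).
rewrite (calLE fgE) (calLE fg) (calLE fg').
rewrite (gopD disk_stable cgM gM' Dz) (gopZ disk_stable _ gM Dz); ring.
Qed.

HB.instance Definition _ :=
  GRing.isLinear.Build R[i] (Comega R) (Comega R) *:%R calL_op calL_linear.

Lemma gop_cst (c : R[i]) z : disk R z -> gop (fun=> c) z = c.
Proof.
move=> Dz; have cM : bounded_on (disk R) (nc c) (fun=> c) by [].
have S N : series (gterm (fun=> c) z) N = c - 2 ^- N * c.
  elim: N => [|N IH]; first by rewrite series_at0 expr0 invr1 mul1r subrr.
  by rewrite seriesSr IH /gterm exprS; field; rewrite expf_neq0.
apply/eqP; rewrite -subr_eq0 -nc_eq0 eq_le nc_ge0 andbT.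
apply: (@le_pow2 R (2 * nc c)) => N; rewrite add0r.
have := (gop_cvg disk_stable cM Dz).2 N; rewrite S => h.
have -> : gop (fun=> c) z - c = (gop (fun=> c) z - (c - 2 ^- N * c)) - 2 ^- N * c by ring.
by apply: le_trans (ncD _ _) _; rewrite ncN ncM nc_exp2; lra.
Qed.

Lemma ccont_real a b g : (forall x, a <= x <= b -> ccont g x%:C) ->
  ccts_on a b (fun x => g x%:C).
Proof.
move=> gc x /gc + e e0 => /(_ e e0)[r r0 H]; exists r => // y yx.
by apply: H; rewrite -rmorphB nc_real.
Qed.

Lemma lip_holo_real a K M g : 0 < a -> a <= 10^-1 -> lip_holo a K M g ->
  ccts_on 0 1 (fun x => g x%:C).
Proof.
move=> a0 a1 [gd _ _]; apply: ccont_real => x /real_disk /(disk_vreg a0 a1) /gd[d].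
exact: cdiff_cont.
Qed.

Lemma calTE (f : Comega R) g : ccts_on 0 1 (fun x => g x%:C) -> extends g f ->
  calT f = cint F 0 1 (fun x => g x%:C).
Proof.
move=> gc fg; have fE x : 0 <= x <= 1 -> on_real f x = g x%:C.
  move=> /real_disk Dx.
  by rewrite (@on_realE _ _ (exist (fun w => w \in disk R) _ (mem_set Dx))).
rewrite /calT /cint -!Stieltjes_sint; [|exact: ccts_on_Im|exact: ccts_on_Re].
by congr (_ +i* _); apply: eq_Rintegral => x; rewrite inE /= in_itv /= => /fE ->.
Qed.

(** [p] stands for the real or the imaginary part. *)
Lemma sint_gop (p : R[i] -> R) a K M g : 0 < a -> a <= 10^-1 -> 0 <= K ->
  (forall z w, p (z + w) = p z + p w) -> (forall x z, p (x%:C * z) = x * p z) ->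
  (forall z, `|p z| <= nc z) -> lip_holo a K M g ->
  cts_on 0 1 (fun x => p (g x%:C)) -> cts_on 0 1 (fun x => p (gop g x%:C)) ->
  sint F 0 1 (fun x => p (gop g x%:C)) = sint F 0 1 (fun x => p (g x%:C)).
Proof.
move=> a0 a1 K0 pD pZ pnc [_ gK gM] gc Gc.
have Vx x : 0 <= x <= 1 -> vreg a x%:C by move=> /real_disk /(disk_vreg a0 a1).
have pB z w : p (z - w) = p z - p w.
  have -> : z - w = z + (-1)%:C * w by rewrite rmorphN1 mulN1r.
  by rewrite pD pZ mulN1r.
apply: (@sint_gauss _ _ _ K M) => //.
- move=> x y /Vx Vx0 /Vx Vy; rewrite -pB; apply: le_trans (pnc _) _.
  by apply: le_trans (gK _ _ Vx0 Vy) _; rewrite -rmorphB nc_real.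
- by move=> x /Vx Vx0; apply: le_trans (pnc _) (gM _ Vx0).
move=> N x /Vx Vx0; have := (gop_cvg (vreg_stable a0 a1) gM Vx0).2 N.
apply: le_trans; apply: le_trans (pnc _); rewrite pB.
suff -> : p (series (gterm g x%:C) N) = \sum_(0 <= n < N) 2 ^- n.+1 * p (g (phi n x)%:C) by [].
elim: N => [|N IH].
  by rewrite series_at0 big_geq//; have := pZ 0 0; rewrite mulr0 mul0r.
rewrite seriesSr pD IH big_nat_recr//=; congr (_ + _).
have -> : gterm g x%:C N = (2 ^- N.+1)%:C * g (phi N x)%:C.
  have -> : (2 ^- N.+1)%:C = 2 ^- N.+1 :> R[i] by rewrite fmorphV rmorphXn /= rmorph_nat.
  by have -> : (phi N x)%:C = (x%:C + N.+1%:R)^-1; [rewrite fmorphV rmorphD /= rmorph_nat|].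
exact: pZ.
Qed.

Lemma cint_gop a K M g : 0 < a -> a <= 10^-1 -> 0 <= K -> lip_holo a K M g ->
  cint F 0 1 (fun x => gop g x%:C) = cint F 0 1 (fun x => g x%:C).
Proof.
move=> a0 a1 K0 gh; have gc := lip_holo_real a0 a1 gh.
have Gc := lip_holo_real a0 a1 (lip_holo_gop a0 a1 K0 gh).
congr (_ +i* _); apply: (sint_gop a0 a1 K0 _ _ _ gh);
  first [exact: ccts_on_Re|exact: ccts_on_Im|exact: nc_Re|exact: nc_Im|idtac].
- by move=> [? ?] [? ?].
- by move=> x [? ?] /=; rewrite mul0r subr0.
- by move=> [? ?] [? ?].
- by move=> x [? ?] /=; rewrite mul0r addr0.
Qed.

(** [g z] times the total mass 1/2 is the integral of [g z - g x], and [z] is within 4 of every [x]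
    in [[0, 1]]. *)
Lemma mean_zero_bound a K M g : 0 < a -> a <= 10^-1 -> 0 <= K -> lip_holo a K M g ->
  cint F 0 1 (fun x => g x%:C) = 0 -> bounded_on (vreg a) (16 * K) g.
Proof.
move=> a0 a1 K0 gh g0 z Vz; have gc := lip_holo_real a0 a1 gh.
have [_ gK _] := gh.
have cc := @ccts_on_cst R 0 1 (g z).
have := @cint_cst R F 0 1 (g z) ler01.
rewrite /= qmark1 qmark0 subr0 => zE.
have : cint F 0 1 (fun x => g z - g x%:C) = g z * (2^-1)%:C.
  by rewrite cintB// g0 subr0.
have h : nc (cint F 0 1 (fun x => g z - g x%:C)) <= 2 * (K * 4) * (F 1 - F 0).
  apply: cint_bound => //; first exact: ccts_onB.
  move=> x /andP[x0 x1]; have x01 : 0 <= x <= 1 by rewrite (ltW x0).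
  apply: le_trans (gK _ _ Vz (disk_vreg a0 a1 (real_disk x01))) _.
  apply: ler_wpM2l => //; apply: le_trans (ncD _ _) _; rewrite ncN nc_real (ger0_norm (ltW x0)).
  by have := vreg_bounded a0 a1 Vz; lra.
move=> e; move: h; rewrite e ncM nc_real ger0_norm ?invr_ge0// qmark1 qmark0; lra.
Qed.

End exactness.

Section iterates.
Local Open Scope complex_scope.

Lemma gauss_iterates (R : realType) (a K M : R) (g : R[i] -> R[i]) :
  0 < a -> a <= 10^-1 -> 0 <= K -> lip_holo a K M g ->
  cint (@qmark R) 0 1 (fun x => g x%:C) = 0 ->
  forall k, lip_holo a (K * (4 / 5) ^+ k) M (iter k (@gop R) g) /\
    cint (@qmark R) 0 1 (fun x => iter k (@gop R) g x%:C) = 0.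
Proof.
move=> a0 a1 K0 gh g0; elim=> [|k [IH IH0]]; first by rewrite expr0 mulr1.
have Kq : 0 <= K * (4 / 5) ^+ k by rewrite mulr_ge0 ?exprn_ge0//; lra.
split; first by have := lip_holo_gop a0 a1 Kq IH; rewrite exprS mulrCA.
by rewrite iterS (cint_gop a0 a1 Kq IH).
Qed.

End iterates.

Theorem theorem4 (R : realType) :
  exists L : {linear Comega R -> Comega R},
    (forall (f : Comega R) (z : disk R), (L f : Comega R) z = calL f z) /\
    [/\ injective (cst_incl R),
        range (cst_incl R) = [set f : Comega R | L f = 0],
        range L = [set f : Comega R | calT f = 0] &
        forall c : R[i], exists f : Comega R, calT f = c].
Proof.
exists (@calL_op R); split; first by [].
have D0 : disk R 0 by apply: (@real_disk R 0); rewrite lexx ler01.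
pose d0 : disk R := exist (fun w => w \in disk R) _ (mem_set D0).
have cstE (c : R[i]) : extends (fun=> c) (cst_incl R c) by [].
split.
- by move=> c d /(congr1 (fun f : Comega R => f d0)).
- apply/seteqP; split => f /=.
    move=> [c _ <-]; apply/val_inj/funext => z.
    change (calL (cst_incl R c) z = 0).
    by rewrite (calLE (cstE c)) (gop_cst _ (set_valP z)) subrr.
  move=> Lf0; have [a [K [M [g [[a0 a1] K0 [gd gK gM] fg]]]]] := Comega_extends f.
  exists (g 0) => //; apply/val_inj/funext => z.
  change (g 0 = (f : Comega R) z); rewrite fg.
  have DV := disk_vreg a0 a1.
  (* On the disk and not on [vreg a]: the hypothesis [L f = 0] is an equation on the disk. *)
  apply: (@gop_fixed_cst R (disk R) g M K (@disk_stable R)) => //.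
  + by move=> w /DV /gM.
  + exact: ltW.
  + by move=> u w /DV Vu /DV Vw; exact: gK.
  + move=> w Dw; pose dw : disk R := exist (fun w => w \in disk R) _ (mem_set Dw).
    have := congr1 (fun f : Comega R => f dw) Lf0.
    change (calL f dw = 0 -> g w = gop g w).
    by rewrite (calLE fg) => /eqP; rewrite subr_eq0 => /eqP.
  + exact: set_valP.
- apply/seteqP; split => f /=.
    move=> [h _ <-]; have [a [K [M [g [[a0 a1] K0 gh fg]]]]] := Comega_extends h.
    have gc := lip_holo_real a0 a1 gh.
    have Gc := lip_holo_real a0 a1 (lip_holo_gop a0 a1 (ltW K0) gh).
    rewrite (@calTE _ _ (fun z => g z - gop g z)); [|exact: ccts_onB|exact: calLE].
    by rewrite cintB// (cint_gop a0 a1 (ltW K0) gh) subrr.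
  move=> Tf0; have [a [K [M [g [[a0 a1] K0 gh fg]]]]] := Comega_extends f.
  have gc := lip_holo_real a0 a1 gh.
  have g0 := etrans (esym (calTE gc fg)) Tf0.
  have iters := gauss_iterates a0 a1 (ltW K0) gh g0.
  have Vst := vreg_stable a0 a1.
  have [h [hd [M' hM] hE]] : exists h, [/\ forall z, vreg a z -> exists d, cdiff h z d,
      (exists M, bounded_on (vreg a) M h) & forall z, vreg a z -> h z - gop h z = g z].
    apply: (@neumann R (vreg a) Vst _ g (16 * K) K).
    + by move=> z; exact: vreg_open.
    + by rewrite mulr_ge0// ltW.
    + exact: ltW.
    + by move=> k; have [[]] := iters k.
    + by move=> k; have [[]] := iters k.
    + move=> k; have [ih i0] := iters k; rewrite -mulrA.
      apply: (mean_zero_bound a0 a1 _ ih i0).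
      by rewrite mulr_ge0 ?exprn_ge0 ?(ltW K0)//; lra.
  have hC : Comega_pred (fun z : disk R => h (val z)) by exact: (extends_Comega a0 a1 hd).
  pose hc : Comega R := exist (fun f => Comega_pred f) _ hC.
  exists hc => //; apply/val_inj/funext => z; change (calL hc z = (f : Comega R) z).
  have hcE : extends h hc by [].
  rewrite (calLE hcE) fg; apply: hE.
  exact: (disk_vreg a0 a1 (set_valP z)).
(* The total mass is [F 1 - F 0 = 1/2], whence the factor 2. *)
- move=> c; exists (cst_incl R (2 * c)).
  rewrite (@calTE _ _ (fun=> 2 * c))//; last exact: ccts_on_cst.
  rewrite cint_cst//= qmark1 qmark0 subr0 fmorphV rmorph_nat.
  by rewrite mulrAC divff ?mul1r// pnatr_eq0.
Qed.
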